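(* Let $p$ be a prime with $p\equiv 5 \pmod 6$, let $\sigma=(a_1,a_2,a_3,a_4)\in \mathbf{Z}_p^4$, and let $g_\sigma(x)=a_4+a_3x+a_2x^2-a_1x^3$ be the polynomial attached to $\sigma$. Assume that the reduction of $g_\sigma$ modulo $p$ is an irreducible cubic polynomial over $\mathbf{Z}/p\mathbf{Z}$. Let $\psi:\mathbf{Q}_p\to\mathbf{C}^\times$ be a continuous homomorphism which is trivial on $\mathbf{Z}_p$ but not on $p^{-1}\mathbf{Z}_p$. Then, for every $s\in\mathbf{C}$ for which the integral $$I^{\sigma}_p(s,f_{s,p}^\circ)=\int_{\mathbf{Q}_p^5} f_{s,p}^\circ\big(w_0\,n(x,y,z,u,v)\big)\,\psi(a_1x+a_2y+a_3u+a_4v)\,dx\,dy\,dz\,du\,dv$$ converges absolutely, $$I^{\sigma}_p(s,f_{s,p}^\circ)=(1-p^{-3s})(1-p^{-3s+1})(1-p^{-6s+2}).$$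
   Context: Integrals over $\mathbf{Q}_p^5$ use the product of the additive Haar measures on $\mathbf{Q}_p$ normalized so that $\mathbf{Z}_p$ has measure $1$; $|\cdot|_p$ is the absolute value with $|p|_p=p^{-1}$. For a commutative ring $R$ and $x,y,z,u,v\in R$ put $$n(x,y,z,u,v)=\begin{pmatrix} 1 & 0 & -u & -y & -y & -x & vx+2uy-z & -ux-y^2\\ 0&1&v&u&u&-y&-u^2+vy&-uy+z\\ 0&0&1&0&0&0&y&x\\ 0&0&0&1&0&0&-u&y\\ 0&0&0&0&1&0&-u&y\\ 0&0&0&0&0&1&-v&u\\ 0&0&0&0&0&0&1&0\\ 0&0&0&0&0&0&0&1\end{pmatrix},$$ $$n^-(x,y,z,u,v)=\begin{pmatrix} 1&0&0&0&0&0&0&0\\ 0&1&0&0&0&0&0&0\\ -y&x&1&0&0&0&0&0\\ -u&y&0&1&0&0&0&0\\ -u&y&0&0&1&0&0&0\\ -v&-u&0&0&0&1&0&0\\ vx+2uy-z&ux-y^2&u&-y&-y&-x&1&0\\ -u^2-vy&-uy+z&v&u&u&y&0&1\end{pmatrix}.$$ For $g=\begin{pmatrix}a&b\\c&d\end{pmatrix}\in GL_2(R)$ with $\Delta=ad-bc$, let $m(g)\in GL_8(R)$ be the block diagonal matrix with diagonal blocks $$\begin{pmatrix}a&b\\c&d\end{pmatrix},\qquad \frac1\Delta\begin{pmatrix}a^2&ab&ab&-b^2\\ ac&ad&bc&-bd\\ ac&bc&ad&-bd\\ -c^2&-cd&-cd&d^2\end{pmatrix},\qquad \frac1\Delta\begin{pmatrix}a&-b\\-c&d\end{pmatrix}.$$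 Let $N(\mathbf{Q}_p)$, $N^-(\mathbf{Q}_p)$, $M(\mathbf{Q}_p)$ be the subgroups of $GL_8(\mathbf{Q}_p)$ of all matrices $n(x,y,z,u,v)$, all $n^-(x,y,z,u,v)$, and all $m(g)$, respectively, with entries in $\mathbf{Q}_p$. The group $G_2(\mathbf{Q}_p)\subset GL_8(\mathbf{Q}_p)$ is the group of $\mathbf{Q}_p$-points of the split exceptional group of type $G_2$ in this realization, i.e. the subgroup generated by $N(\mathbf{Q}_p)$, $N^-(\mathbf{Q}_p)$ and $M(\mathbf{Q}_p)$; and $G_2(\mathbf{Z}_p)=G_2(\mathbf{Q}_p)\cap GL_8(\mathbf{Z}_p)$. Every element of $G_2(\mathbf{Q}_p)$ can be written $n\,m(g)\,k$ with $n\in N(\mathbf{Q}_p)$, $g\in GL_2(\mathbf{Q}_p)$, $k\in G_2(\mathbf{Z}_p)$, and $f_{s,p}^\circ:G_2(\mathbf{Q}_p)\to\mathbf{C}$ is the well-defined function $$f_{s,p}^\circ(n\,m(g)\,k)=|\det g|_p^{3s}.$$ The element $w_0\in G_2(\mathbf{Z}_p)$ is the matrix with entries $(w_0)_{17}=(w_0)_{28}=(w_0)_{71}=(w_0)_{82}=1$, $(w_0)_{33}=(w_0)_{66}=-1$, $(w_0)_{44}=(w_0)_{55}=1$, and all other entries $0$. *)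

(* Defs.v *)
From HB Require Import structures.
From mathcomp Require Import all_boot all_order all_algebra.
From mathcomp Require Import all_classical all_reals all_analysis.
From mathcomp Require Import complex.
Import Order.TTheory GRing.Theory Num.Theory.
Import numFieldNormedType.Exports.

Set Implicit Arguments.
Unset Strict Implicit.
Unset Printing Implicit Defensive.

Local Open Scope classical_set_scope.
Local Open Scope ring_scope.
Local Open Scope complex_scope.

(* Q_p as the completion of the rationals for the p-adic absolute value: a
   field, complete for a multiplicative ultrametric absolute value with
   |p| = 1/p, in which the rationals are dense.  For p prime, such an absolute
   value restricts to the p-adic one on the rationals, so a padicField R p is
   Q_p up to a unique isometric isomorphism. *)
Record padicField (R : realType) (p : nat) := PadicField {
  padic_carrier : fieldType ;
  padic_abs : padic_carrier -> R ;
  padic_abs_ge0 : forall x, 0 <= padic_abs x ;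
  padic_abs_eq0 : forall x, padic_abs x = 0 <-> x = 0 ;
  padic_absM : forall x y, padic_abs (x * y) = padic_abs x * padic_abs y ;
  padic_absD : forall x y,
    padic_abs (x + y) <= Num.max (padic_abs x) (padic_abs y) ;
  padic_abs_p : padic_abs p%:R = p%:R^-1 ;
  padic_complete : forall u : nat -> padic_carrier,
    (forall e : R, 0 < e -> exists N, forall m n, (N <= m)%N -> (N <= n)%N ->
       padic_abs (u m - u n) < e) ->
    exists l, forall e : R, 0 < e -> exists N, forall n, (N <= n)%N ->
      padic_abs (u n - l) < e ;
  padic_dense : forall (x : padic_carrier) (e : R), 0 < e ->
    exists q : rat, padic_abs (x - ratr q) < e
}.

Section Padic.
Context {R : realType} {p : nat}.
Variable K : padicField R p.

Definition Qp : Type := padic_carrier K.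
HB.instance Definition _ := GRing.Field.on Qp.

Definition absp (x : Qp) : R := padic_abs x.

Let distp (x y : Qp) : R := absp (x - y).

Let absp0 : absp 0 = 0.
Proof. exact/padic_abs_eq0. Qed.

Let abspN x : absp (- x) = absp x.
Proof.
have abs1 : absp 1 = 1.
  have n0 : absp 1 != 0.
    by apply/eqP => /padic_abs_eq0/eqP; rewrite oner_eq0.
  by apply: (mulfI n0); rewrite -[LHS]padic_absM !mulr1.
rewrite -mulN1r [LHS]padic_absM -[padic_abs _]/(absp (- 1)).
suff -> : absp (- 1) = 1 by rewrite mul1r.
apply/eqP; rewrite -(@eqrXn2 _ 2) ?padic_abs_ge0 ?ler01//.
by rewrite expr1n expr2 -[X in X == _]padic_absM mulrNN mulr1 -/(absp 1) abs1.
Qed.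

Let distpxx x : distp x x = 0.
Proof. by rewrite /distp subrr absp0. Qed.

Let distp_eq0 x y : distp x y = 0 -> x = y.
Proof. by move/padic_abs_eq0/eqP; rewrite subr_eq0 => /eqP. Qed.

Let distp_sym x y : distp x y = distp y x.
Proof. by rewrite /distp -abspN opprB. Qed.

Let distp_triangle y x z : distp x z <= distp x y + distp y z.
Proof.
rewrite /distp -[x - z](subrKA y).
rewrite (le_trans (padic_absD _ _))// ge_max.
by rewrite lerDl lerDr !padic_abs_ge0.
Qed.

HB.instance Definition _ := isPointed.Build Qp 0.
HB.instance Definition _ :=
  isMetric.Build R Qp distpxx distp_eq0 distp_sym distp_triangle.

Definition padic_int : set Qp := [set x | absp x <= 1].

(* The class of a in Z_p modulo p: the only c with a - c in p Z_p. *)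
Definition reduction (a : Qp) : 'F_p :=
  odflt 0 [pick c : 'F_p | absp (a - (c : nat)%:R) < 1].

(* Q_p with its Borel sigma-algebra *)
Definition borelQp := g_sigma_algebraType (@open Qp).
HB.instance Definition _ := Measurable.on borelQp.

Definition normalized_haar (mu : set borelQp -> \bar R) : Prop :=
  (forall (x : Qp) (A : set borelQp), measurable A ->
     mu [set x + a | a in (A : set Qp)] = mu A) /\
  mu padic_int = 1%E.

End Padic.

Arguments padic_int {R p K}.

Section ComplexAnalysis.
Context {R : realType}.

Definition cexp (z : R[i]) : R[i] :=
  (expR (complex.Re z) * cos (complex.Im z))
  +i* (expR (complex.Re z) * sin (complex.Im z)).

(* r ^ s for a positive real r and a complex s *)
Definition rpowc (r : R) (s : R[i]) : R[i] := cexp (s * (ln r)%:C).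

Context {d : measure_display} {T : measurableType d}.
Variable mu : {measure set T -> \bar R}.

Definition abs_convergent (F : T -> R[i]) : Prop :=
  [/\ measurable_fun setT (fun x => complex.Re (F x)),
      measurable_fun setT (fun x => complex.Im (F x)) &
      (\int[mu]_x (Normc.normc (F x))%:E < +oo)%E].

Definition cintegral (F : T -> R[i]) : R[i] :=
  (\int[mu]_x complex.Re (F x)) +i* (\int[mu]_x complex.Im (F x)).

End ComplexAnalysis.

Section Matrices.
Variable F : fieldType.

Definition rows_mx (m n : nat) (rows : seq (seq F)) : 'M[F]_(m, n) :=
  \matrix_(i, j) nth 0 (nth [::] rows i) j.

Definition n_mx (x y z u v : F) : 'M[F]_8 := rows_mx 8 8
  [:: [:: 1; 0; - u; - y; - y; - x; v * x + 2 * u * y - z; - u * x - y ^+ 2];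
      [:: 0; 1; v; u; u; - y; - u ^+ 2 + v * y; - u * y + z];
      [:: 0; 0; 1; 0; 0; 0; y; x];
      [:: 0; 0; 0; 1; 0; 0; - u; y];
      [:: 0; 0; 0; 0; 1; 0; - u; y];
      [:: 0; 0; 0; 0; 0; 1; - v; u];
      [:: 0; 0; 0; 0; 0; 0; 1; 0];
      [:: 0; 0; 0; 0; 0; 0; 0; 1]].

Definition nminus_mx (x y z u v : F) : 'M[F]_8 := rows_mx 8 8
  [:: [:: 1; 0; 0; 0; 0; 0; 0; 0];
      [:: 0; 1; 0; 0; 0; 0; 0; 0];
      [:: - y; x; 1; 0; 0; 0; 0; 0];
      [:: - u; y; 0; 1; 0; 0; 0; 0];
      [:: - u; y; 0; 0; 1; 0; 0; 0];
      [:: - v; - u; 0; 0; 0; 1; 0; 0];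
      [:: v * x + 2 * u * y - z; u * x - y ^+ 2; u; - y; - y; - x; 1; 0];
      [:: - u ^+ 2 - v * y; - u * y + z; v; u; u; y; 0; 1]].

Definition m_mx (g : 'M[F]_2) : 'M[F]_8 :=
  let a := g 0 0 in let b := g 0 1 in let c := g 1 0 in let d := g 1 1 in
  let D := a * d - b * c in
  block_mx (rows_mx 2 2 [:: [:: a; b]; [:: c; d]]) 0
           0 (block_mx
    (D^-1 *: rows_mx 4 4
      [:: [:: a ^+ 2; a * b; a * b; - b ^+ 2];
          [:: a * c; a * d; b * c; - (b * d)];
          [:: a * c; b * c; a * d; - (b * d)];
          [:: - c ^+ 2; - (c * d); - (c * d); d ^+ 2]]) 0
    0 (D^-1 *: rows_mx 2 2 [:: [:: a; - b]; [:: - c; d]])) : 'M[F]_(2 + (4 + 2)).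

Definition w0 : 'M[F]_8 := rows_mx 8 8
  [:: [:: 0; 0; 0; 0; 0; 0; 1; 0];
      [:: 0; 0; 0; 0; 0; 0; 0; 1];
      [:: 0; 0; -1; 0; 0; 0; 0; 0];
      [:: 0; 0; 0; 1; 0; 0; 0; 0];
      [:: 0; 0; 0; 0; 1; 0; 0; 0];
      [:: 0; 0; 0; 0; 0; -1; 0; 0];
      [:: 1; 0; 0; 0; 0; 0; 0; 0];
      [:: 0; 1; 0; 0; 0; 0; 0; 0]].

Definition N_set : set 'M[F]_8 :=
  [set h | exists x y z u v, h = n_mx x y z u v].

Definition Nminus_set : set 'M[F]_8 :=
  [set h | exists x y z u v, h = nminus_mx x y z u v].

Definition M_set : set 'M[F]_8 := [set m_mx g | g in [set g | g \in unitmx]].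

Definition is_subgroup (H : set 'M[F]_8) : Prop :=
  [/\ (forall h, H h -> h \in unitmx),
      H 1%:M,
      (forall h k, H h -> H k -> H (h *m k)) &
      (forall h, H h -> H (invmx h))].

(* the subgroup of GL_8(F) generated by N, N^- and M *)
Definition G2 : set 'M[F]_8 :=
  smallest is_subgroup (N_set `|` Nminus_set `|` M_set).

End Matrices.

Section Integral.
Context {R : realType} {p : nat}.
Variable K : padicField R p.
Local Notation Qp := (Qp K).
Local Notation borelQp := (borelQp K).
Local Notation borelQp5 := (borelQp * borelQp * borelQp * borelQp * borelQp)%type.

Definition GL8_Zp : set 'M[Qp]_8 :=
  [set h | [/\ h \in unitmx, forall i j, padic_int (h i j) &
               forall i j, padic_int (invmx h i j)]].

Definition G2_Zp : set 'M[Qp]_8 := @G2 Qp `&` GL8_Zp.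

(* The value at h = n m(g) k is |det g|^(3s), which does not depend on the
   decomposition; a matrix without such a decomposition lies outside G_2(Q_p)
   and gets the junk value 0. *)
Definition f_circ (s : R[i]) (h : 'M[Qp]_8) : R[i] :=
  xget 0 [set c | exists n g k,
    [/\ N_set n, g \in unitmx, G2_Zp k, h = n *m m_mx g *m k &
        c = rpowc (absp (\det g)) (3 * s)]].

Definition g_sigma (a1 a2 a3 a4 : Qp) : {poly Qp} :=
  a4%:P + a3 *: 'X + a2 *: 'X^2 - a1 *: 'X^3.

Definition haar5 (mu : {sigma_finite_measure set borelQp -> \bar R}) :
    {measure set borelQp5 -> \bar R} :=
  (mu \x mu \x mu \x mu \x mu)%E.

(* t = (x, y, z, u, v) *)
Definition integrand (a1 a2 a3 a4 : Qp) (psi : Qp -> R[i]) (s : R[i])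
    (t : borelQp5) : R[i] :=
  let: (x, y, z, u, v) := t : (Qp * Qp * Qp * Qp * Qp)%type in
  f_circ s (w0 Qp *m n_mx x y z u v) * psi (a1 * x + a2 * y + a3 * u + a4 * v).

End Integral.

(* Main.v *)
Require Import Defs.
From HB Require Import structures.
From mathcomp Require Import all_boot all_order all_algebra.
From mathcomp Require Import all_classical all_reals all_analysis.
From mathcomp Require Import measurable_realfun.
From mathcomp Require Import complex.
From mathcomp Require Import ring zify.
Import Order.TTheory GRing.Theory Num.Theory.
Import numFieldNormedType.Exports.

(* The value f_s(w0 n) is a power of a height: if w0 n = n' m(g) k, then
   |det g|^-1 is the largest 2 x 2 minor of the last two rows of w0 n, i.e. of
   the first two rows of n, because k is integral.  (That a decomposition exists
   follows by Iwasawa decompositions along a reduced word of w0.)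

   Put X = -x, w = (X, y, u, v), a binary cubic form, and let zeta be the
   symmetric coordinate on the centre of N.  The height H(w, zeta) is invariant
   under GL_2(Z_p), acting on N, and under translation by N(Z_p).

   - Where |w| > p, elements of GL_2(Z_p) close to 1 preserve each residue box
     and multiply the integrand by values of psi; these are all trivial only if
     the residue of w annihilates g, g', and their multiples by x in degree at
     most 3, hence everything, since the irreducible cubic g is prime to g'.
     So the integral over each box vanishes.
   - Where |w| <= p and |zeta| > p^2, H = |zeta|^2, and translating v by 1/p
     kills the integral because g(0) <> 0.
   - Where |w| <= p and |zeta| <= p^2, with residues c of p w and Z of p^2 zeta,
     H is p^4 if (2Z)^2 <> disc c, and p^3 if (2Z)^2 = disc c and c is not on
     the cone of cubes of linear forms.  On the cone, for Z = 0, the box splits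
     into a part of measure 1 with H = p (H = 1 if c = 0) and one of measure
     p - 1 with H = p^2.

   This leaves two sums of additive characters over F_p^4: over the cone it is
   -p, and weighted by the number of square roots of the discriminant it is p^2.
   Both use that g has no root: the number of roots of the Hessian in P^1 is
   that number of square roots, plus p on the cone, and the forms whose Hessian
   vanishes at a given point are invariant under translation by a line. *)

Set Implicit Arguments.
Unset Strict Implicit.
Unset Printing Implicit Defensive.

Local Open Scope classical_set_scope.
Local Open Scope ring_scope.
Local Open Scope complex_scope.

(** * Explicit matrices *)

(** Wherever the integral vanishes, only a relative invariance is used: a measure-preserving map
    that stabilizes a region and multiplies the integrand there by a constant other than 1 forces
    the integral over it to be 0 ([cint_twist]). So no height is computed where |w| > p. Absolute
    convergence enters as integrability, which licenses cutting the domain and changing variables.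
    In a box at scale p^-k, elements of GL_2 congruent to 1 modulo p^(k-1) act on psi to first
    order, because the second-order terms are integral once 2(k - 1) >= k. This fails for k = 1, so
    the boxes with |w| <= p have to be evaluated. On the cone the residues do not determine the
    height; there the residue is lifted to an exact cube over Q_p, and N(Z_p) moves the whole box to
    that point. With q = p^(-3s), a generic box gives p q^4 times a character value. These terms sum
    to 0, and the corrections sum to p^3 (q^3 - q^4) - p ((p - 1) q^2 + q - p q^3) + (1 - q), which
    factors as (1 - q)(1 - p q)(1 - p^2 q^2). Since p > 3, both 2 and 3 are units: halves occur in
    zeta, and 3 in the leading coefficient of g'. *)

Section RowsMx.
Variable F : fieldType.
Implicit Types A B : seq (seq F).

Definition rows_fun (m n : nat) (f : nat -> nat -> F) : seq (seq F) :=
  [seq [seq f i j | j <- iota 0 n] | i <- iota 0 m].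

Lemma rows_funE m n f (i : 'I_m) (j : 'I_n) :
  rows_mx m n (rows_fun m n f) i j = f i j.
Proof.
rewrite mxE (nth_map 0%N) ?size_iota//.
by rewrite (nth_map 0%N) ?size_iota// !nth_iota.
Qed.

Lemma rows_mxZ m n c A :
  c *: rows_mx m n A =
  rows_mx m n (rows_fun m n (fun i j => c * nth 0 (nth [::] A i) j)).
Proof. by apply/matrixP => i j; rewrite rows_funE !mxE. Qed.

Lemma rows_mx_diag m1 n1 m2 n2 A B :
  block_mx (rows_mx m1 n1 A) 0 0 (rows_mx m2 n2 B) =
  rows_mx (m1 + m2) (n1 + n2) (rows_fun (m1 + m2) (n1 + n2) (fun i j =>
    match (i < m1)%N, (j < n1)%N with
    | true, true => nth 0 (nth [::] A i) j
    | false, false => nth 0 (nth [::] B (i - m1)) (j - n1)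
    | _, _ => 0
    end)).
Proof.
apply/matrixP => i j; rewrite rows_funE.
case: (split_ordP i) => i' ->; case: (split_ordP j) => j' ->;
by rewrite ?(block_mxEul, block_mxEur, block_mxEdl, block_mxEdr) !mxE /=
  ?ltn_ord ?[(_ + _ < _)%N]ltnNge ?leq_addr ?addKn.
Qed.

(** Flattening the blocks into one literal 8 x 8 matrix makes [m_mx] amenable to the same entrywise
    computation as the other generators. *)
Lemma m_mxE (g : 'M[F]_2) :
  let a := g 0 0 in let b := g 0 1 in let c := g 1 0 in let d := g 1 1 in
  let D := (a * d - b * c)^-1 in
  m_mx g = rows_mx 8 8
    [:: [:: a; b; 0; 0; 0; 0; 0; 0];
        [:: c; d; 0; 0; 0; 0; 0; 0];
        [:: 0; 0; D * a ^+ 2; D * (a * b); D * (a * b); D * - b ^+ 2; 0; 0];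
        [:: 0; 0; D * (a * c); D * (a * d); D * (b * c); D * - (b * d); 0; 0];
        [:: 0; 0; D * (a * c); D * (b * c); D * (a * d); D * - (b * d); 0; 0];
        [:: 0; 0; D * - c ^+ 2; D * - (c * d); D * - (c * d); D * d ^+ 2; 0; 0];
        [:: 0; 0; 0; 0; 0; 0; D * a; D * - b];
        [:: 0; 0; 0; 0; 0; 0; D * - c; D * d]].
Proof.
rewrite /m_mx !rows_mxZ rows_mx_diag rows_mx_diag.
by [].
Qed.

Lemma rows_mx1 : 1%:M = rows_mx 8 8
    [:: [:: 1; 0; 0; 0; 0; 0; 0; 0]; [:: 0; 1; 0; 0; 0; 0; 0; 0];
        [:: 0; 0; 1; 0; 0; 0; 0; 0]; [:: 0; 0; 0; 1; 0; 0; 0; 0];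
        [:: 0; 0; 0; 0; 1; 0; 0; 0]; [:: 0; 0; 0; 0; 0; 1; 0; 0];
        [:: 0; 0; 0; 0; 0; 0; 1; 0]; [:: 0; 0; 0; 0; 0; 0; 0; 1 : F]].
Proof.
apply/matrixP => i j; rewrite !mxE.
case: i => [[|[|[|[|[|[|[|[|//]]]]]]]] ?];
by case: j => [[|[|[|[|[|[|[|[|//]]]]]]]] ?].
Qed.

Definition mx2 (a b c d : F) : 'M[F]_2 := rows_mx 2 2 [:: [:: a; b]; [:: c; d]].

Lemma det_mx2E (g : 'M[F]_2) : \det g = g 0 0 * g 1 1 - g 0 1 * g 1 0.
Proof.
rewrite (expand_det_row _ 0) !big_ord_recl big_ord0 /cofactor !det_mx11 !mxE/=.
rewrite !addr0 expr0 expr1 mulN1r mul1r mulrN.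
by congr (g _ _ * g _ _ - g _ _ * g _ _); apply/val_inj.
Qed.

Lemma det_mx2 a b c d : \det (mx2 a b c d) = a * d - b * c.
Proof. by rewrite det_mx2E !mxE. Qed.

Lemma mx2_eta (g : 'M[F]_2) : g = mx2 (g 0 0) (g 0 1) (g 1 0) (g 1 1).
Proof.
apply/matrixP => i j; rewrite mxE.
by case: i j => [[|[|//]] ?] [[|[|//]] ?]; congr (g _ _); apply/val_inj.
Qed.

Lemma eq_cons (T : Type) (x y : T) s t : x = y -> s = t -> x :: s = y :: t.
Proof. by move=> -> ->. Qed.

(* Sparse entries: None stands for a syntactic zero, so that products of the
   explicit 8 x 8 matrices compute without their many vanishing terms. *)
Definition sparse_add (a b : option F) : option F :=
  match a, b with
  | None, _ => b
  | _, None => a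
  | Some x, Some y => Some (x + y)
  end.

Definition sparse_mul (a b : option F) : option F :=
  if a is Some x then if b is Some y then Some (x * y) else None else None.

Definition sparse (A : seq (seq (option F))) : seq (seq F) :=
  map (map (odflt 0)) A.

Definition sparse_mulr m k n (A B : seq (seq (option F))) : seq (seq (option F)) :=
  [seq [seq foldr sparse_add None
              [seq sparse_mul (nth None (nth [::] A i) l) (nth None (nth [::] B l) j)
              | l <- iota 0 k] | j <- iota 0 n] | i <- iota 0 m].

Let nth_sparse (A : seq (seq (option F))) i j : nth 0 (nth [::] (sparse A) i) j =
    odflt 0 (nth None (nth [::] A i) j).
Proof.
have [iA|Ai] := ltnP i (size A); last first.
  by rewrite !(nth_default [::]) ?size_map// !nth_nil.
rewrite (nth_map [::])//; have [jA|Aj] := ltnP j (size (nth [::] A i)).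
  by rewrite (nth_map None).
by rewrite [LHS]nth_default ?size_map// [nth None _ _]nth_default.
Qed.

Lemma sparse_mulmx m k n (A B : seq (seq (option F))) :
  rows_mx m k (sparse A) *m rows_mx k n (sparse B) =
  rows_mx m n (sparse (sparse_mulr m k n A B)).
Proof.
have addE a b : odflt 0 (sparse_add a b) = odflt 0 a + odflt 0 b.
  by case: a b => [x|] [y|] /=; rewrite ?addr0 ?add0r.
have mulE a b : odflt 0 (sparse_mul a b) = odflt 0 a * odflt 0 b.
  by case: a b => [x|] [y|] /=; rewrite ?mulr0 ?mul0r.
apply/matrixP => i j; rewrite [RHS]mxE nth_sparse /sparse_mulr.
rewrite (nth_map 0%N) ?size_iota// (nth_map 0%N) ?size_iota// !nth_iota// !add0n mxE.
under eq_bigr do rewrite !mxE !nth_sparse -mulE.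
rewrite -(big_mkord xpredT (fun l => odflt 0
  (sparse_mul (nth None (nth [::] A i) l) (nth None (nth [::] B l) j)))).
rewrite /index_iota subn0; elim: (iota 0 k) => [|l s IH]; first by rewrite big_nil.
by rewrite big_cons IH -addE.
Qed.

End RowsMx.

(** Only a syntactic [0] becomes [None]; entries that merely happen to vanish stay explicit and are
    left to [ring]. *)
Ltac sparse_row r :=
  let r := eval hnf in r in
  let T := type of r in
  lazymatch T with
  | seq ?T0 =>
    lazymatch r with
    | nil => constr:(@nil (option T0))
    | cons 0 ?r' => let s := sparse_row r' in constr:(cons None s)
    | cons ?x ?r' => let s := sparse_row r' in constr:(cons (Some x) s)
    end
  end.

Ltac sparse_rows A :=
  let A := eval hnf in A in
  let T := type of A in
  lazymatch T with
  | seq (seq ?T0) =>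
    lazymatch A with
    | nil => constr:(@nil (seq (option T0)))
    | cons ?r ?A' =>
      let s := sparse_row r in let S := sparse_rows A' in constr:(cons s S)
    end
  end.

Ltac sparsify :=
  repeat match goal with
  | |- context [rows_mx ?m ?n ?A] =>
    lazymatch A with
    | sparse _ => fail
    | _ => let S := sparse_rows A in change (rows_mx m n A) with (rows_mx m n
        (sparse S))
    end
  end.

(** The restricted [lazy] unfolds the sparse product but keeps the field operations folded, so one
    readable equation per nontrivial entry remains for [ring] or [field]. *)
Ltac rows_eq :=
  rewrite /n_mx /nminus_mx /w0; sparsify; rewrite ?sparse_mulmx;
  refine (f_equal (rows_mx _ _) _); lazy beta iota zeta delta [sparse sparse_mulr
      sparse_add sparse_mul map nth foldr
    seq.iota odflt Option.default Option.apply oapp];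
  repeat (apply: eq_cons); try reflexivity.

(** * Relations between the generators of G_2 *)

Section G2Relations.
Variable F : fieldType.
Implicit Types a d t x y z u v : F.

Lemma mx2M a b c d a' b' c' d' : mx2 a b c d *m mx2 a' b' c' d' =
  mx2 (a * a' + b * c') (a * b' + b * d') (c * a' + d * c') (c * b' + d * d').
Proof. by rewrite /mx2; rows_eq. Qed.

(** Heisenberg group law with centre z. Its cocycle is not alternating, a defect that the symmetric
    coordinate zeta removes later. *)
Lemma n_mxM x y z u v x' y' z' u' v' :
  n_mx x y z u v *m n_mx x' y' z' u' v' =
  n_mx (x + x') (y + y') (z + z' + v * x' + 3 * u * y') (u + u') (v + v').
Proof. by rows_eq; ring. Qed.

Lemma n_mx0 : n_mx 0 0 0 0 0 = 1%:M :> 'M[F]_8.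
Proof. by rewrite rows_mx1; rows_eq; ring. Qed.

Lemma nminus_mxM x x' :
  nminus_mx x 0 0 0 0 *m nminus_mx x' 0 0 0 0 = nminus_mx (x + x') 0 0 0 0.
Proof. by rows_eq; ring. Qed.

Lemma nminus_mx0 : nminus_mx 0 0 0 0 0 = 1%:M :> 'M[F]_8.
Proof. by rewrite rows_mx1; rows_eq; ring. Qed.

Lemma m_mxM (g h : 'M[F]_2) : g \in unitmx -> h \in unitmx ->
  m_mx g *m m_mx h = m_mx (g *m h).
Proof.
rewrite !unitmxE !unitfE (mx2_eta g) (mx2_eta h).
move: (g 0 0) (g 0 1) (g 1 0) (g 1 1) => a b c d.
move: (h 0 0) (h 0 1) (h 1 0) (h 1 1) => a' b' c' d'.
rewrite !det_mx2 => g0 h0.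
have gh0 : (a * a' + b * c') * (c * b' + d * d')
    - (a * b' + b * d') * (c * a' + d * c') != 0.
  have -> : (a * a' + b * c') * (c * b' + d * d')
    - (a * b' + b * d') * (c * a' + d * c') = (a * d - b * c) * (a' * d' - b' * c').
    by ring.
  by rewrite mulf_neq0.
rewrite mx2M !m_mxE !mxE /=.
by rows_eq; try ring; field; rewrite gh0 g0 h0.
Qed.

(* Root subgroups, a lift of the reflection and the torus of the Levi GL_2, and
   a lift sb of the other simple reflection. *)
Definition xa t : 'M[F]_8 := m_mx (mx2 1 t 0 1).
Definition ya t : 'M[F]_8 := m_mx (mx2 1 0 t 1).
Definition sa : 'M[F]_8 := m_mx (mx2 0 1 (-1) 0).
Definition torus a d : 'M[F]_8 := m_mx (mx2 a 0 0 d).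
Definition sb : 'M[F]_8 := rows_mx 8 8
    [:: [:: 1; 0; 0; 0; 0; 0; 0; 0]; [:: 0; 0; 1; 0; 0; 0; 0; 0];
        [:: 0; -1; 0; 0; 0; 0; 0; 0]; [:: 0; 0; 0; 1; 0; 0; 0; 0];
        [:: 0; 0; 0; 0; 1; 0; 0; 0]; [:: 0; 0; 0; 0; 0; 0; -1; 0];
        [:: 0; 0; 0; 0; 0; 1; 0; 0]; [:: 0; 0; 0; 0; 0; 0; 0; 1]].

Lemma torusE a d : a != 0 -> d != 0 -> torus a d = rows_mx 8 8
    [:: [:: a; 0; 0; 0; 0; 0; 0; 0]; [:: 0; d; 0; 0; 0; 0; 0; 0];
        [:: 0; 0; a / d; 0; 0; 0; 0; 0]; [:: 0; 0; 0; 1; 0; 0; 0; 0];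
        [:: 0; 0; 0; 0; 1; 0; 0; 0]; [:: 0; 0; 0; 0; 0; d / a; 0; 0];
        [:: 0; 0; 0; 0; 0; 0; d^-1; 0]; [:: 0; 0; 0; 0; 0; 0; 0; a^-1]].
Proof.
move=> a0 d0; rewrite /torus m_mxE !mxE /=.
by rows_eq; try ring; field; rewrite ?a0 ?d0.
Qed.

Lemma xaE t : xa t = rows_mx 8 8
    [:: [:: 1; t; 0; 0; 0; 0; 0; 0]; [:: 0; 1; 0; 0; 0; 0; 0; 0];
        [:: 0; 0; 1; t; t; - t ^+ 2; 0; 0]; [:: 0; 0; 0; 1; 0; - t; 0; 0];
        [:: 0; 0; 0; 0; 1; - t; 0; 0]; [:: 0; 0; 0; 0; 0; 1; 0; 0];
        [:: 0; 0; 0; 0; 0; 0; 1; - t]; [:: 0; 0; 0; 0; 0; 0; 0; 1]].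
Proof.
rewrite /xa m_mxE !mxE /= !mul1r mulr0 subr0 invr1.
by rows_eq; ring.
Qed.

Lemma yaE t : ya t = rows_mx 8 8
    [:: [:: 1; 0; 0; 0; 0; 0; 0; 0]; [:: t; 1; 0; 0; 0; 0; 0; 0];
        [:: 0; 0; 1; 0; 0; 0; 0; 0]; [:: 0; 0; t; 1; 0; 0; 0; 0];
        [:: 0; 0; t; 0; 1; 0; 0; 0]; [:: 0; 0; - t ^+ 2; - t; - t; 1; 0; 0];
        [:: 0; 0; 0; 0; 0; 0; 1; 0]; [:: 0; 0; 0; 0; 0; 0; - t; 1]].
Proof.
rewrite /ya m_mxE !mxE /= !mul1r mul0r subr0 invr1.
by rows_eq; ring.
Qed.

Lemma saE : sa = rows_mx 8 8
    [:: [:: 0; 1; 0; 0; 0; 0; 0; 0]; [:: -1; 0; 0; 0; 0; 0; 0; 0];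
        [:: 0; 0; 0; 0; 0; -1; 0; 0]; [:: 0; 0; 0; 0; -1; 0; 0; 0];
        [:: 0; 0; 0; -1; 0; 0; 0; 0]; [:: 0; 0; -1; 0; 0; 0; 0; 0];
        [:: 0; 0; 0; 0; 0; 0; 0; -1]; [:: 0; 0; 0; 0; 0; 0; 1; 0]].
Proof.
rewrite /sa m_mxE !mxE /= mul0r mul1r sub0r opprK invr1.
by rows_eq; ring.
Qed.

Lemma n_vE v : n_mx 0 0 0 0 v = rows_mx 8 8
    [:: [:: 1; 0; 0; 0; 0; 0; 0; 0]; [:: 0; 1; v; 0; 0; 0; 0; 0];
        [:: 0; 0; 1; 0; 0; 0; 0; 0]; [:: 0; 0; 0; 1; 0; 0; 0; 0];
        [:: 0; 0; 0; 0; 1; 0; 0; 0]; [:: 0; 0; 0; 0; 0; 1; - v; 0];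
        [:: 0; 0; 0; 0; 0; 0; 1; 0]; [:: 0; 0; 0; 0; 0; 0; 0; 1]].
Proof. by rows_eq; ring. Qed.

Lemma nminus_xE x : nminus_mx x 0 0 0 0 = rows_mx 8 8
    [:: [:: 1; 0; 0; 0; 0; 0; 0; 0]; [:: 0; 1; 0; 0; 0; 0; 0; 0];
        [:: 0; x; 1; 0; 0; 0; 0; 0]; [:: 0; 0; 0; 1; 0; 0; 0; 0];
        [:: 0; 0; 0; 0; 1; 0; 0; 0]; [:: 0; 0; 0; 0; 0; 1; 0; 0];
        [:: 0; 0; 0; 0; 0; - x; 1; 0]; [:: 0; 0; 0; 0; 0; 0; 0; 1]].
Proof. by rows_eq; ring. Qed.

(** The SL_2 identity for a simple reflection; the x-coordinate of N^- is the root opposite to the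
    v-coordinate of N. It shows that [sb] is an integral point of G_2. *)
Lemma sbE :
  sb = n_mx 0 0 0 0 1 *m nminus_mx (-1) 0 0 0 0 *m n_mx 0 0 0 0 1.
Proof. by rewrite /sb n_vE nminus_xE; rows_eq; ring. Qed.

(** Conjugation acts by a linear substitution on the binary cubic with coefficients -x, 3y, 3u,
    v. *)
Lemma xa_n t x y z u v : xa t *m n_mx x y z u v =
  n_mx (x + 3 * t * y - 3 * t ^+ 2 * u + t ^+ 3 * v)
    (y - 2 * t * u + t ^+ 2 * v)
    (z - 3 * t * u ^+ 2 + 3 * t ^+ 2 * u * v - t ^+ 3 * v ^+ 2)
    (u - t * v) v *m xa t.
Proof. by rewrite xaE; rows_eq; ring. Qed.

Lemma n_xa t x y z u v : n_mx x y z u v *m xa t = xa t *m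
  n_mx (x - 3 * t * y - 3 * t ^+ 2 * u - t ^+ 3 * v)
    (y + 2 * t * u + t ^+ 2 * v)
    (z + 3 * t * u ^+ 2 + 3 * t ^+ 2 * u * v + t ^+ 3 * v ^+ 2)
    (u + t * v) v.
Proof. by rewrite xa_n; congr (n_mx _ _ _ _ _ *m _); ring. Qed.

Lemma sa_n x y z u v :
  sa *m n_mx x y z u v = n_mx v u (z - v * x - 3 * u * y) (- y) (- x) *m sa.
Proof. by rewrite saE; rows_eq; ring. Qed.

Lemma torus_n a d x y z u v : a != 0 -> d != 0 ->
  torus a d *m n_mx x y z u v =
  n_mx (a ^+ 2 / d * x) (a * y) (a * d * z) (d * u) (d ^+ 2 / a * v) *m torus a d.
Proof.
move=> a0 d0; rewrite torusE//.
by rows_eq; try ring; field; rewrite ?a0 ?d0.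
Qed.

(** The matrices [xa t] together with the elements of N having v = 0 form the unipotent radical of
    the other maximal parabolic, which [sb] normalizes; the roots of t and u are exchanged. *)
Lemma sb_xa_n t x y z u : sb *m (xa t *m n_mx x y z u 0) =
  xa (- u) *m n_mx (- z + 3 * u * y - 3 * u ^+ 2 * t) (y - 2 * u * t)
    (x + 3 * t * y - 3 * u * t ^+ 2) t 0 *m sb.
Proof. by rewrite !xaE /sb; rows_eq; ring. Qed.

Lemma sb_torus a d : a != 0 -> d != 0 ->
  sb *m torus a d = torus a (a / d) *m sb.
Proof.
move=> a0 d0; rewrite !torusE ?mulf_neq0 ?invr_eq0// /sb.
by rows_eq; try ring; field; rewrite ?a0 ?d0.
Qed.

Lemma sa_torus a d : a != 0 -> d != 0 -> sa *m torus a d = torus d a *m sa.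
Proof.
move=> a0 d0; rewrite !torusE// saE.
by rows_eq; try ring; field; rewrite ?a0 ?d0.
Qed.

Lemma xa_torus a d t : a != 0 -> d != 0 ->
  xa t *m torus a d = torus a d *m xa (t * d / a).
Proof.
move=> a0 d0; rewrite !torusE// !xaE.
by rows_eq; try ring; field; rewrite ?a0 ?d0.
Qed.

(** Rank-one Iwasawa decomposition: when |v| > 1 the lower unipotent factor, with entry 1/v, is
    integral. The next lemma is its analogue for the other simple root. *)
Lemma sb_iwasawa v : v != 0 -> sb *m n_mx 0 0 0 0 v =
  n_mx 0 0 0 0 (- v^-1) *m torus 1 (- v^-1) *m nminus_mx v^-1 0 0 0 0.
Proof.
move=> v0; rewrite torusE ?oppr_eq0 ?invr_eq0 ?oner_eq0// /sb !n_vE nminus_xE.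
by rows_eq; try ring; field; rewrite ?oppr_eq0 ?oner_eq0 ?v0.
Qed.

Lemma sa_iwasawa t : t != 0 -> sa *m xa t =
  xa (- t^-1) *m torus (- t^-1) (- t) *m ya t^-1.
Proof.
move=> t0; rewrite torusE ?oppr_eq0 ?invr_eq0// saE !xaE yaE.
by rows_eq; try ring; field; rewrite ?oppr_eq0 ?oner_eq0 ?t0.
Qed.

(** A reduced word of length 5, one letter for each root of N; the torus element only corrects
    signs. *)
Lemma w0E : w0 F = torus 1 (-1) *m sb *m sa *m sb *m sa *m sb.
Proof.
have -> : torus 1 (-1) *m sb = rows_mx 8 8
    [:: [:: 1; 0; 0; 0; 0; 0; 0; 0]; [:: 0; 0; -1; 0; 0; 0; 0; 0];
        [:: 0; 1; 0; 0; 0; 0; 0; 0]; [:: 0; 0; 0; 1; 0; 0; 0; 0];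
        [:: 0; 0; 0; 0; 1; 0; 0; 0]; [:: 0; 0; 0; 0; 0; 0; 1; 0];
        [:: 0; 0; 0; 0; 0; -1; 0; 0]; [:: 0; 0; 0; 0; 0; 0; 0; 1 : F]].
  rewrite torusE ?oppr_eq0 ?oner_eq0// invrN1 invr1 /sb.
  by rows_eq; ring.
have sasb : sa *m sb = rows_mx 8 8
    [:: [:: 0; 0; 1; 0; 0; 0; 0; 0]; [:: -1; 0; 0; 0; 0; 0; 0; 0];
        [:: 0; 0; 0; 0; 0; 0; 1; 0]; [:: 0; 0; 0; 0; -1; 0; 0; 0];
        [:: 0; 0; 0; -1; 0; 0; 0; 0]; [:: 0; 1; 0; 0; 0; 0; 0; 0];
        [:: 0; 0; 0; 0; 0; 0; 0; -1]; [:: 0; 0; 0; 0; 0; 1; 0; 0 : F]].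
  by rewrite saE /sb; rows_eq; ring.
by rewrite -!(mulmxA _ sa sb) sasb; rows_eq; ring.
Qed.

End G2Relations.

(** * The p-adic absolute value and reduction modulo p *)

Section PadicAbs.
Context {R : realType} {p : nat} {K : padicField R p}.
Local Notation Qp := (Qp K).
Implicit Types (x y : Qp) (r : R).

Lemma absp_ge0 x : 0 <= absp x. Proof. exact: padic_abs_ge0. Qed.

Lemma absp_eq0 x : (absp x == 0) = (x == 0).
Proof. by apply/eqP/eqP => /padic_abs_eq0. Qed.

Lemma absp0 : absp (0 : Qp) = 0.
Proof. by apply/eqP; rewrite absp_eq0. Qed.

Lemma absp_gt0 x : (0 < absp x) = (x != 0).
Proof. by rewrite lt_neqAle absp_ge0 andbT eq_sym absp_eq0. Qed.

Lemma abspM x y : absp (x * y) = absp x * absp y.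
Proof. exact: padic_absM. Qed.

Lemma absp1 : absp (1 : Qp) = 1.
Proof.
have n0 : absp (1 : Qp) != 0 by rewrite absp_eq0 oner_eq0.
by apply: (mulfI n0); rewrite -abspM !mulr1.
Qed.

Lemma abspN x : absp (- x) = absp x.
Proof.
rewrite -mulN1r abspM; suff -> : absp (-1 : Qp) = 1 by rewrite mul1r.
apply/eqP; rewrite -(@eqrXn2 _ 2) ?absp_ge0//.
by rewrite expr1n expr2 -abspM mulrNN mulr1 absp1.
Qed.

Lemma abspBC x y : absp (x - y) = absp (y - x).
Proof. by rewrite -abspN opprB. Qed.

Lemma abspV x : absp x^-1 = (absp x)^-1.
Proof.
have [->|x0] := eqVneq x 0; first by rewrite invr0 absp0 invr0.
have a0 : absp x != 0 by rewrite absp_eq0.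
by apply: (mulfI a0); rewrite -abspM !mulfV// absp1.
Qed.

Lemma abspX x n : absp (x ^+ n) = absp x ^+ n.
Proof. by elim: n => [|n IH]; rewrite ?expr0 ?absp1// !exprS abspM IH. Qed.

Lemma abspXz x (k : int) : absp (x ^ k) = absp x ^ k.
Proof. by case: k => n; rewrite ?NegzE -?exprnN ?abspV -?exprnP abspX// -exprVn. Qed.

Lemma abspD_max x y : absp (x + y) <= Num.max (absp x) (absp y).
Proof. exact: padic_absD. Qed.

Lemma abspD_le x y r : absp x <= r -> absp y <= r -> absp (x + y) <= r.
Proof. by move=> xr yr; rewrite (le_trans (abspD_max _ _))// ge_max xr. Qed.

Lemma abspD_lt x y r : absp x < r -> absp y < r -> absp (x + y) < r.
Proof. by move=> xr yr; rewrite (le_lt_trans (abspD_max _ _))// gt_max xr. Qed.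

Lemma abspB_le x y r : absp x <= r -> absp y <= r -> absp (x - y) <= r.
Proof. by move=> xr yr; rewrite abspD_le// abspN. Qed.

Lemma abspB_lt x y r : absp x < r -> absp y < r -> absp (x - y) < r.
Proof. by move=> xr yr; rewrite abspD_lt// abspN. Qed.

Lemma abspM_le x y r r' : absp x <= r -> absp y <= r' -> absp (x * y) <= r * r'.
Proof. by move=> xr yr; rewrite abspM ler_pM// absp_ge0. Qed.

Lemma abspX_le x n r : absp x <= r -> absp (x ^+ n) <= r ^+ n.
Proof. by move=> xr; rewrite abspX lerXn2r// nnegrE ?absp_ge0// (le_trans _ xr)//
    absp_ge0. Qed.

Lemma abspDl x y : absp y < absp x -> absp (x + y) = absp x.
Proof.
move=> yx; apply/eqP; rewrite eq_le abspD_le ?(ltW yx)//= leNgt.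
apply/negP => xyx; have : absp (x + y - y) < absp x by rewrite abspB_lt.
by rewrite addrK ltxx.
Qed.

Lemma abspDr x y : absp x < absp y -> absp (x + y) = absp y.
Proof. by rewrite addrC; exact: abspDl. Qed.

Lemma absp_sum_le (I : Type) (s : seq I) (P : pred I) (F : I -> Qp) r :
  0 <= r -> (forall i, P i -> absp (F i) <= r) ->
  absp (\sum_(i <- s | P i) F i) <= r.
Proof.
move=> r0 Fr; apply: (big_ind (fun x => absp x <= r)) => //.
  by rewrite absp0.
by move=> x y; exact: abspD_le.
Qed.

Lemma absp_nat_le1 n : absp (n%:R : Qp) <= 1.
Proof.
elim: n => [|n IH]; first by rewrite absp0.
by rewrite -addn1 natrD abspD_le ?absp1.
Qed.

Lemma absp_int_le1 (k : int) : absp (k%:~R : Qp) <= 1.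
Proof. by case: k => n; rewrite ?NegzE ?mulrNz ?abspN; exact: absp_nat_le1. Qed.

Lemma absp_p : absp (p%:R : Qp) = p%:R^-1.
Proof. exact: padic_abs_p. Qed.

Hypothesis p_prime : prime p.

Let p_gt0 : (0 : R) < p%:R. Proof. by rewrite ltr0n prime_gt0. Qed.
Let p_gt1 : (1 : R) < p%:R. Proof. by rewrite ltr1n prime_gt1. Qed.

Lemma absp_p_lt1 : absp (p%:R : Qp) < 1.
Proof. by rewrite absp_p invf_lt1. Qed.

Lemma natp_neq0 : (p%:R : Qp) != 0.
Proof. by rewrite -absp_eq0 absp_p invr_eq0 gt_eqF. Qed.

(** By Bezout 1 = a n - b p, so |n| < 1 would give |1| < 1. *)
Lemma absp_coprime n : ~~ (p %| n)%N -> absp (n%:R : Qp) = 1.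
Proof.
move=> pn; have n_gt0 : (0 < n)%N by case: n pn => //; rewrite dvdn0.
have : coprime n p by rewrite coprime_sym prime_coprime.
have [a b e _] := egcdnP p n_gt0; rewrite /coprime => /eqP g1.
apply/eqP; rewrite eq_le absp_nat_le1/= leNgt; apply/negP => n1.
have : absp (1 : Qp) < 1; last by rewrite absp1 ltxx.
have -> : 1 = (a%:R * n%:R - b%:R * p%:R : Qp).
  by rewrite -!natrM e g1 natrD [_%:R + _]addrC addrK.
apply: abspB_lt; rewrite abspM.
  by rewrite (le_lt_trans _ n1)// ler_piMl ?absp_ge0 ?absp_nat_le1.
by rewrite (le_lt_trans _ absp_p_lt1)// ler_piMl ?absp_ge0 ?absp_nat_le1.
Qed.

Lemma absp_natP n : (0 < n)%N -> exists k : nat, absp (n%:R : Qp) = p%:R ^- k.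
Proof.
move=> n_gt0; exists (logn p n).
have [m pm e] := pfactor_coprime p_prime n_gt0.
rewrite [in LHS]e natrM abspM absp_coprime.
  by rewrite mul1r natrX abspX absp_p exprVn.
by rewrite -prime_coprime.
Qed.

Lemma absp_intP (k : int) : k != 0 -> exists n : nat, absp (k%:~R : Qp) = p%:R ^- n.
Proof.
case: k => [n|n] n0; first by apply: absp_natP; case: n n0.
by rewrite NegzE mulrNz abspN; exact: absp_natP.
Qed.

Lemma absp_denq (q : rat) : exists n : nat, absp ((denq q)%:~R : Qp) = p%:R ^- n.
Proof. by apply: absp_intP; rewrite denq_neq0. Qed.

Lemma denq_unit (q : rat) : (denq q)%:~R != 0 :> Qp.
Proof.
have [n e] := absp_denq q.
by rewrite -absp_eq0 e invr_eq0 expf_neq0// gt_eqF.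
Qed.

(* ratr is only multiplicative because the residue characteristic is not the
   characteristic of the field *)
Lemma absp_ratP (q : rat) : q != 0 -> exists k : int, absp (ratr q : Qp) = p%:R ^ k.
Proof.
move=> q0; have [m em] := absp_denq q.
have [n en] := absp_intP (eqbRL (congr1 negb (numq_eq0 q)) q0).
exists (m%:Z - n%:Z); rewrite /ratr abspM abspV em en invrK.
by rewrite expfzDr ?gt_eqF// exprnN mulrC.
Qed.

Lemma ratr_approx x r : 0 < r -> exists q : rat, absp (x - ratr q) < r.
Proof. exact: padic_dense. Qed.

(** A rational closer to x than |x| has the same absolute value as x, by the ultrametric inequality,
    so the value group is that of the rationals. *)
Lemma absp_valueP x : x != 0 -> exists k : int, absp x = p%:R ^ k.
Proof.
rewrite -absp_gt0 => x0; have [q xq] := ratr_approx x x0.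
have e : absp x = absp (ratr q : Qp).
  by rewrite -[ratr q](subKr x) abspDl ?abspN.
have [q0|/absp_ratP[k ek]] := eqVneq q 0; last by exists k; rewrite e.
by move: x0; rewrite e q0 /ratr mul0r absp0 ltxx.
Qed.

Lemma absp_lt_le x (k : int) : absp x < p%:R ^ (k + 1) -> absp x <= p%:R ^ k.
Proof.
have [->|/absp_valueP[j ->]] := eqVneq x 0; first by rewrite absp0 exprz_ge0 ?ltW.
by rewrite ltr_eXz2l// ler_eXz2l// ltzD1.
Qed.

Lemma absp_lt1_le x : absp x < 1 -> absp x <= p%:R^-1.
Proof. by move=> x1; have := @absp_lt_le x (-1); rewrite addNr expr0z exprN1;
    apply. Qed.

Lemma padic_intP x : absp x <= 1 -> exists n : nat, absp (x - n%:R) < 1.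
Proof.
move=> x1; have [q xq] := ratr_approx x (@ltr01 R).
have q1 : absp (ratr q : Qp) <= 1.
  by rewrite -[ratr q](subKr x) abspB_le// ltW.
(* If p divides the denominator, the coprime numerator is a unit, and |q| <= 1 then forces the
   denominator to have absolute value at least 1. *)
have den1 : absp ((denq q)%:~R : Qp) = 1.
  have [pd|pd] := boolP (p %| `|denq q|)%N; last first.
    by rewrite -(absp_coprime pd) -[denq q in LHS]gez0_abs ?denq_ge0.
  have pn : ~~ (p %| `|numq q|)%N.
    apply/negP => pn; have := coprime_num_den q; rewrite /coprime => /eqP g1.
    have : (p %| gcdn `|numq q| `|denq q|)%N by rewrite dvdn_gcd pn.
    by rewrite g1 dvdn1 => /eqP p1; have := p_prime; rewrite p1.
  have n1 : absp ((numq q)%:~R : Qp) = 1.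
    rewrite -(absp_coprime pn); case: (numq q) => k //.
    by rewrite NegzE mulrNz abspN abszN.
  have d0 := denq_unit q; rewrite -absp_gt0 in d0.
  apply/eqP; rewrite eq_le absp_int_le1/=.
  by move: q1; rewrite /ratr abspM abspV n1 mul1r invf_le1.
pose d := `|denq q|%N.
have dE : (denq q)%:~R = d%:R :> Qp by rewrite -[denq q]gez0_abs ?denq_ge0.
have pd : ~~ (p %| d)%N.
  apply/negP => /dvdnP[m em]; move: den1; rewrite dE em natrM abspM => e1.
  have : absp (m%:R : Qp) * absp (p%:R : Qp) < 1.
    by rewrite (le_lt_trans _ absp_p_lt1)// ler_piMl ?absp_ge0 ?absp_nat_le1.
  by rewrite e1 ltxx.
have d_gt0 : (0 < d)%N by rewrite lt0n; apply: contra pd => /eqP ->; rewrite dvdn0.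
have : coprime d p by rewrite coprime_sym prime_coprime.
have [a b eab _] := egcdnP p d_gt0; rewrite /coprime => /eqP g1.
(* A negative numerator -(k + 1) is congruent modulo p to the natural number (k + 1)(p - 1). *)
have [m em] : exists m : nat, absp ((numq q)%:~R - m%:R : Qp) < 1.
  case: (numq q) => k; first by exists k; rewrite subrr absp0.
  exists (k.+1 * p.-1)%N; rewrite NegzE mulrNz -opprD abspN -natrD.
  rewrite -mulnS prednK ?prime_gt0// natrM abspM.
  by rewrite (le_lt_trans _ absp_p_lt1)// ler_piMl ?absp_ge0 ?absp_nat_le1.
(* The Bezout coefficient a inverts the denominator d modulo p, since a d = b p + 1. *)
exists (m * a)%N.
have -> : x - (m * a)%:R = (x - ratr q) +
    ((numq q)%:~R * (d%:R^-1 - a%:R) + ((numq q)%:~R - m%:R) * a%:R).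
  by rewrite /ratr dE natrM; ring.
apply: abspD_lt => //; apply: abspD_lt; last first.
  by rewrite abspM (le_lt_trans _ em)// ler_piMr ?absp_ge0 ?absp_nat_le1.
have d0 : d%:R != 0 :> Qp by rewrite -dE denq_unit.
have -> : d%:R^-1 - a%:R = - (b%:R * p%:R) / d%:R :> Qp.
  by rewrite -natrM -[(b * p)%:R](addrK 1) -[1 in X in X - 1]/(1%:R) -natrD -g1
      -eab natrM; field.
rewrite -dE !abspM abspN abspV den1 invr1 mulr1.
rewrite (le_lt_trans (ler_piMl _ (absp_int_le1 _)))// ?abspM ?mulr_ge0 ?absp_ge0//.
by rewrite (le_lt_trans _ absp_p_lt1)// ler_piMl ?absp_ge0 ?absp_nat_le1.
Qed.

End PadicAbs.

Section Reduction.
Context {R : realType} {p : nat} {K : padicField R p}.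
Local Notation Qp := (Qp K).
Hypothesis p_prime : prime p.
Implicit Types (x y : Qp) (c : 'F_p).

Definition red x : 'F_p := reduction x.
Definition lift_Fp c : Qp := (c : nat)%:R.

Lemma absp_lift_le1 c : absp (lift_Fp c) <= 1.
Proof. exact: absp_nat_le1. Qed.

Lemma Fp_lt c : (c < p)%N.
Proof. by have := ltn_ord c; rewrite [X in (_ < X)%N -> _]Fp_cast. Qed.

Lemma lift_nat n : absp (n%:R - lift_Fp n%:R) < 1.
Proof.
rewrite /lift_Fp val_Fp_nat// [X in X%:R - _](divn_eq n p) natrD addrK natrM abspM.
by rewrite (le_lt_trans _ (absp_p_lt1 p_prime (K := K)))// ler_piMl ?absp_ge0
    ?absp_nat_le1.
Qed.

Lemma lift_inj c c' : absp (lift_Fp c - lift_Fp c') < 1 -> c = c'.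
Proof.
wlog cc' : c c' / (c' <= c)%N => [H|].
  case: (leqP c' c) => [/H//|/ltnW/H H']; rewrite (abspBC (lift_Fp c)).
  by move/H'.
rewrite /lift_Fp -natrB// => lt1; apply/val_inj/eqP.
rewrite eqn_leq cc' andbT leqNgt; apply/negP => cc.
have /(absp_coprime (K := K) p_prime) e : ~~ (p %| c - c')%N.
  by rewrite gtnNdvd ?subn_gt0// (leq_ltn_trans (leq_subr _ _))// Fp_lt.
by rewrite e ltxx in lt1.
Qed.

Lemma redP x : absp x <= 1 -> absp (x - lift_Fp (red x)) < 1.
Proof.
move=> /(padic_intP p_prime)[n xn]; rewrite /red /reduction.
case: pickP => [c //|/(_ n%:R)/negP[]].
rewrite -[x](subrK n%:R) -addrA; apply: abspD_lt => //.
exact: lift_nat.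
Qed.

Lemma red_eq x c : absp (x - lift_Fp c) < 1 -> red x = c.
Proof.
move=> xc; have x1 : absp x <= 1.
  by rewrite -[x](subrK (lift_Fp c)) abspD_le ?absp_lift_le1// ltW.
apply: lift_inj.
have -> : lift_Fp (red x) - lift_Fp c = (x - lift_Fp c) - (x - lift_Fp (red x)) by ring.
by rewrite abspB_lt ?redP.
Qed.

Lemma red_lift c : red (lift_Fp c) = c.
Proof. by apply: red_eq; rewrite subrr absp0. Qed.

Lemma redD x y : absp x <= 1 -> absp y <= 1 -> red (x + y) = red x + red y.
Proof.
move=> x1 y1; apply: red_eq.
have -> : x + y - lift_Fp (red x + red y) = (x - lift_Fp (red x)) + (y - lift_Fp
    (red y))
   + ((red x + red y)%N%:R - lift_Fp (red x + red y)).
  by rewrite natrD /lift_Fp; ring.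
apply: abspD_lt; first by apply: abspD_lt; exact: redP.
by have := lift_nat (red x + red y)%N; rewrite (natrD 'F_p) !natr_Zp.
Qed.

Lemma redM x y : absp x <= 1 -> absp y <= 1 -> red (x * y) = red x * red y.
Proof.
move=> x1 y1; apply: red_eq.
have -> : x * y - lift_Fp (red x * red y) = x * (y - lift_Fp (red y))
    + (x - lift_Fp (red x)) * lift_Fp (red y)
    + ((red x * red y)%N%:R - lift_Fp (red x * red y)).
  by rewrite natrM /lift_Fp; ring.
apply: abspD_lt; first apply: abspD_lt; rewrite ?abspM.
- by rewrite (le_lt_trans _ (redP y1))// ler_piMl ?absp_ge0.
- by rewrite (le_lt_trans _ (redP x1))// ler_piMr ?absp_ge0 ?absp_lift_le1.
by have := lift_nat (red x * red y)%N; rewrite (natrM 'F_p) !natr_Zp.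
Qed.

Lemma red_eq0 x : absp x <= 1 -> (red x == 0) = (absp x < 1).
Proof.
move=> x1; apply/eqP/idP => [e|x1']; last by apply: red_eq; rewrite subr0.
by have := redP x1; rewrite e subr0.
Qed.

Lemma red_neq0 x : absp x <= 1 -> (red x != 0) = (absp x == 1).
Proof. by move=> x1; rewrite red_eq0// -leNgt eq_le x1. Qed.

Lemma red0 : red 0 = 0.
Proof. by apply: red_eq; rewrite subr0 absp0. Qed.

Lemma red_nat n : red n%:R = n%:R.
Proof. exact/red_eq/lift_nat. Qed.

Lemma red1 : red 1 = 1.
Proof. exact: (red_nat 1). Qed.

Lemma redN x : absp x <= 1 -> red (- x) = - red x.
Proof.
by move=> x1; apply/eqP; rewrite -addr_eq0 -redD ?abspN// addNr red0.
Qed.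

Lemma redB x y : absp x <= 1 -> absp y <= 1 -> red (x - y) = red x - red y.
Proof. by move=> x1 y1; rewrite redD ?abspN// redN. Qed.

Lemma redX x n : absp x <= 1 -> red (x ^+ n) = red x ^+ n.
Proof.
move=> x1; elim: n => [|n IH]; first by rewrite !expr0 red1.
by rewrite !exprS redM ?IH// abspX exprn_ile1 ?absp_ge0.
Qed.

End Reduction.

(** * Character sums over binary cubic forms *)

Section CubicCharacterSums.
Variables (F : finFieldType) (C : fieldType) (chi : F -> C).
Hypothesis chiD : forall a b, chi (a + b) = chi a * chi b.
Hypothesis chi_nontrivial : exists c, chi c != 1.
Hypothesis chi_neq0 : forall a, chi a != 0.

Lemma chi0 : chi 0 = 1.
Proof. by apply: (mulIf (chi_neq0 0)); rewrite -chiD addr0 mul1r. Qed.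

(** Reindexing by h gives S = c S; this is the finite counterpart of [cint_twist]. *)
Lemma sum_twist (I : finType) (P : pred I) (f : I -> C) (h h' : I -> I) c :
  cancel h h' -> cancel h' h -> (forall i, P (h i) = P i) ->
  (forall i, P i -> f (h i) = c * f i) -> c != 1 -> \sum_(i | P i) f i = 0.
Proof.
move=> hK h'K Ph fh c1; set S := \sum_(i | _) _.
have : S = c * S.
  rewrite {1}/S (reindex h); last by exists h' => i _.
  by rewrite /S big_distrr; apply: eq_big => // i; rewrite Ph => /fh.
move/eqP; rewrite -subr_eq0 -{1}[S]mul1r -mulrBl mulf_eq0 subr_eq0 eq_sym.
by rewrite (negbTE c1) => /eqP.
Qed.

Lemma sum_chi d : d != 0 -> \sum_c chi (c * d) = 0.
Proof.
move=> d0; have [b b1] := chi_nontrivial.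
apply: (sum_twist (h := fun c => c + b / d) (h' := fun c => c - b / d)
    (c := chi b)) => // [c|c|c _]; rewrite ?addrK ?subrK//.
by rewrite mulrDl divfK// addrC chiD.
Qed.

Variables s0 s1 s2 s3 : F.
Let g : {poly F} := s3%:P + s2 *: 'X + s1 *: 'X^2 + s0 *: 'X^3.
Hypothesis g_size : size g = 4%N.
Hypothesis g_irr : irreducible_poly g.
Hypothesis two_neq0 : 2 != 0 :> F.
Hypothesis three_neq0 : 3 != 0 :> F.

Lemma coef_g k : g`_k = match k with 0%N => s3 | 1%N => s2 | 2%N => s1 | 3%N =>
    s0 | _ => 0 end.
Proof.
rewrite /g !coefE; case: k => [|[|[|[|k]]]] /=;
  by rewrite ?mulr0 ?mulr1 ?addr0 ?add0r.
Qed.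

Lemma s0_neq0 : s0 != 0.
Proof. by rewrite -[s0](coef_g 3) -[3%N]/(4.-1)%N -g_size -lead_coefE lead_coef_eq0
    -size_poly_eq0 g_size. Qed.

Lemma g_noroot r : s0 * r ^+ 3 + s1 * r ^+ 2 + s2 * r + s3 != 0.
Proof.
apply/eqP => e; have /factor_theorem[q gq] : root g r.
  by rewrite /root; apply/eqP; rewrite -[RHS]e /g !hornerE; ring.
have : ('X - r%:P) %= g.
  by apply: g_irr.2; rewrite ?size_XsubC// gq dvdp_mulIr.
by move=> /eqp_size; rewrite size_XsubC g_size.
Qed.

Definition form : Type := (F * F * F * F)%type.
HB.instance Definition _ := Finite.on form.
(** [h0], [h1], [h2] are, up to a constant, the coefficients of the Hessian of the binary cubic X
    a^3 + 3 y a^2 b + 3 u a b^2 + v b^3. Its discriminant [disc] is that of the cubic divided by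
    -27, and [cone] consists of the multiples of cubes of linear forms. *)
Definition h0 (w : form) := let: (X, y, u, v) := w in X * u - y ^+ 2.
Definition h1 (w : form) := let: (X, y, u, v) := w in X * v - u * y.
Definition h2 (w : form) := let: (X, y, u, v) := w in y * v - u ^+ 2.
Definition disc w := h1 w ^+ 2 - 4 * h0 w * h2 w.
Definition cone w := [&& h0 w == 0, h1 w == 0 & h2 w == 0].
(** On the cube with coordinates (r^3, r^2, r, 1) the pairing equals g(r); this is how the absence
    of roots enters. *)
Definition pairing (w : form) := let: (X, y, u, v) := w in
  s0 * X + s1 * y + s2 * u + s3 * v.

Definition translate (e w : form) : form := let: (X, y, u, v) := w in
  let: (X', y', u', v') := e in (X + X', y + y', u + u', v + v').

(** The pairing takes every value along the line spanned by e, so some translation along it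
    multiplies each term by a value of chi other than 1. *)
Lemma sum_form_translate (P : pred form) (e : form) : pairing e != 0 ->
  (forall t w, P (translate (let: (X, y, u, v) := e in (t * X, t * y, t * u,
      t * v)) w) = P w) ->
  \sum_(w | P w) chi (pairing w) = 0.
Proof.
case: e => [[[X y] u] v] e0 Pt; have [b b1] := chi_nontrivial.
pose t := b / pairing (X, y, u, v).
apply: (sum_twist (h := translate (t * X, t * y, t * u, t * v))
   (h' := translate (- (t * X), - (t * y), - (t * u), - (t * v))) (c := chi b)) => //.
- by move=> [[[? ?] ?] ?] /=; rewrite !addrK.
- by move=> [[[? ?] ?] ?] /=; rewrite !subrK.
move=> [[[X' y'] u'] v'] _; rewrite -chiD; congr chi.
by rewrite /t /=; field.
Qed.

(** Points with v = 0 are (X, 0, 0, 0), and their sum vanishes as s0 is nonzero. The others are v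
    (r^3, r^2, r, 1), where the pairing is v g(r) with g(r) nonzero; summing over nonzero v gives -1
    for each r. *)
Lemma sum_cone : \sum_(w | cone w) chi (pairing w) = - #|F|%:R.
Proof.
rewrite (bigID (fun w => w.2 == 0)) /=.
have -> : \sum_(w | cone w && (w.2 == 0)) chi (pairing w) = 0.
  rewrite (reindex_onto (fun X => (X, 0, 0, 0) : form) (fun w => w.1.1.1)); last first.
    move=> [[[X y] u] v] /andP[/and3P[/= e0 e1 e2] /eqP/= v0].
    move: e0 e2; rewrite v0 mulr0 sub0r oppr_eq0 expf_eq0/= => + /eqP u0.
    by rewrite u0 mulr0 sub0r oppr_eq0 expf_eq0/= => /eqP ->.
  rewrite (eq_bigl xpredT) => [|X]; last by rewrite /cone /=
      !(mul0r,mulr0,expr0n,subr0,eqxx).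
  rewrite -[RHS](sum_chi s0_neq0); apply: eq_bigr => X _.
  by congr chi; rewrite /=; ring.
rewrite add0r (reindex_onto (fun q : F * F => (q.2 * q.1 ^+ 3, q.2 * q.1 ^+ 2,
    q.2 * q.1, q.2) : form)
   (fun w => (w.1.2 / w.2, w.2))); last first.
  move=> [[[X y] u] v] /andP[/and3P[/= _ /eqP e1 /eqP e2] v0] /=.
  have v0' : v != 0 by [].
  have ye : y = u ^+ 2 / v by apply/(canRL (mulfK v0'))/eqP; rewrite -subr_eq0 e2.
  have Xe : X = u * y / v by apply/(canRL (mulfK v0'))/eqP; rewrite -subr_eq0 e1.
  by rewrite Xe ye; congr (_, _, _, _); field.
rewrite (eq_bigl (fun q => q.2 != 0)) => [|[r v]]; last first.
  rewrite /cone /=; have [->|v0] := eqVneq v 0; first by rewrite !andbF.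
  have -> : v * r / v = r by rewrite mulrC mulKf.
  rewrite eqxx !andbT; apply/and3P; split; apply/eqP; ring.
rewrite (eq_bigl (fun q : F * F => xpredT q.1 && (q.2 != 0)))//.
rewrite -(pair_big xpredT (fun v => v != 0) (fun r v => chi (pairing (v * r ^+ 3,
    v * r ^+ 2, v * r, v)))) /=.
rewrite (eq_bigr (fun=> -1)) => [|r _]; first by rewrite sumr_const mulNrn.
have := sum_chi (g_noroot r); rewrite (bigD1 0)//= mul0r chi0 => /eqP.
rewrite addrC addr_eq0 => /eqP <-; apply: eq_bigr => v v0.
by congr chi; rewrite /=; ring.
Qed.

(** Vanishing of the Hessian at the point (1 : -r), the zero of the linear form r a + b. The
    remaining point (0 : 1) of P^1 corresponds to [h2 w == 0]. *)
Definition hess_root (w : form) (r : F) := h0 w - r * h1 w + r ^+ 2 * h2 w == 0.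

(** A nonzero binary quadratic form has as many zeros in P^1 as its discriminant has square roots.
    The zero form has all |F| + 1 points as zeros while its discriminant has one square root, hence
    the term on the cone. *)
Lemma card_sqrt_disc w : (#|[pred Z | Z ^+ 2 == disc w]| + #|F| * cone w)%N =
  (#|hess_root w| + (h2 w == 0)%R)%N.
Proof.
rewrite /cone /hess_root /disc.
move: (h0 w) (h1 w) (h2 w) => a b c.
have [->|c0] := eqVneq c 0; last first.
  rewrite !andbF muln0 !addn0 -!sum1_card.
  (* Completing the square: with Z = 2 c r - b, Z^2 - (b^2 - 4 a c) is 4 c times the quadratic in
     r. *)
  rewrite (reindex (fun r => 2 * c * r - b)); last first.
    exists (fun Z => (Z + b) / (2 * c)) => Z _; first by field; rewrite c0.
    by field; rewrite c0.
  have c4 : 4 * c != 0.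
    by rewrite mulf_neq0// (_ : 4 = 2 * 2) ?mulf_neq0//; ring.
  apply: eq_bigl => r; rewrite !inE [RHS]unfold_in -[RHS](inj_eq (mulfI c4)).
  by rewrite mulr0 -subr_eq0; congr (_ == _); ring.
rewrite andbT; have [->|b0] := eqVneq b 0.
  have -> : #|[pred Z | Z ^+ 2 == 0 ^+ 2 - 4 * a * 0]| = 1%N.
    rewrite -[RHS](card1 (0 : F)); apply: eq_card => Z; rewrite !inE mulr0 subr0.
    by rewrite (expr0n F 2) mulr0n sqrf_eq0.
  rewrite andbT addnC; congr (_ + _)%N.
  have [->|a0] := eqVneq a 0.
    by rewrite muln1; apply/esym/eq_card => r;
        rewrite !inE unfold_in !(mulr0,subr0,addr0) eqxx.
  by rewrite muln0; apply/esym/eq_card0 => r;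
      rewrite !inE unfold_in !(mulr0,subr0,addr0) (negbTE a0).
rewrite andbF muln0 addn0.
have -> : #|[pred Z | Z ^+ 2 == b ^+ 2 - 4 * a * 0]| = 2%N.
  have bNb : b != - b.
    by rewrite -subr_eq0 opprK (_ : b + b = 2 * b) ?mulf_neq0//; ring.
  transitivity #|pred2 b (- b)|; last by rewrite card2 bNb.
  by apply: eq_card => Z; rewrite !inE mulr0 subr0 eqf_sqr.
rewrite [X in (X + _)%N](_ : _ = 1%N)//.
rewrite -[RHS](card1 (a / b)); apply: eq_card => r.
rewrite !inE unfold_in mulr0 addr0 subr_eq0 eq_sym.
by rewrite -[RHS](inj_eq (mulIf b0)) divfK.
Qed.

(** After exchanging sums, the forms whose Hessian vanishes at (1 : -r) are stable under adding
    multiples of (r a + b)^3, whose second derivatives vanish there; the pairing of that cube is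
    g(r). At (0 : 1) the cube is a^3, with pairing s0. So the sum over Hessian zeros is 0, and what
    remains is -|F| times the cone sum. *)
Lemma sum_sqrt_disc :
  \sum_w chi (pairing w) *+ #|[pred Z | Z ^+ 2 == disc w]| = #|F|%:R ^+ 2.
Proof.
have S0 : \sum_w chi (pairing w) *+ (#|hess_root w| + (h2 w == 0%R)) = 0.
  under eq_bigr do rewrite mulrnDr.
  rewrite big_split /= [X in _ + X](_ : _ = 0) ?addr0; last first.
    rewrite -[RHS](@sum_form_translate (fun w => h2 w == 0) (1, 0, 0, 0)).
    - by rewrite [RHS]big_mkcond; apply: eq_bigr => w _; case: (_ == _).
    - by rewrite /pairing !mulr0 !addr0 mulr1 s0_neq0.
    - by move=> t [[[X y] u] v] /=; rewrite !mulr0 !addr0.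
  rewrite (eq_bigr (fun w => \sum_(r | hess_root w r) chi (pairing w))); last first.
    by move=> w _; rewrite sumr_const.
  rewrite (exchange_big_dep xpredT)//= big1// => r _.
  apply: (@sum_form_translate (fun w => hess_root w r) (r ^+ 3, r ^+ 2, r, 1)).
    by rewrite /pairing mulr1 g_noroot.
  by move=> t [[[X y] u] v]; rewrite /hess_root /=; congr (_ == _); ring.
have : \sum_w chi (pairing w) *+ (#|[pred Z | Z ^+ 2 == disc w]| + #|F| * cone w) = 0.
  by rewrite -[RHS]S0; apply: eq_bigr => w _; rewrite card_sqrt_disc.
under eq_bigr do rewrite mulrnDr mulrnA mulrnAC.
rewrite big_split /= => /eqP; rewrite addr_eq0 => /eqP ->.
rewrite sumrMnl.
have -> : \sum_i chi (pairing i) *+ cone i = \sum_(w | cone w) chi (pairing w).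
  by rewrite [RHS]big_mkcond; apply: eq_bigr => w _; case: (cone w).
by rewrite sum_cone -mulr_natr; ring.
Qed.

(** (X, y, u, v) is read as a linear functional on polynomials of degree at most 3. It kills g' and
    3 g - x g' as well as their multiples by x. These two polynomials of degree at most 2 are
    coprime, so their multiples by polynomials of degree at most 1 fill the whole space. *)
Lemma annihilator_eq0 X y u v :
  s0 * X + s1 * y + s2 * u + s3 * v = 0 ->
  2 * s0 * X + s1 * y - s3 * v = 0 ->
  3 * s0 * y + 2 * s1 * u + s2 * v = 0 ->
  s1 * X + 2 * s2 * y + 3 * s3 * u = 0 ->
  [/\ X = 0, y = 0, u = 0 & v = 0].
Proof.
move=> e1 e2 e3 e4.
pose lam (f : {poly F}) := f`_3 * X + f`_2 * y + f`_1 * u + f`_0 * v.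
have lamD f f' : lam (f + f') = lam f + lam f' by rewrite /lam !coefD; ring.
have lamZ a f : lam (a *: f) = a * lam f by rewrite /lam !coefZ; ring.
(* After homogenizing g, [d] and [e] are its two partial derivatives. *)
pose d := g^`(); pose e := 3 *: g - 'X * d.
have dE k : d`_k = g`_k.+1 *+ k.+1 by rewrite coef_deriv.
have lam_d : lam d = 0.
  by rewrite /lam !dE !coef_g /= mul0rn mul0r add0r -[RHS]e3; ring.
have lam_Xd : lam ('X * d) = 0.
  rewrite /lam !coefXM /= !dE !coef_g /= mul0r addr0.
  rewrite -[RHS]addr0 -{1}e1 -e2; ring.
have eE k : e`_k = 3 * g`_k - (if k is k'.+1 then g`_k *+ k else 0).
  by rewrite coefB coefZ coefXM; case: k => //= k; rewrite dE.
have lam_e : lam e = 0.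
  transitivity (2 * (s0 * X + s1 * y + s2 * u + s3 * v) -
    (2 * s0 * X + s1 * y - s3 * v)); last by rewrite e1 e2 mulr0 subr0.
  by rewrite /lam !eE !coef_g /=; ring.
have lam_Xe : lam ('X * e) = 0.
  by rewrite /lam !coefXM /= !eE !coef_g /= -[RHS]e4; ring.
have size_lin (a f : {poly F}) : (size a <= 2)%N -> lam f = 0 -> lam ('X * f) = 0 ->
    lam (a * f) = 0.
  move=> a2 f0 Xf0; have -> : a = a`_1 *: 'X + a`_0 *: 1.
    apply/polyP => i; rewrite coefD !coefZ coefX coef1.
    case: i => [|[|i]] /=; rewrite ?mulr0 ?mulr1 ?addr0 ?add0r//.
    by rewrite nth_default// (leq_trans a2).
  by rewrite mulrDl -!scalerAl mul1r lamD !lamZ f0 Xf0 !mulr0 addr0.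
have d2 : d`_2 != 0.
  by rewrite dE coef_g /= -mulr_natl mulf_neq0 ?s0_neq0.
have size_d : size d = 3%N.
  apply/eqP; rewrite eqn_leq; apply/andP; split.
    by apply/leq_sizeP => j j3; rewrite dE coef_g; case: j j3 => [|[|[|j]]]//= _;
        rewrite mul0rn.
  by rewrite ltnNge; apply: contra d2 => d2; rewrite nth_default.
have d_neq0 : d != 0 by rewrite -size_poly_eq0 size_d.
have size_e : (size e <= 3)%N.
  apply/leq_sizeP => -[|[|[|j]]]// _; rewrite eE !coef_g/=.
  by case: j => [|j] /=; ring.
have cde : coprimep d e.
  rewrite /e addrC -mulNr coprimep_addl_mul coprimepZr//.
  rewrite coprimep_sym irreducible_poly_coprime//.
  by apply/negP => /dvdp_leq; rewrite g_size size_d => /(_ d_neq0).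
have lam0 (f : {poly F}) : (size f <= 4)%N -> lam f = 0.
  move=> f4; have /Bezout_eq1_coprimepP[[U V] /= UV] := cde.
  (* Reducing the coefficient of e modulo d makes it of degree at most 1; the degree of f - B e then
     bounds that of A. *)
  pose B := (f * V) %% d; pose A := f * U + (f * V) %/ d * e.
  have fE : f = A * d + B * e.
    rewrite -[LHS]mulr1 -UV mulrDr !mulrA [X in _ + X * e](divp_eq (f * V) d) /A
        -/B; ring.
  have B2 : (size B <= 2)%N by rewrite -ltnS -size_d ltn_modp.
  have A2 : (size A <= 2)%N.
    have [->|A0] := eqVneq A 0; first by rewrite size_poly0.
    have : (size (A * d)%R <= 4)%N.
      rewrite (_ : A * d = f - B * e); last by rewrite {1}fE addrK.
      rewrite (leq_trans (size_polyD _ _))// geq_max f4 size_polyN.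
      rewrite (leq_trans (size_polyMleq _ _))// -subn1 leq_subLR.
      exact: leq_add B2 size_e.
    by rewrite size_mul// size_d addn3.
  by rewrite fE lamD (size_lin A d)// (size_lin B e)// addr0.
have lamXn k : (k <= 3)%N -> lam 'X^k = 0.
  by move=> k3; apply: lam0; rewrite size_polyXn ltnS.
split.
- by have := lamXn 3 isT; rewrite /lam !coefXn /= !(mul0r, mul1r, addr0).
- by have := lamXn 2 isT; rewrite /lam !coefXn /= !(mul0r, mul1r, add0r, addr0).
- by have := lamXn 1 isT; rewrite /lam !coefXn /= !(mul0r, mul1r, add0r, addr0).
- by have := lamXn 0 isT; rewrite /lam !coefXn /= !(mul0r, mul1r, add0r, addr0).
Qed.

End CubicCharacterSums.

(** * Heights and the Iwasawa decomposition *)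

Section Height.
Context {R : realType} {p : nat} {K : padicField R p}.
Local Notation Qp := (Qp K).

Definition minor2 n (A : 'M[Qp]_(2, n)) (i j : 'I_n) : Qp :=
  A 0 i * A 1 j - A 0 j * A 1 i.

(** The sup norm of the Pluecker coordinates of the row space. *)
Definition height n (A : 'M[Qp]_(2, n)) : R :=
  \big[Num.max/0]_(ij : 'I_n * 'I_n) absp (minor2 A ij.1 ij.2).

Lemma height_ge0 n (A : 'M[Qp]_(2, n)) : 0 <= height A.
Proof. exact: bigmax_ge_id. Qed.

Lemma le_height n (A : 'M[Qp]_(2, n)) i j : absp (minor2 A i j) <= height A.
Proof. exact: (le_bigmax _ (fun ij => absp (minor2 A ij.1 ij.2)) (i, j)). Qed.

Lemma height_le n (A : 'M[Qp]_(2, n)) r : 0 <= r ->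
  (forall i j, absp (minor2 A i j) <= r) -> height A <= r.
Proof. by move=> r0 Ar; apply: bigmax_le => // -[i j] _; exact: Ar. Qed.

Definition integral_mx m n (A : 'M[Qp]_(m, n)) := forall i j, absp (A i j) <= 1.

Lemma integral_mxM m n q (A : 'M[Qp]_(m, n)) (B : 'M[Qp]_(n, q)) :
  integral_mx A -> integral_mx B -> integral_mx (A *m B).
Proof.
move=> iA iB i j; rewrite mxE; apply: absp_sum_le => // l _.
by rewrite abspM mulr_ile1 ?absp_ge0.
Qed.

Lemma minor2M n m (A : 'M[Qp]_(2, n)) (k : 'M[Qp]_(n, m)) i j :
  minor2 (A *m k) i j = \sum_l (\sum_q (minor2 A l q * (k l i * k q j))).
Proof.
rewrite /minor2 !mxE !big_distrlr /= [X in _ - X]exchange_big /= -sumrB.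
apply: eq_bigr => l _; rewrite -sumrB; apply: eq_bigr => l' _; ring.
Qed.

Lemma heightM_le n m (A : 'M[Qp]_(2, n)) (k : 'M[Qp]_(n, m)) : integral_mx k ->
  height (A *m k) <= height A.
Proof.
move=> ik; apply: height_le => [|i j]; first exact: height_ge0.
rewrite minor2M; apply: absp_sum_le => [|l _]; first exact: height_ge0.
apply: absp_sum_le => [|l' _]; first exact: height_ge0.
rewrite !abspM (le_trans _ (le_height A l l'))// ler_piMr ?absp_ge0//.
by rewrite mulr_ile1 ?absp_ge0.
Qed.

Lemma height_mulr n (A : 'M[Qp]_(2, n)) (k k' : 'M[Qp]_n) :
  integral_mx k -> integral_mx k' -> k *m k' = 1%:M -> height (A *m k) = height A.
Proof.
move=> ik ik' kk'; apply/eqP; rewrite eq_le heightM_le//=.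
by rewrite -{1}[A]mulmx1 -kk' mulmxA heightM_le.
Qed.

Lemma height_mull n (A : 'M[Qp]_(2, n)) (g : 'M[Qp]_2) :
  height (g *m A) = absp (\det g) * height A.
Proof.
have minE i j : minor2 (g *m A) i j = \det g * minor2 A i j.
  have e0 : lift ord0 ord0 = 1 :> 'I_2 by apply/val_inj.
  by rewrite /minor2 !mxE !big_ord_recl !big_ord0 det_mx2E !e0; ring.
rewrite /height; under eq_bigr do rewrite minE abspM.
rewrite -[in LHS](mulr0 (absp (\det g))).
elim/big_rec2 : _ => [|ij a b _ ->]; first by rewrite mulr0.
by rewrite maxr_pMr ?absp_ge0.
Qed.

End Height.

(** * Integral points of G_2 and the Iwasawa decomposition of w0 N *)

Section IntegralPoints.
Context {R : realType} {p : nat} {K : padicField R p}.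
Local Notation Qp := (Qp K).
Implicit Types x y z u v t a d : Qp.

Fixpoint rows_integral (A : seq (seq Qp)) : Prop :=
  if A is r :: A' then
    foldr (fun x P => absp x <= 1 /\ P) True r /\ rows_integral A'
  else True.

Lemma integral_rows_mx m n A : rows_integral A -> integral_mx (rows_mx m n A).
Proof.
move=> iA i j; rewrite mxE; move: {i j}(val i) (val j) => i j.
elim: A iA i => [_|r A IH /= [ir iA]] [|i] /=.
- by rewrite !nth_nil absp0.
- by rewrite !nth_nil absp0.
- clear IH iA; elim: r ir j => [_|x r IHr /= [x1 ir]] [|j] //=; rewrite ?absp0//.
  exact: IHr.
- exact: IH.
Qed.

Lemma zp0 : absp (0 : Qp) <= 1. Proof. by rewrite absp0. Qed.
Lemma zp1 : absp (1 : Qp) <= 1. Proof. by rewrite absp1. Qed.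
Lemma zp_nat n : absp (n%:R : Qp) <= 1. Proof. exact: absp_nat_le1. Qed.
Lemma zpN x : absp x <= 1 -> absp (- x) <= 1. Proof. by rewrite abspN. Qed.
Lemma zpD x y : absp x <= 1 -> absp y <= 1 -> absp (x + y) <= 1.
Proof. exact: abspD_le. Qed.
Lemma zpM x y : absp x <= 1 -> absp y <= 1 -> absp (x * y) <= 1.
Proof. by move=> x1 y1; rewrite abspM mulr_ile1 ?absp_ge0. Qed.
Lemma zpX x n : absp x <= 1 -> absp (x ^+ n) <= 1.
Proof. by move=> x1; rewrite abspX exprn_ile1 ?absp_ge0. Qed.

End IntegralPoints.

(** Z_p is a subring: proves integrality of polynomial expressions in integral quantities. *)
Ltac zp := repeat first [assumption | exact: I | split | exact: zp0 | exact: zp1 |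
  exact: zp_nat | apply: zpN | apply: zpD | apply: zpM | apply: zpX].

Section G2Integral.
Context {R : realType} {p : nat} {K : padicField R p}.
Local Notation Qp := (Qp K).
Implicit Types (x y z u v t a d : Qp) (h k : 'M[Qp]_8).

Lemma integral_n x y z u v : absp x <= 1 -> absp y <= 1 -> absp z <= 1 ->
  absp u <= 1 -> absp v <= 1 -> integral_mx (n_mx x y z u v).
Proof. by move=> *; apply: integral_rows_mx; rewrite /=; zp. Qed.

Lemma integral_nminus x : absp x <= 1 -> integral_mx (nminus_mx x 0 0 0 0).
Proof. by move=> *; apply: integral_rows_mx; rewrite /=; zp. Qed.

Lemma integral_xa t : absp t <= 1 -> integral_mx (xa t).
Proof. by move=> *; rewrite xaE; apply: integral_rows_mx; rewrite /=; zp. Qed.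

Lemma integral_ya t : absp t <= 1 -> integral_mx (ya t).
Proof. by move=> *; rewrite yaE; apply: integral_rows_mx; rewrite /=; zp. Qed.

Lemma G2M h k : G2 h -> G2 k -> G2 (h *m k).
Proof.
by move=> Gh Gk H HH; have [[_ _ + _] _] := HH; apply; [exact: Gh|exact: Gk].
Qed.

Lemma G2_n x y z u v : G2 (n_mx x y z u v).
Proof. by move=> H [_ sH]; apply: sH; left; left; exists x, y, z, u, v. Qed.

Lemma G2_nminus x y z u v : G2 (nminus_mx x y z u v).
Proof. by move=> H [_ sH]; apply: sH; left; right; exists x, y, z, u, v. Qed.

Lemma G2_m (g : 'M[Qp]_2) : g \in unitmx -> G2 (m_mx g).
Proof. by move=> gu H [_ sH]; apply: sH; right; exists g. Qed.

(** Integrality is certified by an explicit integral inverse, so that [invmx] never has to be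
    computed. *)
Lemma G2_ZpP k : G2_Zp k <-> G2 k /\
  exists k', [/\ k *m k' = 1%:M, integral_mx k & integral_mx k'].
Proof.
split=> [[Gk [ku ik ik']]|[Gk [k' [kk' ik ik']]]].
  by split => //; exists (invmx k); rewrite mulmxV.
have ku := (mulmx1_unit kk').1.
have k'E : k' = invmx k by rewrite -[RHS]mulmx1 -kk' mulKmx.
by split => //; split => // i j; rewrite -k'E; exact: ik'.
Qed.

Lemma G2_ZpM h k : G2_Zp h -> G2_Zp k -> G2_Zp (h *m k).
Proof.
move=> /G2_ZpP[Gh [h' [hh' ih ih']]] /G2_ZpP[Gk [k' [kk' ik ik']]].
apply/G2_ZpP; split; first exact: G2M.
exists (k' *m h'); split; [|exact: integral_mxM|exact: integral_mxM].
by rewrite mulmxA -(mulmxA h) kk' mulmx1.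
Qed.

Lemma G2_Zp1 : G2_Zp (1%:M : 'M[Qp]_8).
Proof.
rewrite -n_mx0; apply/G2_ZpP; split; first exact: G2_n.
exists (n_mx 0 0 0 0 0); split; [|by apply: integral_n; rewrite absp0..].
by rewrite n_mxM -n_mx0; congr n_mx; ring.
Qed.

Lemma G2_Zp_nv v : absp v <= 1 -> G2_Zp (n_mx 0 0 0 0 v).
Proof.
move=> v1; apply/G2_ZpP; split; first exact: G2_n.
exists (n_mx 0 0 0 0 (- v)).
by rewrite n_mxM -n_mx0; split; [congr n_mx; ring|apply: integral_n; zp..].
Qed.

Lemma G2_Zp_nminus x : absp x <= 1 -> G2_Zp (nminus_mx x 0 0 0 0).
Proof.
move=> x1; apply/G2_ZpP; split; first exact: G2_nminus.
exists (nminus_mx (- x) 0 0 0 0).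
by rewrite nminus_mxM subrr nminus_mx0; split => //; apply: integral_nminus; zp.
Qed.

Lemma unit_mx2 a b c d : a * d - b * c != 0 -> mx2 a b c d \in unitmx.
Proof. by rewrite unitmxE unitfE det_mx2. Qed.

Lemma unit_xa t : mx2 1 t 0 1 \in unitmx.
Proof. by rewrite unit_mx2// mulr0 subr0 mulr1 oner_neq0. Qed.

Lemma unit_ya t : mx2 1 0 t 1 \in unitmx.
Proof. by rewrite unit_mx2// mul0r subr0 mulr1 oner_neq0. Qed.

Lemma unit_torus a d : a != 0 -> d != 0 -> mx2 a 0 0 d \in unitmx.
Proof. by move=> a0 d0; rewrite unit_mx2// mulr0 subr0 mulf_neq0. Qed.

Lemma xaM t t' : xa t *m xa t' = xa (t + t').
Proof.
by rewrite /xa (m_mxM (unit_xa t) (unit_xa t')) mx2M !(mul1r, mulr1, mul0r, mulr0,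
    addr0, add0r) addrC.
Qed.

Lemma yaM t t' : ya t *m ya t' = ya (t + t').
Proof.
by rewrite /ya (m_mxM (unit_ya t) (unit_ya t')) mx2M !(mul1r, mulr1, mul0r, mulr0,
    addr0, add0r).
Qed.

Lemma xa0 : xa 0 = 1%:M :> 'M[Qp]_8.
Proof. by rewrite xaE rows_mx1; rows_eq; ring. Qed.

Lemma ya0 : ya 0 = 1%:M :> 'M[Qp]_8.
Proof. by rewrite yaE rows_mx1; rows_eq; ring. Qed.

Lemma G2_Zp_xa t : absp t <= 1 -> G2_Zp (xa t).
Proof.
move=> t1; apply/G2_ZpP; split; first exact: (G2_m (unit_xa t)).
by exists (xa (- t)); rewrite xaM subrr xa0; split => //; apply: integral_xa; zp.
Qed.

Lemma G2_Zp_ya t : absp t <= 1 -> G2_Zp (ya t).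
Proof.
move=> t1; apply/G2_ZpP; split; first exact: (G2_m (unit_ya t)).
by exists (ya (- t)); rewrite yaM subrr ya0; split => //; apply: integral_ya; zp.
Qed.

Lemma G2_Zp_sb : G2_Zp (sb Qp).
Proof.
rewrite sbE.
by apply: G2_ZpM; [apply: G2_ZpM; [apply: G2_Zp_nv|apply: G2_Zp_nminus]|apply:
    G2_Zp_nv]; zp.
Qed.

Lemma saE_xa_ya : sa Qp = xa 1 *m ya (-1) *m xa 1.
Proof.
rewrite /xa /ya !m_mxM ?unitmx_mul ?unit_xa ?unit_ya// !mx2M.
by rewrite !(mul1r, mulr1, mul0r, mulr0, addr0, add0r) subrr add0r addNr.
Qed.

Lemma G2_Zp_sa : G2_Zp (sa Qp).
Proof.
rewrite saE_xa_ya.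
by apply: G2_ZpM; [apply: G2_ZpM; [apply: G2_Zp_xa|apply: G2_Zp_ya]|apply:
    G2_Zp_xa]; zp.
Qed.

Definition decomposable h := exists n g k,
  [/\ N_set n, g \in unitmx, G2_Zp k & h = n *m m_mx g *m k].

Lemma decomposable_torus a d h : a != 0 -> d != 0 ->
  decomposable h -> decomposable (torus a d *m h).
Proof.
move=> a0 d0 [_ [g [k [[x [y [z [u [v ->]]]]] gu Gk ->]]]].
exists (n_mx (a ^+ 2 / d * x) (a * y) (a * d * z) (d * u) (d ^+ 2 / a * v)),
  (mx2 a 0 0 d *m g), k; split => //; first by do 5 eexists.
  by rewrite unitmx_mul unit_torus.
by rewrite -m_mxM ?unit_torus// !mulmxA torus_n.
Qed.

Lemma decomposable_mulr h k : decomposable h -> G2_Zp k -> decomposable (h *m k).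
Proof.
move=> [n [g [k' [Nn gu Gk' ->]]]] Gk; exists n, g, (k' *m k); split => //.
  exact: G2_ZpM.
by rewrite !mulmxA.
Qed.

(* Downward induction along a reduced word of w0, on products C of simple
   reflections: C U lies in N M G_2(Z_p), U the unipotent radical of the Borel
   subgroup, and C normalizes the torus. *)
Definition reaches (C : 'M[Qp]_8) :=
  (forall x y z u v t, decomposable (C *m (n_mx x y z u v *m xa t))) /\
  (forall a d, a != 0 -> d != 0 -> exists a' d',
     [/\ a' != 0, d' != 0 & C *m torus a d = torus a' d' *m C]).

Lemma reaches1 : reaches 1%:M.
Proof.
split=> [x y z u v t|a d a0 d0]; last by exists a, d; rewrite mul1mx mulmx1.
rewrite mul1mx -[_ *m xa t]mulmx1; exists (n_mx x y z u v), (mx2 1 t 0 1), 1%:M.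
by split => //; [do 5 eexists|exact: unit_xa|exact: G2_Zp1].
Qed.

(** The torus element moves left through U, only rescaling its coordinates, then through C, and is
    absorbed into M. *)
Lemma reaches_torus C x y z u v t a d k : reaches C -> a != 0 -> d != 0 ->
  G2_Zp k ->
  decomposable (C *m (n_mx x y z u v *m xa t) *m torus a d *m k).
Proof.
move=> [CU CT] a0 d0 Gk; apply: decomposable_mulr => //.
have [a' [d' [a'0 d'0 CTE]]] := CT _ _ a0 d0.
pose n' := n_mx (d / a ^+ 2 * x) (y / a) (z / (a * d)) (u / d) (a / d ^+ 2 * v).
have nT : n_mx x y z u v *m torus a d = torus a d *m n'.
  by rewrite torus_n//; congr (n_mx _ _ _ _ _ *m _); field; rewrite ?a0 ?d0.
rewrite -!mulmxA xa_torus// (mulmxA (n_mx _ _ _ _ _)) nT.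
rewrite -(mulmxA (torus a d)) (mulmxA C) CTE -(mulmxA (torus a' d'));
    apply: decomposable_torus => //; exact: CU.
Qed.

(** Among the positive roots only that of v fails to cross [sb]. If v is integral, its factor joins
    the compact part; otherwise the rank-one decomposition replaces it by upper, torus and integral
    lower factors. *)
Lemma reaches_sb C : reaches C -> reaches (C *m sb Qp).
Proof.
move=> rC; have [CU CT] := rC; split=> [x y z u v t|a d a0 d0]; last first.
  have [a' [d' [a'0 d'0 CTE]]] := CT a (a / d) a0 (mulf_neq0 a0 (invr_neq0 d0)).
  by exists a', d'; split => //; rewrite -(mulmxA C) sb_torus// (mulmxA C) CTE
      -(mulmxA _ C).
rewrite -mulmxA.
have [x2 [y2 [z2 [u2 [v2 [t2 ->]]]]]] : exists x2 y2 z2 u2 v2 t2,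
    sb Qp *m (n_mx x y z u v *m xa t) =
    n_mx x2 y2 z2 u2 v2 *m xa t2 *m (sb Qp *m n_mx 0 0 0 0 v).
  rewrite n_xa.
  move: (x - _ - _ - _) (y + _ + _) (z + _ + _ + _) (u + _) => x' y' z' u'.
  have -> : n_mx x' y' z' u' v = n_mx x' y' z' u' 0 *m n_mx 0 0 0 0 v.
    by rewrite n_mxM; congr n_mx; ring.
  rewrite (mulmxA (xa t)) (mulmxA (sb Qp)) sb_xa_n xa_n -(mulmxA _ (sb Qp)).
  by do 6 eexists.
have [v1|v1] := leP (absp v) 1.
  rewrite mulmxA; apply: decomposable_mulr; first exact: CU.
  by apply: G2_ZpM; [exact: G2_Zp_sb|exact: G2_Zp_nv].
have v0 : v != 0 by rewrite -absp_gt0 (lt_trans _ v1).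
rewrite sb_iwasawa//.
(* The new upper unipotent factor crosses [xa t2], which normalizes N. *)
have [x3 [y3 [z3 [u3 [v3 E3]]]]] : exists x3 y3 z3 u3 v3,
    n_mx x2 y2 z2 u2 v2 *m xa t2 *m n_mx 0 0 0 0 (- v^-1) =
    n_mx x3 y3 z3 u3 v3 *m xa t2.
  by do 5 eexists; rewrite -mulmxA xa_n mulmxA n_mxM.
have assoc (B N T M : 'M[Qp]_8) : C *m (B *m (N *m T *m M)) = C *m (B *m N) *m T *m M.
  by rewrite !mulmxA.
rewrite {}assoc; move: (n_mx 0 0 0 0 (- v^-1)) E3 => N E3.
move: (_ *m xa t2) E3 => B ->; apply: reaches_torus;
    rewrite ?oner_neq0 ?oppr_eq0 ?invr_eq0//.
by apply: G2_Zp_nminus; rewrite abspV invf_le1 ?ltW// (lt_trans _ v1).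
Qed.

(** Here N is normalized by [sa], and only the factor [xa t] needs the rank-one decomposition. *)
Lemma reaches_sa C : reaches C -> reaches (C *m sa Qp).
Proof.
move=> rC; have [CU CT] := rC; split=> [x y z u v t|a d a0 d0]; last first.
  have [a' [d' [a'0 d'0 CTE]]] := CT d a d0 a0.
  by exists a', d'; split => //; rewrite -(mulmxA C) sa_torus// (mulmxA C) CTE
      -(mulmxA _ C).
rewrite -mulmxA (mulmxA (sa Qp)) sa_n -mulmxA.
move: (z - _ - _) (- y) (- x) => z' y' x'.
have [t1|t1] := leP (absp t) 1.
  rewrite (mulmxA (n_mx v u z' y' x')) -(mulmxA _ (sa Qp)) (mulmxA C).
  apply: decomposable_mulr.
    by have := CU v u z' y' x' 0; rewrite xa0 mulmx1.
  by apply: G2_ZpM; [exact: G2_Zp_sa|exact: G2_Zp_xa].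
have t0 : t != 0 by rewrite -absp_gt0 (lt_trans _ t1).
rewrite sa_iwasawa// 2!(mulmxA (n_mx v u z' y' x')) 2!(mulmxA C).
apply: reaches_torus; rewrite ?oppr_eq0 ?invr_eq0//.
by apply: G2_Zp_ya; rewrite abspV invf_le1 ?ltW// (lt_trans _ t1).
Qed.

Lemma decomposable_w0 x y z u v : decomposable (w0 Qp *m n_mx x y z u v).
Proof.
have -> : n_mx x y z u v = n_mx x y z u v *m xa 0 by rewrite xa0 mulmx1.
have r := reaches_sb (reaches_sa (reaches_sb (reaches_sa (reaches_sb reaches1)))).
rewrite w0E -!(mulmxA (torus 1 (-1))).
apply: decomposable_torus; rewrite ?oppr_eq0 ?oner_neq0//.
by have := r.1 x y z u v 0; rewrite mul1mx.
Qed.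

Definition last_rows : 'M[Qp]_(2, 8) := rows_mx 2 8
  [:: [:: 0; 0; 0; 0; 0; 0; 1; 0]; [:: 0; 0; 0; 0; 0; 0; 0; 1]].

Definition first_rows : 'M[Qp]_(2, 8) := rows_mx 2 8
  [:: [:: 1; 0; 0; 0; 0; 0; 0; 0]; [:: 0; 1; 0; 0; 0; 0; 0; 0]].

Lemma last_rows_n x y z u v : last_rows *m n_mx x y z u v = last_rows.
Proof. by rewrite /last_rows; rows_eq; ring. Qed.

Lemma last_rows_w0 : last_rows *m w0 Qp = first_rows.
Proof. by rewrite /last_rows /first_rows; rows_eq; ring. Qed.

Lemma last_rows_m (g : 'M[Qp]_2) : last_rows *m m_mx g =
  ((\det g)^-1 *: mx2 (g 0 0) (- g 0 1) (- g 1 0) (g 1 1)) *m last_rows.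
Proof.
rewrite m_mxE det_mx2E rows_mxZ /last_rows.
by rows_eq; ring.
Qed.

Lemma height_last_rows : height last_rows = 1.
Proof.
apply/eqP; rewrite eq_le; apply/andP; split.
  apply: height_le => // i j.
  have il : integral_mx last_rows by apply: integral_rows_mx; rewrite /=; zp.
  by rewrite /minor2; apply: zpD; [|apply: zpN]; apply: zpM; exact: il.
rewrite (le_trans _ (le_height _ (inord 6) (inord 7)))//.
by rewrite /minor2 !mxE !inordK//= mul0r mulr1 subr0 absp1.
Qed.

Lemma height_decomposition n (g : 'M[Qp]_2) k :
  N_set n -> g \in unitmx -> G2_Zp k ->
  height (last_rows *m (n *m m_mx g *m k)) = (absp (\det g))^-1.
Proof.
move=> [x [y [z [u [v ->]]]]]; rewrite unitmxE unitfE => g0.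
move=> /G2_ZpP[_ [k' [kk' ik ik']]].
rewrite !mulmxA (height_mulr _ ik ik' kk') last_rows_n last_rows_m height_mull.
(* The lower right block of m(g) has determinant (det g)^-2 det g = (det g)^-1. *)
rewrite height_last_rows mulr1 detZ det_mx2 abspM mulrNN -det_mx2E abspX abspV.
by rewrite expr2 -mulrA mulVf ?absp_eq0// mulr1.
Qed.

(** Whichever decomposition [xget] selects, its |det g| is the inverse of the same height;
    [decomposable_w0] excludes the default value. *)
Lemma f_circE s x y z u v : f_circ s (w0 Qp *m n_mx x y z u v) =
  rpowc (height (first_rows *m n_mx x y z u v))^-1 (3 * s).
Proof.
rewrite /f_circ; case: xgetP => [c _ [n [g [k [Nn gu Gk hE ->]]]]|].
  rewrite -last_rows_w0 -mulmxA hE height_decomposition// invrK//.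
have [n [g [k [Nn gu Gk hE]]]] := decomposable_w0 x y z u v.
by move=> /(_ (rpowc (absp (\det g)) (3 * s)))[]; exists n, g, k.
Qed.

End G2Integral.

(** * Haar measure *)

Section Haar.
Context {R : realType} {p : nat} {K : padicField R p}.
Local Notation Qp := (Qp K).
Local Notation borelQp := (borelQp K).
Hypothesis p_prime : prime p.
Implicit Types (x y c : Qp) (r : R).

Let p_gt0 : (0 : R) < p%:R. Proof. by rewrite ltr0n prime_gt0. Qed.
Let p_gt1 : (1 : R) < p%:R. Proof. by rewrite ltr1n prime_gt1. Qed.

Lemma ballQpE c r : ball (c : Qp) r = [set x | absp (c - x) < r].
Proof. by []. Qed.

Definition cball c r : set Qp := [set x | absp (x - c) <= r].

Lemma cball_eq c c' r : absp (c' - c) <= r -> cball c r = cball c' r.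
Proof.
move=> cc'; apply/seteqP; split=> x; rewrite /cball/= => xc.
  have -> : x - c' = (x - c) - (c' - c) by ring.
  exact: abspB_le.
have -> : x - c = (x - c') + (c' - c) by ring.
exact: abspD_le.
Qed.

Lemma open_cball c r : 0 < r -> open (cball c r).
Proof.
move=> r0; rewrite openE => x xc; apply/nbhs_ballP; exists r => //= y.
rewrite ballQpE/= => xy; rewrite (cball_eq xc)/cball/= abspBC; exact: ltW.
Qed.

Lemma open_measurable_Qp (U : set Qp) : open U -> measurable (U : set borelQp).
Proof. exact: sub_sigma_algebra. Qed.

Lemma measurable_cball c r : 0 < r -> measurable (cball c r : set borelQp).
Proof. by move=> r0; exact: (open_measurable_Qp (@open_cball c r r0)). Qed.

Lemma exp_small r : 0 < r -> exists n : nat, p%:R ^- n < r.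
Proof.
move=> r0; have p1 : `|p%:R^-1 : R| < 1.
  by rewrite ger0_norm ?invr_ge0 ?(ltW p_gt0)// invf_lt1.
have /cvgrPdist_lt/(_ _ r0)[n _ /(_ n (leqnn n))] := cvg_geometric 1 p1.
rewrite /geometric /= sub0r normrN mul1r ger0_norm ?exprn_ge0 ?invr_ge0 ?(ltW p_gt0)//.
by rewrite exprVn; exists n.
Qed.

(** A countable base of the topology. *)
Definition rball (i : rat * nat) : set Qp := cball (ratr i.1) (p%:R ^- i.2).

Lemma rball_nbhs x r : 0 < r -> exists i,
    rball i x /\ rball i `<=` [set y | absp (y - x) < r].
Proof.
move=> r0; have [n nr] := exp_small r0.
have n0 : (0 : R) < p%:R ^- n by rewrite invr_gt0 exprn_gt0.
have [q xq] := ratr_approx x n0.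
exists (q, n); split; first exact: ltW.
move=> y; rewrite /rball/= (@cball_eq _ x) 1?ltW//.
by rewrite /cball/= => /le_lt_trans -> .
Qed.

Lemma open_rballs (U : set Qp) : open U ->
  U = \bigcup_(i in [set i | rball i `<=` U]) rball i.
Proof.
move=> oU; apply/seteqP; split=> [x Ux|x [i /= iU ix]]; last exact: iU.
move: oU; rewrite openE => /(_ _ Ux)/nbhs_ballP[r /= r0 rU].
have [i [ix ir]] := rball_nbhs x r0.
by exists i => //= y /ir yx; apply: rU; rewrite ballQpE/= abspBC.
Qed.

Lemma measurable_rball i : measurable (rball i : set borelQp).
Proof. by apply: measurable_cball; rewrite invr_gt0 exprn_gt0. Qed.

Lemma bigcup_countable_measurable d (T : measurableType d) (I : countType)
  (P : set I) (F : I -> set T) : (forall i, P i -> measurable (F i)) ->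
  measurable (\bigcup_(i in P) F i).
Proof.
move=> mF; rewrite bigcup_mkcond; apply: countable_bigcupT_measurable => //.
by move=> i; case: ifPn => [/set_mem/mF//|_]; exact: measurable0.
Qed.

(** The product carries the product sigma-algebra; the countable base writes the preimage of an open
    set as a countable union of boxes. *)
Lemma measurable_cont2 (f : Qp -> Qp -> Qp) :
  (forall x y r, 0 < r -> exists2 r', 0 < r' & forall x' y',
     absp (x' - x) < r' -> absp (y' - y) < r' -> absp (f x' y' - f x y) < r) ->
  measurable_fun setT (fun q : borelQp * borelQp => f q.1 q.2 : borelQp).
Proof.
move=> fc.
have mE : @measurable _ borelQp = <<s (@open Qp : set (set borelQp)) >> by [].
apply: (measurability _ mE) => // _ [U oU <-]; rewrite setTI.
pose box (i : (rat * nat) * (rat * nat)) : set (borelQp * borelQp) :=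
  rball i.1 `*` rball i.2.
have -> : (fun q : borelQp * borelQp => f q.1 q.2 : borelQp) @^-1` U =
    \bigcup_(i in [set i | box i `<=` (fun q => f q.1 q.2) @^-1` U]) box i.
  apply/seteqP; split=> [[x y]/= Uxy|q [i /= iU iq]]; last exact: iU.
  move: oU; rewrite openE => /(_ _ Uxy)/nbhs_ballP[r /= r0 rU].
  have [r' r'0 fr'] := fc x y r r0.
  have [i [ix ir]] := rball_nbhs x r'0; have [j [jy jr]] := rball_nbhs y r'0.
  exists (i, j) => //= -[x' y'] /= [/ir x'x /jr y'y]; apply: rU.
  by rewrite ballQpE/= abspBC; exact: fr'.
apply: bigcup_countable_measurable => i _; apply: measurableX; exact: measurable_rball.
Qed.

Lemma measurable_add : measurable_fun setT
  (fun q : borelQp * borelQp => (q.1 + q.2 : Qp) : borelQp).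
Proof.
apply: (@measurable_cont2 (fun x y => x + y)) => x y r r0.
exists r => // x' y' x'x y'y.
have -> : x' + y' - (x + y) = (x' - x) + (y' - y) by ring.
exact: abspD_lt.
Qed.

Lemma measurable_mul : measurable_fun setT
  (fun q : borelQp * borelQp => (q.1 * q.2 : Qp) : borelQp).
Proof.
apply: (@measurable_cont2 (fun x y => x * y)) => x y r r0.
(* [M] bounds both |y| and |x'| as soon as |x' - x| < 1. *)
pose M := 1 + absp x + absp y.
have M1 : 1 <= M by rewrite /M -addrA lerDl addr_ge0 ?absp_ge0.
have M0 : 0 < M by rewrite (lt_le_trans ltr01).
exists (Num.min 1 (r / M)) => [|x' y']; first by rewrite lt_min ltr01 divr_gt0.
rewrite !lt_min => /andP[x'1 x'r] /andP[y'1 y'r].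
have -> : x' * y' - x * y = x' * (y' - y) + (x' - x) * y by ring.
have xM : absp x <= M by rewrite /M -addrA addrCA lerDl addr_ge0 ?absp_ge0.
have yM : absp y <= M by rewrite /M addrC lerDl addr_ge0 ?absp_ge0.
have x'M : absp x' <= M.
  by rewrite -[x'](subrK x) abspD_le// (le_trans _ M1)// ltW.
apply: abspD_lt; rewrite abspM.
  by rewrite (le_lt_trans (ler_wpM2r (absp_ge0 _) x'M))// mulrC -ltr_pdivlMr.
by rewrite (le_lt_trans (ler_wpM2l (absp_ge0 _) yM))// -ltr_pdivlMr.
Qed.

Section MeasurableArith.
Context d (S : measurableType d).
Implicit Types f g : S -> borelQp.

Lemma measurable_funDQp f g : measurable_fun setT f -> measurable_fun setT g ->
  measurable_fun setT (fun t => (f t : Qp) + g t : borelQp).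
Proof.
by move=> mf mg; exact: (measurableT_comp measurable_add (measurable_fun_pair mf mg)).
Qed.

Lemma measurable_funMQp f g : measurable_fun setT f -> measurable_fun setT g ->
  measurable_fun setT (fun t => (f t : Qp) * g t : borelQp).
Proof.
by move=> mf mg; exact: (measurableT_comp measurable_mul (measurable_fun_pair mf mg)).
Qed.

Lemma measurable_funNQp f : measurable_fun setT f ->
  measurable_fun setT (fun t => - (f t : Qp) : borelQp).
Proof.
move=> mf; rewrite (_ : (fun _ => _) = (fun t => (-1 : Qp) * f t : borelQp)).
  by apply: measurable_funMQp => //; exact: measurable_cst.
by apply/funext => t; rewrite mulN1r.
Qed.

End MeasurableArith.

End Haar.

(** * Fibrewise measure-preserving maps of product spaces *)

Section MeasurePreserving.
Context {R : realType}.
Local Open Scope ereal_scope.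

Definition preserves d (T : measurableType d) (nu : set T -> \bar R) (f : T -> T) :=
  forall A, measurable A -> nu (f @^-1` A) = nu A.

Section Products.
Context d1 d2 (T1 : measurableType d1) (T2 : measurableType d2).

Lemma preserves_fibr (nu1 : {measure set T1 -> \bar R})
    (nu2 : {sigma_finite_measure set T2 -> \bar R}) (tau : T1 -> T2 -> T2) :
  (forall s, preserves nu2 (tau s)) ->
  preserves (nu1 \x nu2) (fun q => (q.1, tau q.1 q.2)).
Proof.
move=> tauP A mA; apply: eq_integral => s _ /=.
rewrite -(tauP s (xsection A s)); last exact: measurable_xsection.
by congr (nu2 _); apply/seteqP; split => x /=; rewrite /xsection/= !inE.
Qed.

(** The product measure integrates sections over the first factor; when that factor moves,
    uniqueness of the product measure first exchanges the roles of the factors. Measurability of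
    [tau s], deduced from that of the whole map, is passed on so that the lemma can be iterated. *)
Lemma preserves_fibl (nu1 : {sigma_finite_measure set T1 -> \bar R})
    (nu2 : {sigma_finite_measure set T2 -> \bar R}) (tau : T2 -> T1 -> T1) :
  measurable_fun setT (fun q : T1 * T2 => (tau q.2 q.1, q.2)) ->
  (forall s, measurable_fun setT (tau s) -> preserves nu1 (tau s)) ->
  preserves (nu1 \x nu2) (fun q => (tau q.2 q.1, q.2)).
Proof.
move=> mtau tauP A mA.
have prodE B : measurable B -> (nu1 \x nu2) B = (nu1 \x^ nu2) B.
  by apply: product_measure_unique => //= *; rewrite product_measure2E.
rewrite !prodE//; last by rewrite -[X in measurable X]setTI; exact: mtau.
apply: eq_integral => s _ /=.
rewrite -(tauP s _ (ysection A s)); last exact: measurable_ysection.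
  by congr (nu1 _); apply/seteqP; split => x /=; rewrite /ysection/= !inE.
have := measurableT_comp measurable_fst (measurableT_comp mtau (pair2_measurable s)).
by apply.
Qed.

End Products.
Arguments preserves_fibr {d1 d2 T1 T2 nu1 nu2} tau.
Arguments preserves_fibl {d1 d2 T1 T2 nu1 nu2} tau.

Section SigmaFiniteProduct.
Context d1 d2 (T1 : measurableType d1) (T2 : measurableType d2).
Variables (m1 : {sigma_finite_measure set T1 -> \bar R})
  (m2 : {sigma_finite_measure set T2 -> \bar R}).

Lemma sigma_finite_product : sigma_finite setT (m1 \x m2).
Proof.
have [F FT Foo] := sigma_finiteT m1; have [G GT Goo] := sigma_finiteT m2.
exists (fun k => if unpickle k is Some (i, j) then F i `*` G j else set0).
  apply/seteqP; split => // -[x y] _.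
  have [i _ Fx] : (\bigcup_i F i) x by rewrite -FT.
  have [j _ Gy] : (\bigcup_i G i) y by rewrite -GT.
  by exists (pickle (i, j)) => //; rewrite pickleK.
move=> k; case: unpickle => [[i j]|]; last by rewrite measure0.
have [mF Fi] := Foo i; have [mG Gj] := Goo j.
by split; [exact: measurableX|rewrite product_measure1E// lte_mul_pinfty//
    ge0_fin_numE].
Qed.

(** Packing the product as a sigma-finite measure allows the fibre lemmas to be applied to iterated
    products. *)
Definition sf_product : {sigma_finite_measure set (T1 * T2)%type -> \bar R} :=
  HB.pack (m1 \x m2)
    (Measure_isSigmaFinite.Build _ _ _ (m1 \x m2) sigma_finite_product).

End SigmaFiniteProduct.

Record mpres d (T : measurableType d) (nu : set T -> \bar R) (f : T -> T) : Prop :=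
  MPres { mpres_measurable : measurable_fun setT f ; mpresP : preserves nu f }.

Lemma mpres_comp d (T : measurableType d) (nu : set T -> \bar R) (f g : T -> T) :
  mpres nu f -> mpres nu g -> mpres nu (f \o g).
Proof.
move=> [mf pf] [mg pg]; split; first exact: measurableT_comp.
move=> A mA; rewrite comp_preimage pg ?pf//.
by rewrite -[X in measurable X]setTI; exact: mf.
Qed.

End MeasurePreserving.

Lemma measure_fintype_bigcup {R : realType} d (T : measurableType d)
    (nu : {measure set T -> \bar R}) (I : finType) (D : I -> set T) :
  (forall i, measurable (D i)) -> trivIset setT D ->
  nu (\bigcup_i D i) = (\sum_i nu (D i))%E.
Proof.
move=> mD tD.
rewrite (measure_fin_bigcup nu finite_finset tD (fun i _ => mD i)).
rewrite [RHS]fsbig_seq ?index_enum_uniq//.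
by apply: eq_fsbigl; apply/seteqP; split => i //= _; rewrite mem_index_enum.
Qed.

(** * Measures of balls, uniqueness of Haar measure, and unit affine maps *)

Section HaarMeasure.
Context {R : realType} {p : nat} {K : padicField R p}.
Local Notation Qp := (Qp K).
Local Notation borelQp := (borelQp K).
Hypothesis p_prime : prime p.
Implicit Types (x y c : Qp) (r : R).

Let p_gt0 : (0 : R) < p%:R. Proof. by rewrite ltr0n prime_gt0. Qed.
Let p_gt1 : (1 : R) < p%:R. Proof. by rewrite ltr1n prime_gt1. Qed.
Let pz_gt0 (k : int) : (0 : R) < p%:R ^ k. Proof. exact: exprz_gt0. Qed.

Lemma measurable_affine (a b : Qp) :
  measurable_fun setT (fun x : borelQp => a * (x : Qp) + b : borelQp).
Proof.
apply: (measurable_funDQp p_prime); last exact: measurable_cst.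
by apply: (measurable_funMQp p_prime); first exact: measurable_cst.
Qed.

Section OneMeasure.
Variable nu : {measure set borelQp -> \bar R}.
Hypothesis nu_translate : forall b : Qp, preserves nu (fun x : borelQp =>
    (x : Qp) + b : borelQp).

Lemma haar_cball_center c (k : int) :
  nu (cball c (p%:R ^ k)) = nu (cball 0 (p%:R ^ k)).
Proof.
rewrite -[RHS](nu_translate (- c)); last exact: measurable_cball.
by congr (nu _); apply/seteqP; split => x; rewrite /cball/= subr0.
Qed.

(** A ball of radius p^(k+1) is the disjoint union of p translates of the ball of radius p^k, one
    for each residue. *)
Lemma haar_cballS (k : int) :
  nu (cball 0 (p%:R ^ (k + 1))) = (p%:R%:E * nu (cball 0%R (p%:R ^ k)%R))%E.
Proof.
(* Dividing by [pi], of absolute value p^(k+1), rescales the large ball to Z_p. *)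
pose pi : Qp := p%:R ^ (- (k + 1)).
have pi0 : pi != 0 by rewrite expfz_neq0// natp_neq0.
have abs_pi : absp pi = p%:R ^ (k + 1).
  by rewrite abspXz absp_p exprz_inv opprK.
pose D (a : 'F_p) : set Qp := cball (lift_Fp a * pi) (p%:R ^ k).
have scale (x : Qp) (a : 'F_p) : D a x <-> absp (x / pi - lift_Fp a) < 1.
  rewrite /D /cball/= (_ : x - lift_Fp a * pi = (x / pi - lift_Fp a) * pi);
      last by field.
  rewrite abspM abs_pi; split => [xa|/(absp_lt1_le p_prime) xa].
    rewrite -(ltr_pM2r (pz_gt0 (k + 1))) mul1r (le_lt_trans xa)//.
    by rewrite ltr_eXz2l// ltzD1.
  rewrite (le_trans (ler_wpM2r (ltW (pz_gt0 _)) xa))//.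
  by rewrite expfzDr ?gt_eqF// mulrC -mulrA -exprN1 -expfzDr ?gt_eqF// addrN mulr1.
have -> : cball 0 (p%:R ^ (k + 1)) = \bigcup_a D a.
  apply/seteqP; split=> [x|x [a _ /scale xa]]; rewrite /cball/= subr0.
    rewrite -abs_pi => xpi; exists (red (x / pi)) => //; apply/scale/(redP p_prime).
    by rewrite abspM abspV ler_pdivrMr ?mul1r// abs_pi.
  have xpi : absp (x / pi) <= 1.
    by rewrite -[x / pi](subrK (lift_Fp a)) abspD_le ?absp_lift_le1 ?ltW.
  by rewrite -[X in absp X <= _](divfK pi0) abspM abs_pi ler_piMl// ltW.
rewrite measure_fintype_bigcup; last 2 first.
- by move=> a; exact: measurable_cball.
- move=> a b _ _ [x [/scale xa /scale xb]]; apply: (lift_inj p_prime (K := K)).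
  rewrite (_ : _ - _ = (x / pi - lift_Fp b) - (x / pi - lift_Fp a)); last by ring.
  exact: abspB_lt.
under eq_bigr do rewrite haar_cball_center.
by rewrite sumr_const card_Fp// mule_natl.
Qed.

Hypothesis nu_Zp : nu (cball 0 1) = 1%E.

Lemma haar_cball c (k : int) : nu (cball c (p%:R ^ k)) = (p%:R ^ k)%:E.
Proof.
rewrite haar_cball_center; case: k => n.
  elim: n => [|n IH]; first by rewrite expr0z nu_Zp.
  by rewrite -addn1 PoszD haar_cballS IH -EFinM expfzDr ?gt_eqF// mulrC.
rewrite NegzE; elim: n.+1 => {n} [|n IH]; first by rewrite oppr0 expr0z nu_Zp.
have e : - n.+1%:Z + 1 = - n%:Z by rewrite -addn1 PoszD; ring.
have := haar_cballS (- n.+1%:Z); rewrite e IH => /(congr1 (fun z =>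
    (p%:R^-1)%:E * z)%E).
rewrite muleA -!EFinM mulVf ?gt_eqF// mul1e => <-; congr (_%:E).
by rewrite -exprN1 -expfzDr ?gt_eqF//; congr (_ ^ _); rewrite -e; ring.
Qed.

End OneMeasure.

(** Both measures agree on balls. These, with the empty set, form a pi-system, since ultrametric
    balls are nested or disjoint, and they generate the Borel sets by the countable base. *)
Lemma haar_unique (m1 m2 : {measure set borelQp -> \bar R}) :
  (forall b : Qp, preserves m1 (fun x : borelQp => (x : Qp) + b : borelQp)) ->
  (forall b : Qp, preserves m2 (fun x : borelQp => (x : Qp) + b : borelQp)) ->
  m1 (cball 0 1) = 1%E -> m2 (cball 0 1) = 1%E ->
  forall A, measurable A -> m1 A = m2 A.
Proof.
move=> t1 t2 m11 m21.
pose G : set (set borelQp) := [set A | A = set0 \/ exists c n, A = cball c (p%:R ^- n)].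
(* Unit balls with rational centres exhaust Q_p; indices that encode no rational fall back on the
   centre 0. *)
pose g (k : nat) : set borelQp :=
  cball (ratr (odflt 0 (unpickle k))) (p%:R ^- 0).
have g_cover : \bigcup_k g k = setT.
  apply/seteqP; split=> // x _; have [q xq] := ratr_approx x (@ltr01 R).
  exists (pickle q) => //; rewrite /g pickleK /cball/= expr0 invr1; exact: ltW.
apply: (measure_unique G g) => //.
- apply/seteqP; split; last first.
    apply: smallest_sub; first exact: sigma_algebra_measurable.
    move=> A [->|[c [n ->]]]; first exact: measurable0.
    by apply: measurable_cball => //; rewrite invr_gt0 exprn_gt0.
  apply: smallest_sub; first exact: smallest_sigma_algebra.
  move=> U oU; rewrite (open_rballs p_prime oU).
  have sG := smallest_sigma_algebra setT G.
  rewrite bigcup_mkcond.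
  have := @bigcup_countable_measurable _ (g_sigma_algebraType G) (rat * nat)%type
    [set i | rball i `<=` U] (fun i => rball i).
  rewrite bigcup_mkcond; apply=> i _.
  by apply: sub_sigma_algebra; right; exists (ratr i.1), i.2.
- move=> A B [->|[c [n ->]]]; first by rewrite set0I; left.
  move=> [->|[c' [n' ->]]]; first by rewrite setI0; left.
  wlog nn' : c c' n n' / (n <= n')%N => [H|].
    by have [/H|/ltnW/H] := leqP n n' => // /(_ c' c); rewrite setIC.
  have le_r : (p%:R ^- n' : R) <= p%:R ^- n.
    by rewrite lef_pV2 ?posrE ?exprn_gt0// ler_weXn2l ?ltW.
  have [[x [xc xc']]|E0] := pselect (cball c (p%:R ^- n) `&` cball c' (p%:R ^- n')
      !=set0).
    right; exists c', n'; apply/seteqP; split => [y []//|y yc']; split => //.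
    rewrite (cball_eq xc) (@cball_eq _ _ _ x c') 1?abspBC; last exact: le_trans le_r.
    exact: le_trans le_r.
  by left; apply/eqP/negPn/negP => /set0P.
- by move=> k; right; exists (ratr (odflt 0 (unpickle k))), 0.
- move=> A [->|[c [n ->]]]; first by rewrite (measure0 m1) (measure0 m2).
  by rewrite exprnN (haar_cball t1)// (haar_cball t2).
- by move=> k; rewrite /g exprnN (haar_cball t1)// ltry.
Qed.

Variable mu : {sigma_finite_measure set borelQp -> \bar R}.
Hypothesis mu_haar : normalized_haar mu.

Lemma haar_translate (b : Qp) : preserves mu (fun x : borelQp =>
    (x : Qp) + b : borelQp).
Proof.
move=> A mA; rewrite -(mu_haar.1 (- b) A mA); congr (mu _).
apply/seteqP; split => [x /= Axb|_ [a Aa <-]]; last by rewrite /= addrAC addNr add0r.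
by exists (x + b) => //; rewrite addrC addrK.
Qed.

Lemma haar_Zp : mu (cball 0 1) = 1%E.
Proof.
rewrite -mu_haar.2; congr (mu _).
by apply/seteqP; split => x; rewrite /cball/= subr0.
Qed.

(** The pushforward is again invariant, translation by c pulling back to translation by c/a, and
    again gives Z_p measure 1, so uniqueness applies. *)
Lemma haar_affine (a b : Qp) : absp a = 1 ->
  preserves mu (fun x : borelQp => a * (x : Qp) + b : borelQp).
Proof.
move=> a1; have a0 : a != 0 by rewrite -absp_gt0 a1.
have ma := measurable_affine a b.
suff E : forall A, measurable A -> pushforward mu (fun x : borelQp =>
    a * (x : Qp) + b : borelQp) A = mu A.
  by move=> A mA; exact: E.
apply: haar_unique.
- move=> c A mA; rewrite /pushforward -[RHS](haar_translate (c / a)).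
    have e (x : Qp) : a * (x + c / a) + b = a * x + b + c by field.
    by congr (mu _); apply/seteqP; split => x /=; rewrite e.
  by rewrite -[X in measurable X]setTI; exact: ma.
- exact: haar_translate.
- rewrite /pushforward -[RHS]haar_Zp -(haar_cball_center (haar_translate) (- b / a)
    0) expr0z.
  congr (mu _); apply/seteqP; split => x; rewrite /cball/= subr0;
  by rewrite (_ : a * (x : Qp) + b = a * (x - (- b / a))) ?abspM ?a1 ?mul1r//; field.
- exact: haar_Zp.
Qed.

End HaarMeasure.

(** * Shears of Q_p^5 *)

Section CoordinateMaps.
Context {R : realType} {p : nat} {K : padicField R p}.
Local Notation Qp := (Qp K).
Local Notation borelQp := (borelQp K).
Local Notation borelQp5 := (borelQp * borelQp * borelQp * borelQp * borelQp)%type.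
Hypothesis p_prime : prime p.
Variable mu : {sigma_finite_measure set borelQp -> \bar R}.
Hypothesis mu_haar : normalized_haar mu.
Implicit Types (a : Qp) (phi : Qp -> Qp -> Qp -> Qp -> Qp).

Lemma measurable_tuple5 d (S : measurableType d) (f1 f2 f3 f4 f5 : S -> borelQp) :
  measurable_fun setT f1 -> measurable_fun setT f2 -> measurable_fun setT f3 ->
  measurable_fun setT f4 -> measurable_fun setT f5 ->
  measurable_fun setT (fun t => (f1 t, f2 t, f3 t, f4 t, f5 t)).
Proof. by move=> *; do 4 apply: measurable_fun_pair => //. Qed.

Lemma measurable_coord1 : measurable_fun setT (fun t : borelQp5 => t.1.1.1.1).
Proof. by do 3 (apply: measurableT_comp measurable_fst _); exact: measurable_fst. Qed.

Lemma measurable_coord2 : measurable_fun setT (fun t : borelQp5 => t.1.1.1.2).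
Proof.
apply: measurableT_comp measurable_snd _.
by do 2 (apply: measurableT_comp measurable_fst _); exact: measurable_fst.
Qed.

Lemma measurable_coord3 : measurable_fun setT (fun t : borelQp5 => t.1.1.2).
Proof.
apply: measurableT_comp measurable_snd _.
by apply: measurableT_comp measurable_fst _; exact: measurable_fst.
Qed.

Lemma measurable_coord4 : measurable_fun setT (fun t : borelQp5 => t.1.2).
Proof. apply: measurableT_comp measurable_snd _; exact: measurable_fst. Qed.

Lemma measurable_coord5 : measurable_fun setT (fun t : borelQp5 => t.2).
Proof. exact: measurable_snd. Qed.

Local Notation borelQp4 := (borelQp * borelQp * borelQp * borelQp)%type.
Local Notation borelQp3 := (borelQp * borelQp * borelQp)%type.
Local Notation borelQp2 := (borelQp * borelQp)%type.

Let mu2 : {sigma_finite_measure set borelQp2 -> \bar R} := sf_product mu mu.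
Let mu3 : {sigma_finite_measure set borelQp3 -> \bar R} := sf_product mu2 mu.
Let mu4 : {sigma_finite_measure set borelQp4 -> \bar R} := sf_product mu3 mu.

(** A shear scales one coordinate and shifts it by a function of the other four; it preserves
    measure when the scale is a unit. All changes of variables below are composites of shears. *)
Definition move1 a phi (t : borelQp5) : borelQp5 :=
  (a * t.1.1.1.1 + phi t.1.1.1.2 t.1.1.2 t.1.2 t.2 : Qp,
   t.1.1.1.2, t.1.1.2, t.1.2, t.2).
Definition move2 a phi (t : borelQp5) : borelQp5 :=
  (t.1.1.1.1, a * t.1.1.1.2 + phi t.1.1.1.1 t.1.1.2 t.1.2 t.2 : Qp,
   t.1.1.2, t.1.2, t.2).
Definition move3 a phi (t : borelQp5) : borelQp5 :=
  (t.1.1.1, a * t.1.1.2 + phi t.1.1.1.1 t.1.1.1.2 t.1.2 t.2 : Qp, t.1.2, t.2).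
Definition move4 a phi (t : borelQp5) : borelQp5 :=
  (t.1.1, a * t.1.2 + phi t.1.1.1.1 t.1.1.1.2 t.1.1.2 t.2 : Qp, t.2).
Definition move5 a phi (t : borelQp5) : borelQp5 :=
  (t.1, a * t.2 + phi t.1.1.1.1 t.1.1.1.2 t.1.1.2 t.1.2 : Qp).

Section OneCoordinate.
Variables (a : Qp) (phi : Qp -> Qp -> Qp -> Qp -> Qp).
Hypothesis a1 : absp a = 1.
Hypothesis mphi : forall f1 f2 f3 f4 : borelQp5 -> borelQp,
  measurable_fun setT f1 -> measurable_fun setT f2 -> measurable_fun setT f3 ->
  measurable_fun setT f4 ->
  measurable_fun setT (fun t => phi (f1 t) (f2 t) (f3 t) (f4 t) : borelQp).

Let affine (f g : borelQp5 -> borelQp) : measurable_fun setT f ->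
  measurable_fun setT g ->
  measurable_fun setT (fun t => a * (f t : Qp) + g t : borelQp).
Proof.
move=> mf mg; apply: (measurable_funDQp p_prime) => //.
by apply: (measurable_funMQp p_prime) => //; exact: measurable_cst.
Qed.

Local Notation m1 := measurable_coord1.
Local Notation m2 := measurable_coord2.
Local Notation m3 := measurable_coord3.
Local Notation m4 := measurable_coord4.
Local Notation m5 := measurable_coord5.

(** Freezing v, u, z and y in turn leaves an affine map of the line. For the other coordinates,
    [preserves_fibr] takes over once the moving coordinate is the last one left. *)
Lemma mpres_move1 : mpres (haar5 mu) (move1 a phi).
Proof.
have mT := measurable_tuple5 (affine m1 (mphi m2 m3 m4 m5)) m2 m3 m4 m5.
split; first exact: mT.
apply: (@preserves_fibl R _ _ _ _ mu4 mu (fun (v : borelQp) (q : borelQp4) =>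
    (a * q.1.1.1 + phi q.1.1.2 q.1.2 q.2 v : Qp,
   q.1.1.2, q.1.2, q.2))) => // v mT1.
apply: (@preserves_fibl R _ _ _ _ mu3 mu (fun (u : borelQp) (q : borelQp3) =>
    (a * q.1.1 + phi q.1.2 q.2 u v : Qp,
   q.1.2, q.2))) => // u mT2.
apply: (@preserves_fibl R _ _ _ _ mu2 mu (fun (z : borelQp) (q : borelQp2) =>
    (a * q.1 + phi q.2 z u v : Qp, q.2))) => // z mT3.
apply: (@preserves_fibl R _ _ _ _ mu mu (fun y x : borelQp =>
    (a * x + phi y z u v : Qp))) => // y _.
exact: haar_affine.
Qed.

Lemma mpres_move2 : mpres (haar5 mu) (move2 a phi).
Proof.
have mT := measurable_tuple5 m1 (affine m2 (mphi m1 m3 m4 m5)) m3 m4 m5.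
split; first exact: mT.
apply: (@preserves_fibl R _ _ _ _ mu4 mu (fun (v : borelQp) (q : borelQp4) =>
    (q.1.1.1, a * q.1.1.2 + phi q.1.1.1 q.1.2 q.2 v : Qp,
   q.1.2, q.2))) => // v mT1.
apply: (@preserves_fibl R _ _ _ _ mu3 mu (fun (u : borelQp) (q : borelQp3) =>
    (q.1.1, a * q.1.2 + phi q.1.1 q.2 u v : Qp,
   q.2))) => // u mT2.
apply: (@preserves_fibl R _ _ _ _ mu2 mu (fun (z : borelQp) (q : borelQp2) => (q.1,
    a * q.2 + phi q.1 z u v : Qp))) => // z mT3.
apply: (@preserves_fibr R _ _ _ _ mu mu (fun x y : borelQp =>
    (a * y + phi x z u v : Qp))) => y.
exact: haar_affine.
Qed.

Lemma mpres_move3 : mpres (haar5 mu) (move3 a phi).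
Proof.
have m12 : measurable_fun setT (fun t : borelQp5 => t.1.1.1).
  by do 2 (apply: measurableT_comp measurable_fst _); exact: measurable_fst.
have mT := measurable_fun_pair (measurable_fun_pair (measurable_fun_pair m12
  (affine m3 (mphi m1 m2 m4 m5))) m4) m5.
split; first exact: mT.
apply: (@preserves_fibl R _ _ _ _ mu4 mu (fun (v : borelQp) (q : borelQp4) =>
  (q.1.1, a * q.1.2 + phi q.1.1.1 q.1.1.2 q.2 v : Qp, q.2))) => // v mT1.
apply: (@preserves_fibl R _ _ _ _ mu3 mu (fun (u : borelQp) (q : borelQp3) =>
  (q.1, a * q.2 + phi q.1.1 q.1.2 u v : Qp))) => // u mT2.
apply: (@preserves_fibr R _ _ _ _ mu2 mu (fun (q : borelQp2) (z : borelQp) =>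
  (a * z + phi q.1 q.2 u v : Qp))) => q.
exact: haar_affine.
Qed.

Lemma mpres_move4 : mpres (haar5 mu) (move4 a phi).
Proof.
have m123 : measurable_fun setT (fun t : borelQp5 => t.1.1).
  by apply: measurableT_comp measurable_fst _; exact: measurable_fst.
have mT := measurable_fun_pair (measurable_fun_pair m123
  (affine m4 (mphi m1 m2 m3 m5))) m5.
split; first exact: mT.
apply: (@preserves_fibl R _ _ _ _ mu4 mu (fun (v : borelQp) (q : borelQp4) =>
  (q.1, a * q.2 + phi q.1.1.1 q.1.1.2 q.1.2 v : Qp))) => // v mT1.
apply: (@preserves_fibr R _ _ _ _ mu3 mu (fun (q : borelQp3) (u : borelQp) =>
  (a * u + phi q.1.1 q.1.2 q.2 v : Qp))) => q.
exact: haar_affine.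
Qed.

Lemma mpres_move5 : mpres (haar5 mu) (move5 a phi).
Proof.
have mT := measurable_fun_pair measurable_fst (affine m5 (mphi m1 m2 m3 m4)).
split; first exact: mT.
apply: (@preserves_fibr R _ _ _ _ mu4 mu (fun (q : borelQp4) (v : borelQp) =>
  (a * v + phi q.1.1.1 q.1.1.2 q.1.2 q.2 : Qp))) => q.
exact: haar_affine.
Qed.

End OneCoordinate.

Lemma haar5_box (A1 A2 A3 A4 A5 : set borelQp) :
  measurable A1 -> measurable A2 -> measurable A3 -> measurable A4 -> measurable A5 ->
  haar5 mu (A1 `*` A2 `*` A3 `*` A4 `*` A5) = (mu A1 * mu A2 * mu A3 * mu A4 * mu A5)%E.
Proof.
move=> mA1 mA2 mA3 mA4 mA5.
have m12 := measurableX mA1 mA2; have m123 := measurableX m12 mA3.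
have m1234 := measurableX m123 mA4.
apply: (etrans (@product_measure1E _ _ _ _ R mu4 mu _ _ m1234 mA5)).
congr (_ * _)%E; apply: (etrans (@product_measure1E _ _ _ _ R mu3 mu _ _ m123 mA4)).
congr (_ * _)%E; apply: (etrans (@product_measure1E _ _ _ _ R mu2 mu _ _ m12 mA3)).
by congr (_ * _)%E; exact: (@product_measure1E _ _ _ _ R mu mu _ _ mA1 mA2).
Qed.

End CoordinateMaps.

(** * Complex-valued integrals *)

Section ComplexIntegral.
Context {R : realType} d (T : measurableType d) (nu : {measure set T -> \bar R}).
Implicit Types (D : set T) (F : T -> R[i]) (c : R[i]).
Local Notation Re := complex.Re.
Local Notation Im := complex.Im.

Definition cint D F : R[i] :=
  (\int[nu]_(x in D) Re (F x)) +i* (\int[nu]_(x in D) Im (F x)).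

Definition cintegrable D F :=
  nu.-integrable D (EFin \o (fun x => Re (F x))) /\
  nu.-integrable D (EFin \o (fun x => Im (F x))).

Lemma cintegralE F : cintegral nu F = cint setT F.
Proof. by []. Qed.

Lemma abs_convergent_cintegrable F : abs_convergent nu F -> cintegrable setT F.
Proof.
move=> [mRe mIm Foo]; split; apply/integrableP; split.
- exact/measurable_EFinP.
- apply: le_lt_trans Foo; apply: ge0_le_integral => //.
  + by apply: measurableT_comp => //; exact/measurable_EFinP.
  + apply/measurable_EFinP; rewrite (_ : (fun _ => _) =
      (fun x => Num.sqrt (Re (F x) ^+ 2 + Im (F x) ^+ 2))); last first.
      by apply/funext => x; case: (F x).
    apply: (measurableT_comp (continuous_measurable_fun (@sqrt_continuous R))).
    by apply: measurable_funD; exact: measurable_funX.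
  + move=> x _; rewrite lee_fin; case: (F x) => a b /=.
    by rewrite -sqrtr_sqr ler_wsqrtr// lerDl sqr_ge0.
- exact/measurable_EFinP.
- apply: le_lt_trans Foo; apply: ge0_le_integral => //.
  + by apply: measurableT_comp => //; exact/measurable_EFinP.
  + apply/measurable_EFinP; rewrite (_ : (fun _ => _) =
      (fun x => Num.sqrt (Re (F x) ^+ 2 + Im (F x) ^+ 2))); last first.
      by apply/funext => x; case: (F x).
    apply: (measurableT_comp (continuous_measurable_fun (@sqrt_continuous R))).
    by apply: measurable_funD; exact: measurable_funX.
  + move=> x _; rewrite lee_fin; case: (F x) => a b /=.
    by rewrite -sqrtr_sqr ler_wsqrtr// lerDr sqr_ge0.
Qed.

Lemma cintegrableS D D' F : measurable D -> measurable D' -> D' `<=` D ->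
  cintegrable D F -> cintegrable D' F.
Proof. by move=> mD mD' D'D [iRe iIm]; split; exact: integrableS D'D _. Qed.

Lemma eq_cint D F G : (forall x, D x -> F x = G x) -> cint D F = cint D G.
Proof.
by move=> FG; congr (_ +i* _); apply: eq_Rintegral => x /set_mem/FG ->.
Qed.

Lemma cint_cst D c : measurable D -> cint D (fun=> c) = c * (fine (nu D))%:C.
Proof.
move=> mD; rewrite /cint !Rintegral_cst//; case: c => a b.
by apply/eqP; rewrite eq_complex /= !mulr0 subr0 add0r !eqxx.
Qed.

Lemma cintZ D c F : measurable D -> cintegrable D F ->
  cint D (fun x => c * F x) = c * cint D F.
Proof.
move=> mD [iRe iIm]; rewrite /cint; case: c => a b.
have -> : \int[nu]_(x in D) Re ((a +i* b) * F x) =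
    \int[nu]_(x in D) (a * Re (F x) - b * Im (F x)).
  by apply: eq_Rintegral => x _; case: (F x).
have -> : \int[nu]_(x in D) Im ((a +i* b) * F x) =
    \int[nu]_(x in D) (a * Im (F x) + b * Re (F x)).
  by apply: eq_Rintegral => x _; case: (F x).
have iZ r f : nu.-integrable D (EFin \o f) -> nu.-integrable D (EFin \o (fun x =>
    r * f x)).
  by move=> ?; rewrite (_ : _ \o _ = (fun x => r%:E * (EFin \o f) x)%E)//;
      exact: integrableZl.
rewrite RintegralB ?RintegralD ?RintegralZl//; try exact: iZ.
Qed.

Lemma cint_fintype_bigcup (I : finType) (D : I -> set T) F :
  (forall i, measurable (D i)) -> trivIset setT D ->
  cintegrable (\bigcup_i D i) F ->
  cint (\bigcup_i D i) F = \sum_i cint (D i) F.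
Proof.
move=> mD tD [iRe iIm].
have mU : measurable (\bigcup_i D i) by apply: fin_bigcup_measurable;
    first exact: finite_finset.
have H f : nu.-integrable (\bigcup_i D i) (EFin \o f) ->
    \int[nu]_(x in \bigcup_i D i) f x = \sum_i \int[nu]_(x in D i) f x.
  move=> fi; have DE : \bigcup_i D i = \big[setU/set0]_(i <- index_enum I) D i.
    by rewrite -bigcup_seq; apply: eq_bigcupl; split=> i //= _; rewrite mem_index_enum.
  have fin i : (\int[nu]_(x in D i) (f x)%:E)%E \is a fin_num.
    apply: integrable_fin_num => //; apply: integrableS fi => //.
    exact: bigcup_sup.
  rewrite /Rintegral DE integral_bigsetU_EFin//.
  - by rewrite sum_fine// => i _; exact: fin.
  - exact: index_enum_uniq.
  - exact: sub_trivIset tD.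
  - by rewrite -DE; exact: measurable_int fi.
rewrite /cint !H//; apply/eqP; rewrite eq_complex !raddf_sum/=.
by apply/andP; split; apply/eqP; apply: eq_bigr.
Qed.

Lemma cint_bigcup0 (D : nat -> set T) F :
  (forall i, measurable (D i)) -> trivIset setT D ->
  cintegrable (\bigcup_i D i) F -> (forall i, cint (D i) F = 0) ->
  cint (\bigcup_i D i) F = 0.
Proof.
move=> mD tD [iRe iIm] D0.
have mU : measurable (\bigcup_i D i) by exact: bigcup_measurable.
have DU i : D i `<=` \bigcup_i D i by exact: bigcup_sup.
have H f : nu.-integrable (\bigcup_i D i) (EFin \o f) ->
    (forall i, \int[nu]_(x in D i) f x = 0) -> \int[nu]_(x in \bigcup_i D i) f x = 0.
  move=> fi f0; rewrite /Rintegral integral_bigcup// eseries0// => i _ _.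
  have fin := integrable_fin_num (mD i) (integrableS mU (mD i) (DU i) fi).
  by rewrite -[LHS]fineK// [X in X%:E](f0 i).
rewrite /cint !H// => i; have := D0 i; rewrite /cint => -[] //.
Qed.

Lemma cintU D D' F : measurable D -> measurable D' -> [disjoint D & D'] ->
  cintegrable (D `|` D') F -> cint (D `|` D') F = cint D F + cint D' F.
Proof.
by move=> mD mD' DD' [iRe iIm]; rewrite /cint !Rintegral_setU.
Qed.

Let integrable_comp (f : T -> T) (h : T -> R) : mpres nu f ->
  nu.-integrable setT (EFin \o h) -> nu.-integrable setT ((EFin \o h) \o f).
Proof.
move=> [mf pf] ih; have mh := measurable_int _ ih.
have E g : (\int[pushforward nu f]_x g x = \int[nu]_x g x)%E.
  by apply: eq_measure_integral => A mA _; exact: pf.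
apply/integrableP; split; first exact: measurableT_comp.
have /integrableP[_] := ih; rewrite -E ge0_integral_pushforward//.
by apply: measurableT_comp => //; exact: measurable_funTS.
Qed.

Lemma cintegrable_mpres (f : T -> T) F : mpres nu f -> cintegrable setT F ->
  cintegrable setT (F \o f).
Proof.
by move=> pf [iRe iIm]; split; [exact: (integrable_comp (h := fun x => Re (F x)) pf iRe)
  |exact: (integrable_comp (h := fun x => Im (F x)) pf iIm)].
Qed.

Lemma cint_mpres (f : T -> T) D F : mpres nu f -> measurable D ->
  cintegrable setT F -> cint (f @^-1` D) (F \o f) = cint D F.
Proof.
move=> mpf mD [iRe iIm]; have [mf pf] := mpf.
have H (h : T -> R) : nu.-integrable setT (EFin \o h) ->
    \int[nu]_(x in f @^-1` D) h (f x) = \int[nu]_(x in D) h x.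
  move=> ih; have mh := measurable_int _ ih; congr fine.
  have E D' g : (\int[pushforward nu f]_(x in D') g x = \int[nu]_(x in D') g x)%E.
    by apply: eq_measure_integral => A mA _; exact: pf.
  rewrite -[RHS]E integral_pushforward//.
  apply: integrableS (integrable_comp mpf ih) => //.
  by rewrite -[X in measurable X]setTI; exact: mf.
by congr (_ +i* _); [exact: (H (fun x => Re (F x))) | exact: (H (fun x => Im (F x)))].
Qed.

(** The change of variables f turns the integral into c times itself. *)
Lemma cint_twist (f : T -> T) D F c : mpres nu f -> measurable D ->
  cintegrable setT F -> (forall x, D (f x) <-> D x) ->
  (forall x, D x -> F (f x) = c * F x) -> c != 1 -> cint D F = 0.
Proof.
move=> pf mD iF Df Ff c1.
have DE : f @^-1` D = D by apply/seteqP; split => x /Df.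
have : cint D F = c * cint D F.
  rewrite -{1}(cint_mpres pf mD iF) DE -cintZ//; first exact: eq_cint.
  exact: cintegrableS iF.
move/eqP; rewrite -subr_eq0 -{1}[cint D F]mul1r -mulrBl mulf_eq0 subr_eq0 eq_sym.
by rewrite (negbTE c1) => /eqP.
Qed.

End ComplexIntegral.

(** * Heights in the unipotent radical *)

Section HeisenbergHeight.
Context {R : realType} {p : nat} {K : padicField R p}.
Local Notation Qp := (Qp K).
Hypothesis p_prime : prime p.
Hypothesis p_gt3 : (3 < p)%N.
Implicit Types (X y u v zeta t : Qp).

Let p_gt0 : (0 : R) < p%:R. Proof. by rewrite ltr0n prime_gt0. Qed.
Let p_gt1 : (1 : R) < p%:R. Proof. by rewrite ltr1n prime_gt1. Qed.

Lemma absp_small n : (0 < n < p)%N -> absp (n%:R : Qp) = 1.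
Proof. by move=> /andP[n0 np]; rewrite absp_coprime// gtnNdvd. Qed.

Lemma absp2 : absp (2 : Qp) = 1.
Proof. by rewrite absp_small// (ltn_trans _ p_gt3). Qed.

Lemma absp3 : absp (3 : Qp) = 1.
Proof. by rewrite absp_small. Qed.

Lemma two_neq0 : 2 != 0 :> Qp.
Proof. by rewrite -absp_gt0 absp2. Qed.

Definition hs0 X y u v : Qp := X * u - y ^+ 2.
Definition hs1 X y u v : Qp := X * v - u * y.
Definition hs2 X y u v : Qp := y * v - u ^+ 2.
(** The minor of the last two columns of [heis]: a quarter of the Hessian discriminant, minus
    zeta^2. *)
Definition quartic X y u v zeta : Qp :=
  (hs1 X y u v ^+ 2 - 4 * hs0 X y u v * hs2 X y u v) / 4 - zeta ^+ 2.

(** The shape of the first two rows of an element of N, with the last 2 x 2 block left free so that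
    minors can be bounded without expanding it. *)
Definition plucker X y u v (a b c d : Qp) : 'M[Qp]_(2, 8) := rows_mx 2 8
  [:: [:: 1; 0; - u; - y; - y; X; a; b]; [:: 0; 1; v; u; u; - y; c; d]].

(* zeta is the symmetric coordinate on the centre of N, for which GL_2 acts on
   N by Sym^3 twisted by det^-1 on (X, y, u, v) and by det on zeta. *)
Definition heis X y u v zeta : 'M[Qp]_(2, 8) := plucker X y u v
  (- zeta - hs1 X y u v / 2) (hs0 X y u v) (hs2 X y u v) (zeta - hs1 X y u v / 2).

Ltac heis_eq :=
  rewrite /heis /plucker /hs0 /hs1 /hs2 /first_rows /mx2; rows_eq; try ring.

(** Half the cocycle evaluated at (w, w) separates z from zeta; in [heis_n] the cocycle has become
    alternating. *)
Lemma heisE X y u v zeta :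
  first_rows *m n_mx (- X) y (zeta + (3 * u * y - v * X) / 2) u v =
  heis X y u v zeta.
Proof. by heis_eq; field; rewrite two_neq0. Qed.

Lemma heis_xa t X y u v zeta : heis X y u v zeta *m xa t = mx2 1 t 0 1 *m
  heis (X + 3 * t * y + 3 * t ^+ 2 * u + t ^+ 3 * v)
    (y + 2 * t * u + t ^+ 2 * v) (u + t * v) v zeta.
Proof. by rewrite xaE; heis_eq; field; rewrite two_neq0. Qed.

Lemma heis_ya t X y u v zeta : heis X y u v zeta *m ya t = mx2 1 0 t 1 *m
  heis X (y + t * X) (u + 2 * t * y + t ^+ 2 * X)
    (v + 3 * t * u + 3 * t ^+ 2 * y + t ^+ 3 * X) zeta.
Proof. by rewrite yaE; heis_eq; field; rewrite two_neq0. Qed.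

Lemma heis_torus (a d : Qp) X y u v zeta : a != 0 -> d != 0 ->
  heis X y u v zeta *m torus a d = mx2 a 0 0 d *m
  heis (d / a ^+ 2 * X) (y / a) (u / d) (a / d ^+ 2 * v) (zeta / (a * d)).
Proof.
by move=> a0 d0; rewrite torusE//; heis_eq; field; rewrite ?two_neq0 ?a0 ?d0.
Qed.

Lemma heis_n X y u v zeta X' y' u' v' :
  heis X y u v zeta *m n_mx (- X') y' ((3 * u' * y' - v' * X') / 2) u' v' =
  heis (X + X') (y + y') (u + u') (v + v')
    (zeta + (3 * (u * y' - y * u') - (v * X' - X * v')) / 2).
Proof. by heis_eq; field; rewrite two_neq0. Qed.

Definition heis_height X y u v zeta := height (heis X y u v zeta).

(** Right multiplication by an integral matrix with integral inverse keeps the height, and the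
    compensating left factor has determinant 1. *)
Lemma heis_height_xa t X y u v zeta : absp t <= 1 -> heis_height
  (X + 3 * t * y + 3 * t ^+ 2 * u + t ^+ 3 * v)
    (y + 2 * t * u + t ^+ 2 * v) (u + t * v) v zeta = heis_height X y u v zeta.
Proof.
move=> t1; rewrite /heis_height; have := height_mulr (heis X y u v zeta)
    (integral_xa t1)
  (integral_xa (zpN t1)); rewrite xaM subrr xa0 => /(_ erefl) <-.
by rewrite heis_xa height_mull det_mx2 mulr0 subr0 mulr1 absp1 mul1r.
Qed.

Lemma heis_height_ya t X y u v zeta : absp t <= 1 -> heis_height X (y + t * X)
    (u + 2 * t * y + t ^+ 2 * X)
    (v + 3 * t * u + 3 * t ^+ 2 * y + t ^+ 3 * X) zeta = heis_height X y u v zeta.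
Proof.
move=> t1; rewrite /heis_height; have := height_mulr (heis X y u v zeta)
    (integral_ya t1)
  (integral_ya (zpN t1)); rewrite yaM subrr ya0 => /(_ erefl) <-.
by rewrite heis_ya height_mull det_mx2 mul0r subr0 mulr1 absp1 mul1r.
Qed.

Lemma integral_torus (a d : Qp) : absp a = 1 -> absp d = 1 -> integral_mx (torus a d).
Proof.
move=> a1 d1; rewrite torusE -?absp_gt0 ?a1 ?d1//; apply: integral_rows_mx.
by rewrite /= !abspM !abspV a1 d1 invr1 mulr1 absp0 absp1; do !split; rewrite ?ler01.
Qed.

Lemma heis_height_torus (a d : Qp) X y u v zeta : absp a = 1 -> absp d = 1 ->
  heis_height (d / a ^+ 2 * X) (y / a) (u / d) (a / d ^+ 2 * v) (zeta / (a * d)) =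
  heis_height X y u v zeta.
Proof.
move=> a1 d1; have a0 : a != 0 by rewrite -absp_gt0 a1.
have d0 : d != 0 by rewrite -absp_gt0 d1.
have aV : absp a^-1 = 1 by rewrite abspV a1 invr1.
have dV : absp d^-1 = 1 by rewrite abspV d1 invr1.
rewrite /heis_height; have := height_mulr (heis X y u v zeta) (integral_torus a1
    d1) (integral_torus aV dV).
rewrite /torus m_mxM ?unit_torus ?invr_eq0// mx2M !(mulr0, mul0r, addr0, add0r).
rewrite !divff// -/(xa 0) xa0 => /(_ erefl) <-.
by rewrite heis_torus// height_mull det_mx2 mulr0 subr0 abspM a1 d1 !mul1r.
Qed.

Lemma heis_height_n X y u v zeta X' y' u' v' : absp X' <= 1 -> absp y' <= 1 ->
  absp u' <= 1 -> absp v' <= 1 -> heis_height (X + X') (y + y') (u + u') (v + v')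
    (zeta + (3 * (u * y' - y * u') - (v * X' - X * v')) / 2) = heis_height X y u v zeta.
Proof.
move=> X1 y1 u1 v1; rewrite /heis_height -heis_n.
have half : absp (2^-1 : Qp) <= 1 by rewrite abspV absp2 invr1.
set z' := _ / 2.
apply: (@height_mulr _ _ _ _ _ _ (n_mx X' (- y') (- z' + v' * - X' + 3 * u' * y')
    (- u') (- v'))).
- by apply: integral_n; rewrite /z'; zp.
- by apply: integral_n; rewrite /z'; zp.
- by rewrite n_mxM -n_mx0; congr n_mx; ring.
Qed.

Section Bounds.
Variables (X y u v a b c d : Qp) (rho M r : R).
Hypotheses (r1 : 1 <= r) (rho_r : rho <= r) (M_r : M <= r) (rhoM_r : rho * M <= r).
Hypotheses (Xrho : absp X <= rho) (yrho : absp y <= rho) (urho : absp u <= rho)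
  (vrho : absp v <= rho).
Hypotheses (h0M : absp (hs0 X y u v) <= M) (h1M : absp (hs1 X y u v) <= M)
  (h2M : absp (hs2 X y u v) <= M).
Hypotheses (aM : absp a <= M) (bM : absp b <= M) (cM : absp c <= M) (dM : absp d <= M).
Hypothesis det_r : absp (a * d - b * c) <= r.

Let r0 : 0 <= r. Proof. exact: le_trans r1. Qed.

Let prod1 (e f g k : Qp) : absp e <= rho -> absp f <= M -> absp g <= M ->
    absp k <= rho ->
  absp (e * f - g * k) <= r.
Proof.
move=> er fM gM kr; apply: (le_trans _ rhoM_r); apply: abspB_le; first exact: abspM_le.
by rewrite (mulrC g); exact: abspM_le.
Qed.

Lemma minor2C n (A : 'M[Qp]_(2, n)) i j : absp (minor2 A j i) = absp (minor2 A i j).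
Proof. by rewrite /minor2 abspBC. Qed.

(** Up to sign a minor is 0, 1, an entry of w, a Hessian coefficient, an entry of the last block,
    the determinant of that block, or a difference of two products of an entry of w with one of the
    block; only the last kind requires [rhoM_r]. *)
Lemma height_plucker_le : height (plucker X y u v a b c d) <= r.
Proof.
apply: height_le => // i j.
wlog ij : i j / (i <= j)%N => [Hw|].
  by have [/Hw//|/ltnW/Hw] := leqP i j; rewrite minor2C.
have N (e : Qp) s : absp e <= s -> absp (- e) <= s by rewrite abspN.
move: r1 (le_trans Xrho rho_r) (le_trans yrho rho_r) (le_trans urho rho_r)
  (le_trans vrho rho_r) (le_trans h0M M_r) (le_trans h1M M_r) (le_trans h2M M_r)
  (le_trans aM M_r) (le_trans bM M_r) (le_trans cM M_r) (le_trans dM M_r)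
  => ? Xr yr ur vr h0r h1r h2r ar br cr dr.
have zr : absp (0 : Qp) <= r by rewrite absp0.
have or : absp (1 : Qp) <= r by rewrite absp1.
have use (e f : Qp) : absp f <= r -> e = f -> absp e <= r by move=> + ->.
case: i ij => [[|[|[|[|[|[|[|[|//]]]]]]]] ?];
case: j => [[|[|[|[|[|[|[|[|//]]]]]]]] ?] //= _; rewrite /minor2 !mxE /=;
first [
  by apply: (use _ _ zr); ring | by apply: (use _ _ or); ring |
  by apply: (use _ _ Xr); ring | by apply: (use _ _ yr); ring |
  by apply: (use _ _ (N _ _ yr)); ring |
  by apply: (use _ _ ur); ring | by apply: (use _ _ (N _ _ ur)); ring |
  by apply: (use _ _ vr); ring | by apply: (use _ _ (N _ _ vr)); ring |
  by apply: (use _ _ (N _ _ Xr)); ring |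
  by apply: (use _ _ ar); ring | by apply: (use _ _ br); ring |
  by apply: (use _ _ (N _ _ ar)); ring | by apply: (use _ _ (N _ _ br)); ring |
  by apply: (use _ _ cr); ring | by apply: (use _ _ dr); ring |
  by apply: (use _ _ h0r); rewrite /hs0; ring |
  by apply: (use _ _ h1r); rewrite /hs1; ring |
  by apply: (use _ _ h2r); rewrite /hs2; ring |
  by apply: (use _ _ (N _ _ h0r)); rewrite /hs0; ring |
  by apply: (use _ _ (N _ _ h1r)); rewrite /hs1; ring |
  by apply: (use _ _ (N _ _ h2r)); rewrite /hs2; ring |
  by apply: (use _ _ det_r); ring |
  by apply: prod1; rewrite ?abspN ].
Qed.

End Bounds.

End HeisenbergHeight.

Lemma minor2_plucker {R : realType} {p : nat} {K : padicField R p} n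
    (A : 'M[Qp K]_(2, n)) i j k l :
  minor2 A i j * A l k = minor2 A k j * A l i + minor2 A i k * A l j.
Proof.
have [->|->] : l = 0 \/ l = 1.
  by case: l => [[|[|//]] hl]; [left|right]; apply/val_inj.
all: by rewrite /minor2; ring.
Qed.

(** * Exact values of the height *)

Section HeightValues.
Context {R : realType} {p : nat} {K : padicField R p}.
Local Notation Qp := (Qp K).
Hypothesis p_prime : prime p.
Hypothesis p_gt3 : (3 < p)%N.
Local Notation P := (p%:R : R).
Variables (X y u v zeta : Qp).
Local Notation H := (heis_height X y u v zeta).
Local Notation quartic := (quartic X y u v zeta).
Local Notation a := (- zeta - hs1 X y u v / 2).
Local Notation d := (zeta - hs1 X y u v / 2).
Local Notation h0 := (hs0 X y u v).
Local Notation h1 := (hs1 X y u v).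
Local Notation h2 := (hs2 X y u v).

Let p_gt0 : 0 < P. Proof. by rewrite ltr0n prime_gt0. Qed.
Let p_gt1 : 1 < P. Proof. by rewrite ltr1n prime_gt1. Qed.
Let p_ge1 : 1 <= P. Proof. exact: ltW. Qed.

Let absp_half : absp (2^-1 : Qp) = 1.
Proof. by rewrite abspV absp2// invr1. Qed.

Let two0 : 2 != 0 :> Qp. Proof. exact: two_neq0. Qed.
Let four0 : 4 != 0 :> Qp.
Proof. by rewrite (_ : 4 = 2 * 2) ?mulf_neq0//; ring. Qed.

Let det_last : a * d - h0 * h2 = quartic.
Proof. by rewrite /quartic; field; rewrite two0 four0. Qed.

Let le_minor i j : absp (minor2 (heis X y u v zeta) i j) <= H.
Proof. exact: le_height. Qed.

Lemma heis_height_ge1 : 1 <= H.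
Proof.
have := le_minor (inord 0) (inord 1).
by rewrite /minor2 !mxE !inordK//= mul0r subr0 mulr1 absp1.
Qed.

Lemma heis_height_ge_w : [/\ absp X <= H, absp y <= H, absp u <= H & absp v <= H].
Proof.
split.
- have := le_minor (inord 5) (inord 1).
  by rewrite /minor2 !mxE !inordK//= mulr1 mul0r subr0.
- have := le_minor (inord 0) (inord 5).
  by rewrite /minor2 !mxE !inordK//= mulr0 mul1r subr0 abspN.
- have := le_minor (inord 0) (inord 3).
  by rewrite /minor2 !mxE !inordK//= mulr0 mul1r subr0.
- have := le_minor (inord 0) (inord 2).
  by rewrite /minor2 !mxE !inordK//= mulr0 mul1r subr0.
Qed.

Lemma heis_height_ge_quartic : absp quartic <= H.
Proof.
have := le_minor (inord 6) (inord 7).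
by rewrite /minor2 !mxE !inordK//= det_last.
Qed.

Lemma heis_height_le (rho M r : R) : 1 <= r -> rho <= r -> M <= r -> rho * M <= r ->
  absp X <= rho -> absp y <= rho -> absp u <= rho -> absp v <= rho ->
  absp h0 <= M -> absp h1 <= M -> absp h2 <= M -> absp zeta <= M ->
  absp quartic <= r -> H <= r.
Proof.
move=> r1 rr Mr rMr Xr yr ur vr h0M h1M h2M zM qr.
have hM : absp (h1 / 2) <= M by rewrite abspM absp_half mulr1.
apply: (height_plucker_le r1 rr Mr rMr) => //.
- by apply: abspB_le; rewrite ?abspN.
- exact: abspB_le.
- by rewrite det_last.
Qed.

Section Large.
Hypotheses (XP : absp X <= P) (yP : absp y <= P) (uP : absp u <= P) (vP : absp v <= P).

Let hs_le (e f g h : Qp) : absp e <= P -> absp f <= P -> absp g <= P ->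
  absp h <= P -> absp (e * f - g * h) <= P ^+ 2.
Proof. by move=> *; rewrite expr2; apply: abspB_le; exact: abspM_le. Qed.

Lemma hs0_le : absp h0 <= P ^+ 2.
Proof. by rewrite /hs0 (expr2 y); exact: hs_le. Qed.
Lemma hs1_le : absp h1 <= P ^+ 2.
Proof. exact: hs_le. Qed.
Lemma hs2_le : absp h2 <= P ^+ 2.
Proof. by rewrite /hs2 (expr2 u); exact: hs_le. Qed.

Let disc_le : absp ((h1 ^+ 2 - 4 * h0 * h2) / 4) <= P ^+ 4.
Proof.
have -> : (4 : Qp) = 2 * 2 by ring.
have h0' := hs0_le; have h1' := hs1_le; have h2' := hs2_le.
rewrite invfM !abspM absp_half !mulr1 (exprM P 2 2).
apply: abspB_le; first exact: abspX_le.
by rewrite !abspM absp2// !mul1r expr2 ler_pM ?absp_ge0.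
Qed.

(** The discriminant part of [quartic] is at most p^4 < |zeta|^2, so this minor has absolute value
    |zeta|^2, the upper bound obtained from rho = p and M = |zeta|. *)
Lemma heis_height_large_zeta : P ^+ 2 < absp zeta -> H = absp zeta ^+ 2.
Proof.
move=> Pz; have z0 : 0 < absp zeta by rewrite (lt_trans _ Pz)// exprn_gt0.
have Pz1 : P <= absp zeta.
  by rewrite (le_trans _ (ltW Pz))// -[X in X <= _]expr1 ler_weXn2l.
have z1 : 1 <= absp zeta by rewrite (le_trans p_ge1).
have zz : absp zeta <= absp zeta ^+ 2 by rewrite -[X in X <= _]expr1 ler_weXn2l.
have P4 : P ^+ 4 < absp zeta ^+ 2.
  by rewrite (exprM P 2 2) ltr_pXn2r// nnegrE ?exprn_ge0 ?(ltW z0)// ltW.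
have qE : absp quartic = absp zeta ^+ 2.
  by rewrite abspDr abspN abspX// (le_lt_trans disc_le).
apply/eqP; rewrite eq_le -[X in X <= H]qE heis_height_ge_quartic andbT.
have z2 := ltW Pz.
apply: (@heis_height_le P (absp zeta)) => //.
- exact: le_trans zz.
- exact: le_trans zz.
- by rewrite expr2 ler_wpM2r// ltW.
- exact: le_trans hs0_le _.
- exact: le_trans hs1_le _.
- exact: le_trans hs2_le _.
- by rewrite qE.
Qed.

Hypothesis zP : absp zeta <= P ^+ 2.

Let PX i j : (i <= j)%N -> P ^+ i <= P ^+ j.
Proof. by move=> ij; rewrite ler_weXn2l. Qed.

Lemma heis_height_eq4 : absp quartic = P ^+ 4 -> H = P ^+ 4.
Proof.
move=> qE; apply/eqP; rewrite eq_le -{2}qE heis_height_ge_quartic andbT.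
apply: (@heis_height_le P (P ^+ 2)); rewrite ?qE ?hs0_le ?hs1_le ?hs2_le//.
- exact: (PX (i := 0)).
- exact: (PX (i := 1)).
- exact: PX.
- by rewrite -exprS PX.
Qed.

(* The Pluecker relation det(A,B) C = det(C,B) A + det(A,C) B, with A, B among
   the columns of w and C one of the last two, forces a large minor det(A,C) or
   det(C,B). *)
Lemma heis_height_eq3 : absp quartic <= P ^+ 3 ->
  P ^+ 2 <= absp h0 \/ P ^+ 2 <= absp h1 \/ P ^+ 2 <= absp h2 -> H = P ^+ 3.
Proof.
move=> q3 hP; apply/eqP; rewrite eq_le; apply/andP; split.
  apply: (@heis_height_le P (P ^+ 2)); rewrite ?hs0_le ?hs1_le ?hs2_le//.
  - exact: (PX (i := 0)).
  - exact: (PX (i := 1)).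
  - exact: PX.
have rel (i j k : 'I_8) (l : 'I_2) : let A := heis X y u v zeta in
    absp (A l i) <= P -> absp (A l j) <= P ->
    P ^+ 2 <= absp (minor2 A i j) -> P ^+ 2 <= absp (A l k) -> P ^+ 3 <= H.
  move=> A AiP AjP mij Alk.
  have e := minor2_plucker A i j k l.
  rewrite -(ler_pM2r p_gt0) -exprSr (exprM P 2 2) expr2.
  rewrite (le_trans (ler_pM _ _ mij Alk)) ?exprn_ge0 ?(ltW p_gt0)//.
  rewrite -abspM e; apply: abspD_le; apply: abspM_le => //; exact: le_minor.
have i2 : (inord 2 : 'I_8) = 2 :> nat by rewrite inordK.
have i3 : (inord 3 : 'I_8) = 3 :> nat by rewrite inordK.
have i5 : (inord 5 : 'I_8) = 5 :> nat by rewrite inordK.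
have i6 : (inord 6 : 'I_8) = 6 :> nat by rewrite inordK.
have i7 : (inord 7 : 'I_8) = 7 :> nat by rewrite inordK.
case: hP => [h0P|[h1P|h2P]].
- apply: (rel (inord 3) (inord 5) (inord 7) 0).
  + by rewrite mxE i3 /= abspN.
  + by rewrite mxE i5.
  + rewrite /minor2 !mxE i3 i5 /= (_ : _ - _ = - h0) ?abspN//.
    by rewrite /hs0; ring.
  + by rewrite mxE i7.
(* Since h1 = - a - d, a large h1 makes a or d large. *)
- have [Pa|aP] := leP (P ^+ 2) (absp a).
    apply: (rel (inord 2) (inord 5) (inord 6) 0).
    + by rewrite mxE i2 /= abspN.
    + by rewrite mxE i5.
    + rewrite /minor2 !mxE i2 i5 /= (_ : _ - _ = - h1) ?abspN//.
      by rewrite /hs1; ring.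
    + by rewrite mxE i6.
  have Pd : P ^+ 2 <= absp d.
    rewrite leNgt; apply/negP => dP; have := h1P; apply/negP; rewrite -ltNge.
    rewrite (_ : h1 = - a - d); last by field; rewrite two0.
    by rewrite abspB_lt ?abspN.
  apply: (rel (inord 2) (inord 5) (inord 7) 1).
  + by rewrite mxE i2.
  + by rewrite mxE i5 /= abspN.
  + rewrite /minor2 !mxE i2 i5 /= (_ : _ - _ = - h1) ?abspN//.
    by rewrite /hs1; ring.
  + by rewrite mxE i7.
- apply: (rel (inord 2) (inord 3) (inord 6) 1).
  + by rewrite mxE i2.
  + by rewrite mxE i3.
  + rewrite /minor2 !mxE i2 i3 /= (_ : _ - _ = h2)//.
    by rewrite /hs2; ring.
  + by rewrite mxE i6.
Qed.

End Large.

Section Cone.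
Hypotheses (h00 : h0 = 0) (h10 : h1 = 0) (h20 : h2 = 0).

Let quartic_cone : quartic = - zeta ^+ 2.
Proof. by rewrite /quartic h00 h10 h20; ring. Qed.

Lemma heis_height_cone1 : absp X <= P -> absp y <= P -> absp u <= P -> absp v <= P ->
  (P <= absp X \/ P <= absp v) -> absp zeta <= 1 -> H = P.
Proof.
move=> XP yP uP vP wP z1; apply/eqP; rewrite eq_le; apply/andP; split.
  apply: (@heis_height_le P 1); rewrite ?h00 ?h10 ?h20 ?absp0 ?mulr1 ?ler01//.
  by rewrite quartic_cone abspN abspX (le_trans _ p_ge1)// exprn_ile1 ?absp_ge0.
have [XH _ _ vH] := heis_height_ge_w.
by case: wP => [/le_trans|/le_trans]; apply.
Qed.

Lemma heis_height_cone2 : absp X <= P -> absp y <= P -> absp u <= P -> absp v <= P ->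
  absp zeta = P -> H = P ^+ 2.
Proof.
move=> XP yP uP vP zE; apply/eqP; rewrite eq_le; apply/andP; split; last first.
  by rewrite (le_trans _ heis_height_ge_quartic)// quartic_cone abspN abspX zE.
have PP2 : P <= P ^+ 2 by rewrite -[X in X <= _]expr1 ler_weXn2l.
apply: (@heis_height_le P P); rewrite ?h00 ?h10 ?h20 ?absp0 ?zE -?expr2 ?(ltW p_gt0)//.
  exact: le_trans PP2.
by rewrite quartic_cone abspN abspX zE.
Qed.

End Cone.

Lemma heis_height_zero : X = 0 -> y = 0 -> u = 0 -> v = 0 -> absp zeta <= 1 -> H = 1.
Proof.
move=> X0 y0 u0 v0 z1; apply/eqP; rewrite eq_le heis_height_ge1 andbT.
have h00 : h0 = 0 by rewrite /hs0 X0 y0; ring.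
have h10 : h1 = 0 by rewrite /hs1 X0 y0; ring.
have h20 : h2 = 0 by rewrite /hs2 u0 y0; ring.
have qE : quartic = - zeta ^+ 2 by rewrite /quartic h00 h10 h20; ring.
apply: (@heis_height_le 0 1); rewrite ?qE ?h00 ?h10 ?h20 ?absp0 ?mul0r ?ler01 ?X0
    ?y0 ?u0 ?v0 ?absp0//.
by rewrite abspN abspX exprn_ile1 ?absp_ge0.
Qed.

End HeightValues.

(** * Complex powers and additive characters *)

Section ComplexPowers.
Context {R : realType}.
Implicit Types (r : R) (s z w : R[i]).

Lemma cexpD z w : cexp (z + w) = cexp z * cexp w.
Proof.
case: z w => [a b] [c d]; rewrite /cexp /= expRD cosD sinD.
by apply/eqP; rewrite eq_complex /=; apply/andP; split; apply/eqP; ring.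
Qed.

Lemma cexp_real r : cexp r%:C = (expR r)%:C.
Proof. by rewrite /cexp /= cos0 sin0 mulr1 mulr0. Qed.

Lemma cexpMn z n : cexp (n%:R * z) = cexp z ^+ n.
Proof.
elim: n => [|n IH]; first by rewrite mul0r expr0 cexp_real expR0.
by rewrite exprSr -addn1 natrD mulrDl mul1r cexpD IH.
Qed.

Lemma rpowcD r z w : rpowc r (z + w) = rpowc r z * rpowc r w.
Proof. by rewrite /rpowc mulrDl cexpD. Qed.

Lemma rpowc_nat r n : 0 < r -> rpowc r n%:R = (r ^+ n)%:C.
Proof.
move=> r0; rewrite /rpowc cexpMn cexp_real lnK ?posrE//.
by rewrite rmorphXn.
Qed.

Lemma rpowcVX r n s : 0 < r -> rpowc (r ^+ n)^-1 s = rpowc r (- s) ^+ n.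
Proof.
move=> r0; rewrite /rpowc lnV ?posrE ?exprn_gt0// lnXn// -cexpMn.
congr cexp; have -> : (- (ln r *+ n))%:C = - (n%:R * (ln r)%:C) :> R[i].
  by rewrite rmorphN rmorphMn mulr_natl.
by ring.
Qed.

End ComplexPowers.

Section AdditiveCharacter.
Context {R : realType} {p : nat} {K : padicField R p}.
Local Notation Qp := (Qp K).
Hypothesis p_prime : prime p.
Variable psi : Qp -> R[i].
Hypothesis psi_neq0 : forall x, psi x != 0.
Hypothesis psiD : forall x y, psi (x + y) = psi x * psi y.
Hypothesis psi_Zp : forall x, padic_int x -> psi x = 1.
Hypothesis psi_pinvZp : exists x, padic_int (p%:R * x) /\ psi x <> 1.
Implicit Types x : Qp.

(** The character that psi induces on p^-1 Z_p / Z_p, identified with F_p. *)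
Definition chi (c : 'F_p) : R[i] := psi (lift_Fp c / p%:R).

Let p_neq0 : p%:R != 0 :> Qp. Proof. exact: natp_neq0. Qed.

Lemma psi_red x e : absp (x - e / p%:R) <= 1 -> absp e <= 1 -> psi x = chi (red e).
Proof.
move=> xe e1.
have -> : x = (x - e / p%:R) + ((e - lift_Fp (red e)) / p%:R + lift_Fp (red e) / p%:R).
  by field.
rewrite psiD (psi_Zp xe) psiD (psi_Zp (x := _ / _)) ?mul1r//.
have := absp_lt1_le p_prime (redP p_prime e1).
rewrite /padic_int/= abspM abspV absp_p invrK => /(ler_wpM2r (ler0n R p)).
by rewrite mulVf// pnatr_eq0 -lt0n prime_gt0.
Qed.

Lemma chi_red e : absp e <= 1 -> psi (e / p%:R) = chi (red e).
Proof. by move=> e1; apply: psi_red => //; rewrite subrr absp0. Qed.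

Lemma chiD a b : chi (a + b) = chi a * chi b.
Proof.
rewrite /chi -psiD -mulrDl (chi_red (e := lift_Fp a + lift_Fp b));
    last by apply: abspD_le; exact: absp_lift_le1.
by rewrite redD ?absp_lift_le1// !red_lift.
Qed.

Lemma chi_neq0 a : chi a != 0. Proof. exact: psi_neq0. Qed.

Lemma chi_nontrivial : exists c, chi c != 1.
Proof.
have [x [px x1]] := psi_pinvZp; exists (red (p%:R * x)).
by rewrite -chi_red// mulrC mulKf//; apply/eqP.
Qed.

Lemma chi_neq1 a : a != 0 -> chi a != 1.
Proof.
move=> a0; apply/eqP => a1; have [c /eqP[]] := chi_nontrivial.
have chiMn n : chi (n%:R * a) = 1.
  elim: n => [|n IH].
    by rewrite mul0r; apply: (mulIf (chi_neq0 0)); rewrite -chiD addr0 mul1r.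
  by rewrite -addn1 natrD mulrDl mul1r chiD IH a1 mul1r.
by rewrite -[c](divfK a0) -[c / a]natr_Zp chiMn.
Qed.

End AdditiveCharacter.

(** * The outer region *)

Section SymmetricIntegrand.
Context {R : realType} {p : nat} {K : padicField R p}.
Local Notation Qp := (Qp K).
Local Notation borelQp := (borelQp K).
Local Notation borelQp5 := (borelQp * borelQp * borelQp * borelQp * borelQp)%type.
Hypothesis p_prime : prime p.
Hypothesis p_gt3 : (3 < p)%N.
Variable mu : {sigma_finite_measure set borelQp -> \bar R}.
Hypothesis mu_haar : normalized_haar mu.
Local Notation nu := (haar5 mu).
Local Notation P := (p%:R : R).
Local Notation pi := (p%:R : Qp).
Implicit Types (X y u v zeta t : Qp) (c : form 'F_p).

Let p_gt0 : 0 < P. Proof. by rewrite ltr0n prime_gt0. Qed.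
Let p_gt1 : 1 < P. Proof. by rewrite ltr1n prime_gt1. Qed.
Let pi_neq0 : pi != 0. Proof. exact: natp_neq0. Qed.

(** The x for which p^k x is integral with residue a; this ball has measure p^(k-1). *)
Definition dball (k : nat) (a : 'F_p) : set borelQp :=
  cball (lift_Fp a / pi ^+ k) (P ^ (k%:Z - 1)).

Lemma dballP k a (x : Qp) : dball k a x <-> absp (pi ^+ k * x - lift_Fp a) < 1.
Proof.
have pik : pi ^+ k != 0 by rewrite expf_neq0.
have abs_pik : absp (pi ^+ k) = P ^- k by rewrite abspX absp_p exprVn.
rewrite /dball /cball/= (_ : x - lift_Fp a / pi ^+ k = (pi ^+ k * x - lift_Fp a) /
    pi ^+ k);
  last by field.
rewrite abspM abspV abs_pik invrK.
have Pk : (0 : R) < P ^+ k by rewrite exprn_gt0.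
rewrite -ler_pdivlMr// expfzDr ?gt_eqF// -exprnP exprN1 mulrAC divff ?gt_eqF// mul1r.
split=> [xa|/(absp_lt1_le p_prime)//].
by rewrite (le_lt_trans xa)// invf_lt1.
Qed.

Lemma dball_red k a (x : Qp) : dball k a x ->
    absp (pi ^+ k * x) <= 1 /\ red (pi ^+ k * x) = a.
Proof.
move=> /dballP xa; split; last exact: (red_eq p_prime).
by rewrite -[_ * x](subrK (lift_Fp a)) abspD_le ?absp_lift_le1// ltW.
Qed.

Lemma red_dball k (x : Qp) : absp (pi ^+ k * x) <= 1 -> dball k (red (pi ^+ k * x)) x.
Proof. by move=> x1; apply/dballP; exact: redP. Qed.

Lemma measurable_dball k a : measurable (dball k a).
Proof. by apply: measurable_cball => //; exact: exprz_gt0. Qed.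

Lemma haar_dball k a : mu (dball k a) = (P ^ (k%:Z - 1))%:E.
Proof.
apply: (haar_cball p_prime); first exact: haar_translate.
exact: haar_Zp.
Qed.

Definition dbox k c (A : set borelQp) : set borelQp5 := let: (X, y, u, v) := c in
  dball k X `*` dball k y `*` A `*` dball k u `*` dball k v.

Lemma measurable_dbox k c A : measurable A -> measurable (dbox k c A).
Proof.
case: c => [[[X y] u] v] mA.
have md := measurable_dball k.
exact: (measurableX (measurableX (measurableX (measurableX (md X) (md y)) mA) (md
    u)) (md v)).
Qed.

Lemma mem_dbox k c A X y zeta u v : dbox k c A (X, y, zeta, u, v) <->
  [/\ dball k c.1.1.1 X, dball k c.1.1.2 y, A zeta, dball k c.1.2 u & dball k c.2 v].
Proof.
case: c => [[[cX cy] cu] cv] /=; split => [[[[[? ?] ?] ?] ?]//|[? ? ? ? ?]].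
by do !split.
Qed.

Variables s0 s1 s2 s3 : Qp.
Hypotheses (s0_int : absp s0 <= 1) (s1_int : absp s1 <= 1)
  (s2_int : absp s2 <= 1) (s3_int : absp s3 <= 1).
Variable psi : Qp -> R[i].
Hypothesis psi_neq0 : forall x, psi x != 0.
Hypothesis psiD : forall x y, psi (x + y) = psi x * psi y.
Hypothesis psi_Zp : forall x, padic_int x -> psi x = 1.
Hypothesis psi_pinvZp : exists x, padic_int (p%:R * x) /\ psi x <> 1.
Variable s : R[i].

Definition pairQ X y u v := s0 * X + s1 * y + s2 * u + s3 * v.

Definition integrand_sym (t : borelQp5) : R[i] :=
  let: (X, y, zeta, u, v) := t : (Qp * Qp * Qp * Qp * Qp)%type in
  rpowc (heis_height X y u v zeta)^-1 (3 * s) * psi (pairQ X y u v).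

Hypothesis G_int : cintegrable nu setT integrand_sym.

Lemma red_pairQ k c X y u v : dball k c.1.1.1 X -> dball k c.1.1.2 y ->
  dball k c.1.2 u -> dball k c.2 v ->
  red (pairQ (pi ^+ k * X) (pi ^+ k * y) (pi ^+ k * u) (pi ^+ k * v)) =
  pairing (red s0) (red s1) (red s2) (red s3) c.
Proof.
case: c => [[[cX cy] cu] cv] /= /dball_red[X1 <-] /dball_red[y1 <-]
  /dball_red[u1 <-] /dball_red[v1 <-].
move: (pi ^+ k * X) (pi ^+ k * y) (pi ^+ k * u) (pi ^+ k * v) X1 y1 u1 v1 => *.
by rewrite /pairQ !(redD p_prime) ?(redM p_prime)//; zp.
Qed.

Definition int4 k X y u v := [/\ absp (pi ^+ k * X) <= 1, absp (pi ^+ k * y) <= 1,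
  absp (pi ^+ k * u) <= 1 & absp (pi ^+ k * v) <= 1].

Section Twist.
Variables (m : nat) (c : form 'F_p) (d : 'F_p).
Local Notation pim := (pi ^+ m.+2).
Definition near4 X y u v X' y' u' v' := [/\ absp (pim * (X' - X)) < 1,
  absp (pim * (y' - y)) < 1, absp (pim * (u' - u)) < 1 & absp (pim * (v' - v)) < 1].

(** [near4] keeps residues, and integrality of the image implies that of the point, so T preserves
    the box in both directions. The pairing changes by e/p modulo Z_p with e of residue d, so the
    integrand is multiplied by chi(d). *)
Lemma cint_dbox_twist (T : borelQp5 -> borelQp5) : d != 0 -> mpres nu T ->
  (forall X y zeta u v, exists X' y' zeta' u' v', [/\
     T (X, y, zeta, u, v) = (X', y', zeta', u', v'),
     heis_height X' y' u' v' zeta' = heis_height X y u v zeta,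
     int4 m.+2 X y u v -> near4 X y u v X' y' u' v',
     int4 m.+2 X' y' u' v' -> int4 m.+2 X y u v &
     dball m.+2 c.1.1.1 X -> dball m.+2 c.1.1.2 y -> dball m.+2 c.1.2 u ->
       dball m.+2 c.2 v -> exists e, [/\ absp e <= 1, red e = d &
         absp (pairQ X' y' u' v' - pairQ X y u v - e / pi) <= 1]]) ->
  cint nu (dbox m.+2 c setT) integrand_sym = 0.
Proof.
move=> d0 pT TP.
have md : measurable (dbox m.+2 c setT) by exact: measurable_dbox.
apply: (cint_twist pT md G_int (c := chi psi d)).
- move=> [[[[X y] zeta] u] v]; have [X' [y' [zeta' [u' [v' [-> _ near back _]]]]]]
    := TP X y zeta u v.
  have nb (x x' : Qp) : absp (pim * (x' - x)) < 1 ->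
      forall a, dball m.+2 a x' <-> dball m.+2 a x.
    move=> xx' a; split=> /dballP xa; apply/dballP.
      rewrite (_ : pim * x - _ = (pim * x' - lift_Fp a) - pim * (x' - x)); last by ring.
      exact: abspB_lt.
    rewrite (_ : pim * x' - _ = (pim * x - lift_Fp a) + pim * (x' - x)); last by ring.
    exact: abspD_lt.
  have E : int4 m.+2 X y u v -> dbox m.+2 c setT (X', y', zeta', u', v') <->
      dbox m.+2 c setT (X, y, zeta, u, v).
    move=> /near[/nb nX /nb ny /nb nu /nb nv].
    split=> /mem_dbox[DX Dy _ Du Dv]; apply/mem_dbox; split => //;
      by [apply/nX|apply/ny|apply/nu|apply/nv].
  split=> [D'|D].
    apply/E => //; apply: back; move: D' => /mem_dbox[].
    by move=> /dball_red[? _] /dball_red[? _] _ /dball_red[? _] /dball_red[? _].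
  apply/E => //; move: D => /mem_dbox[].
  by move=> /dball_red[? _] /dball_red[? _] _ /dball_red[? _] /dball_red[? _].
- move=> [[[[X y] zeta] u] v] /mem_dbox[DX Dy _ Du Dv].
  have [X' [y' [zeta' [u' [v' [-> HE _ _ /(_ DX Dy Du Dv)[e [e1 ed ee]]]]]]]] := TP
      X y zeta u v.
  rewrite /integrand_sym HE mulrCA; congr (_ * _).
  rewrite -[pairQ X' _ _ _](subrK (pairQ X y u v)) psiD; congr (_ * _).
  by rewrite (psi_red p_prime psiD psi_Zp ee e1) ed.
- exact: (chi_neq1 p_prime psi_neq0 psiD psi_Zp psi_pinvZp).
Qed.

End Twist.

End SymmetricIntegrand.

Ltac measurability p_prime := repeat first [ assumption
  | apply: measurable_cst
  | apply: (measurable_funDQp p_prime)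
  | apply: (measurable_funNQp p_prime)
  | apply: (measurable_funMQp p_prime) ].

Lemma Fp_natr_neq0 (p n : nat) : prime p -> (0 < n < p)%N -> n%:R != 0 :> 'F_p.
Proof.
move=> p_prime /andP[n0 np]; apply/eqP => e; have := val_Fp_nat p_prime n.
by rewrite e /= modn_small// => n0'; rewrite -n0' in n0.
Qed.

Section OuterRegion.
Context {R : realType} {p : nat} {K : padicField R p}.
Local Notation Qp := (Qp K).
Local Notation borelQp := (borelQp K).
Local Notation borelQp5 := (borelQp * borelQp * borelQp * borelQp * borelQp)%type.
Hypothesis p_prime : prime p.
Hypothesis p_gt3 : (3 < p)%N.
Variable mu : {sigma_finite_measure set borelQp -> \bar R}.
Hypothesis mu_haar : normalized_haar mu.
Local Notation nu := (haar5 mu).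
Local Notation P := (p%:R : R).
Local Notation pi := (p%:R : Qp).
Implicit Types (X y u v zeta : Qp).

Let p_gt0 : 0 < P. Proof. by rewrite ltr0n prime_gt0. Qed.
Let p_gt1 : 1 < P. Proof. by rewrite ltr1n prime_gt1. Qed.
Let pi_neq0 : pi != 0. Proof. exact: natp_neq0. Qed.

Variables s0 s1 s2 s3 : Qp.
Hypotheses (s0_int : absp s0 <= 1) (s1_int : absp s1 <= 1)
  (s2_int : absp s2 <= 1) (s3_int : absp s3 <= 1).
Variable psi : Qp -> R[i].
Hypothesis psi_neq0 : forall x, psi x != 0.
Hypothesis psiD : forall x y, psi (x + y) = psi x * psi y.
Hypothesis psi_Zp : forall x, padic_int x -> psi x = 1.
Hypothesis psi_pinvZp : exists x, padic_int (p%:R * x) /\ psi x <> 1.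
Variable s : R[i].
Local Notation G := (integrand_sym s0 s1 s2 s3 psi s).
Hypothesis G_int : cintegrable nu setT G.

Variables (m : nat) (cX cy cu cv : 'F_p).
Local Notation c := ((cX, cy, cu, cv) : form 'F_p).
Local Notation r0 := (red s0).
Local Notation r1 := (red s1).
Local Notation r2 := (red s2).
Local Notation r3 := (red s3).

(* An element of GL_2(Z_p) congruent to 1 modulo tau maps the box to itself and
   changes the pairing, modulo Z_p, by its derivative at c over p. *)
Let tau : Qp := pi ^+ m.+1.

Let tau_lt1 : absp tau < 1.
Proof.
rewrite /tau exprS abspM (le_lt_trans _ (absp_p_lt1 p_prime (K := K)))//.
by rewrite ler_piMr ?absp_ge0// zpX// zp_nat.
Qed.

Let tau_le1 : absp tau <= 1. Proof. exact: ltW. Qed.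

Let pimE : pi ^+ m.+2 = pi * tau. Proof. by rewrite exprS. Qed.

Let tau_lt e : absp e <= 1 -> absp (tau * e) < 1.
Proof.
by move=> e1; rewrite abspM (le_lt_trans _ tau_lt1)// ler_piMr ?absp_ge0.
Qed.

(** Second-order terms are invisible to psi because 2(m + 1) >= m + 2. *)
Let tau2 e : absp (pi ^+ m.+2 * e) <= 1 -> absp (tau ^+ 2 * e) <= 1.
Proof.
move=> e1; have -> : tau ^+ 2 * e = pi ^+ m * (pi ^+ m.+2 * e).
  by rewrite /tau !exprS; ring.
by zp.
Qed.

Let absp1Q : absp (1 : Qp) = 1. Proof. exact: absp1. Qed.

(** To first order [xa tau] shifts the pairing by tau (3 s0 y + 2 s1 u + s2 v), the functional of w
    at g'. *)
Lemma cint_dbox_upper :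
  3 * r0 * cy + 2 * r1 * cu + r2 * cv != 0 -> cint nu (dbox m.+2 c setT) G = 0.
Proof.
(* The rightmost shear acts first; in this triangular order each shear reads only coordinates not
   yet changed. *)
move=> d0; pose T : borelQp5 -> borelQp5 := move4 1 (fun _ _ _ v => tau * v)
  \o move2 1 (fun _ _ u v => 2 * tau * u + tau ^+ 2 * v)
  \o move1 1 (fun y _ u v => 3 * tau * y + 3 * tau ^+ 2 * u + tau ^+ 3 * v).
apply: (cint_dbox_twist p_prime psi_neq0 psiD psi_Zp psi_pinvZp G_int d0 (T := T)).
  apply: mpres_comp; [apply: mpres_comp; [apply: mpres_move4|apply: mpres_move2]|
    apply: mpres_move1] => // *; by measurability p_prime.
move=> X y zeta u v.
exists (X + 3 * tau * y + 3 * tau ^+ 2 * u + tau ^+ 3 * v),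
  (y + 2 * tau * u + tau ^+ 2 * v), zeta, (u + tau * v), v; split.
- by rewrite /T /= /move1 /move2 /move4 /=; congr (_, _, _, _, _); ring.
- exact: heis_height_xa.
- move=> [X1 y1 u1 v1]; split; last by rewrite subrr mulr0 absp0.
  + have -> : pi ^+ m.+2 * (X + 3 * tau * y + 3 * tau ^+ 2 * u + tau ^+ 3 * v - X) =
      tau * (3 * (pi ^+ m.+2 * y) + 3 * tau * (pi ^+ m.+2 * u) + tau ^+ 2 * (pi ^+
          m.+2 * v)) by ring.
    by apply: tau_lt; zp.
  + have -> : pi ^+ m.+2 * (y + 2 * tau * u + tau ^+ 2 * v - y) =
      tau * (2 * (pi ^+ m.+2 * u) + tau * (pi ^+ m.+2 * v)) by ring.
    by apply: tau_lt; zp.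
  + have -> : pi ^+ m.+2 * (u + tau * v - u) = tau * (pi ^+ m.+2 * v) by ring.
    exact: tau_lt.
- move=> [X1 y1 u1 v1].
  have u2 : absp (pi ^+ m.+2 * u) <= 1.
    have -> : pi ^+ m.+2 * u = pi ^+ m.+2 * (u + tau * v) - tau * (pi ^+ m.+2 * v)
        by ring.
    by zp.
  have y2 : absp (pi ^+ m.+2 * y) <= 1.
    have -> : pi ^+ m.+2 * y = pi ^+ m.+2 * (y + 2 * tau * u + tau ^+ 2 * v)
      - (2 * tau * (pi ^+ m.+2 * u) + tau ^+ 2 * (pi ^+ m.+2 * v)) by ring.
    by zp.
  split => //.
  have -> : pi ^+ m.+2 * X = pi ^+ m.+2 * (X + 3 * tau * y + 3 * tau ^+ 2 * u + tau
      ^+ 3 * v)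
    - (3 * tau * (pi ^+ m.+2 * y) + 3 * tau ^+ 2 * (pi ^+ m.+2 * u)
       + tau ^+ 3 * (pi ^+ m.+2 * v)) by ring.
  by zp.
- move=> /(dball_red p_prime)[X1 _] /(dball_red p_prime)[y1 ey].
  move=> /(dball_red p_prime)[u1 eu] /(dball_red p_prime)[v1 ev].
  exists (s0 * (3 * (pi ^+ m.+2 * y)) + s1 * (2 * (pi ^+ m.+2 * u)) + s2 * (pi ^+
      m.+2 * v)).
  split; first by zp.
    move: (pi ^+ m.+2 * y) (pi ^+ m.+2 * u) (pi ^+ m.+2 * v) y1 u1 v1 ey eu ev =>
        Y U V ? ? ? ey eu ev.
    rewrite !(redD p_prime) ?(redM p_prime) ?(red_nat p_prime) //; zp.
    by rewrite ey eu ev /=; ring.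
  rewrite (_ : _ - _ = s0 * (3 * (tau ^+ 2 * u)) + s0 * (tau * (tau ^+ 2 * v))
    + s1 * (tau ^+ 2 * v)); last by rewrite /pairQ pimE; field.
  have u2 := tau2 u1; have v2 := tau2 v1.
  by zp.
Qed.

(** The opposite unipotent [ya tau] gives the functional of w at x (3 g - x g'). *)
Lemma cint_dbox_lower :
  r1 * cX + 2 * r2 * cy + 3 * r3 * cu != 0 -> cint nu (dbox m.+2 c setT) G = 0.
Proof.
move=> d0; pose T : borelQp5 -> borelQp5 := move2 1 (fun X _ _ _ => tau * X)
  \o move4 1 (fun X y _ _ => 2 * tau * y + tau ^+ 2 * X)
  \o move5 1 (fun X y _ u => 3 * tau * u + 3 * tau ^+ 2 * y + tau ^+ 3 * X).
apply: (cint_dbox_twist p_prime psi_neq0 psiD psi_Zp psi_pinvZp G_int d0 (T := T)).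
  apply: mpres_comp; [apply: mpres_comp; [apply: mpres_move2|apply: mpres_move4]|
    apply: mpres_move5] => // *; by measurability p_prime.
move=> X y zeta u v.
exists X, (y + tau * X), zeta, (u + 2 * tau * y + tau ^+ 2 * X),
  (v + 3 * tau * u + 3 * tau ^+ 2 * y + tau ^+ 3 * X); split.
- by rewrite /T /= /move2 /move4 /move5 /=; congr (_, _, _, _, _); ring.
- exact: heis_height_ya.
- move=> [X1 y1 u1 v1]; split; first by rewrite subrr mulr0 absp0.
  + have -> : pi ^+ m.+2 * (y + tau * X - y) = tau * (pi ^+ m.+2 * X) by ring.
    exact: tau_lt.
  + have -> : pi ^+ m.+2 * (u + 2 * tau * y + tau ^+ 2 * X - u) =
      tau * (2 * (pi ^+ m.+2 * y) + tau * (pi ^+ m.+2 * X)) by ring.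
    by apply: tau_lt; zp.
  + have -> : pi ^+ m.+2 * (v + 3 * tau * u + 3 * tau ^+ 2 * y + tau ^+ 3 * X - v) =
      tau * (3 * (pi ^+ m.+2 * u) + 3 * tau * (pi ^+ m.+2 * y) + tau ^+ 2 * (pi ^+
          m.+2 * X)) by ring.
    by apply: tau_lt; zp.
- move=> [X1 y1 u1 v1].
  have y2 : absp (pi ^+ m.+2 * y) <= 1.
    have -> : pi ^+ m.+2 * y = pi ^+ m.+2 * (y + tau * X) - tau * (pi ^+ m.+2 * X)
        by ring.
    by zp.
  have u2 : absp (pi ^+ m.+2 * u) <= 1.
    have -> : pi ^+ m.+2 * u = pi ^+ m.+2 * (u + 2 * tau * y + tau ^+ 2 * X)
      - (2 * tau * (pi ^+ m.+2 * y) + tau ^+ 2 * (pi ^+ m.+2 * X)) by ring.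
    by zp.
  split => //.
  have -> : pi ^+ m.+2 * v = pi ^+ m.+2 * (v + 3 * tau * u + 3 * tau ^+ 2 * y + tau
      ^+ 3 * X)
    - (3 * tau * (pi ^+ m.+2 * u) + 3 * tau ^+ 2 * (pi ^+ m.+2 * y)
       + tau ^+ 3 * (pi ^+ m.+2 * X)) by ring.
  by zp.
- move=> /(dball_red p_prime)[X1 eX] /(dball_red p_prime)[y1 ey].
  move=> /(dball_red p_prime)[u1 eu] /(dball_red p_prime)[v1 _].
  exists (s1 * (pi ^+ m.+2 * X) + s2 * (2 * (pi ^+ m.+2 * y)) + s3 * (3 * (pi ^+
      m.+2 * u))).
  split; first by zp.
    move: (pi ^+ m.+2 * X) (pi ^+ m.+2 * y) (pi ^+ m.+2 * u) X1 y1 u1 eX ey eu =>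
        Y U V ? ? ? eX ey eu.
    rewrite !(redD p_prime) ?(redM p_prime) ?(red_nat p_prime) //; zp.
    by rewrite eX ey eu /=; ring.
  rewrite (_ : _ - _ = s2 * (tau ^+ 2 * X) + s3 * (3 * (tau ^+ 2 * y))
    + s3 * (tau * (tau ^+ 2 * X))); last by rewrite /pairQ pimE; field.
  have X2 := tau2 X1; have y2 := tau2 y1.
  by zp.
Qed.

Let lam : Qp := 1 + tau.

Let lam1 : absp lam = 1.
Proof. by rewrite /lam abspDl absp1. Qed.

Let lam_neq0 : lam != 0. Proof. by rewrite -absp_gt0 lam1. Qed.

Let lamV1 : absp lam^-1 = 1. Proof. by rewrite abspV lam1 invr1. Qed.

Let lam_le1 : absp lam <= 1. Proof. by rewrite lam1. Qed.
Let lamV_le1 : absp lam^-1 <= 1. Proof. by rewrite lamV1. Qed.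

Let near_lam (x : Qp) : absp (pi ^+ m.+2 * x) <= 1 ->
    absp (pi ^+ m.+2 * (lam * x - x)) < 1.
Proof.
move=> x1; have -> : pi ^+ m.+2 * (lam * x - x) = tau * (pi ^+ m.+2 * x) by rewrite
    /lam; ring.
exact: tau_lt.
Qed.

Let back_unit (a x : Qp) : absp a = 1 -> absp (pi ^+ m.+2 * (a * x)) <= 1 ->
  absp (pi ^+ m.+2 * x) <= 1.
Proof. by move=> a1; rewrite !abspM a1 mul1r. Qed.

(** The central torus element with both entries 1/lam scales w by lam and zeta by lam^2, so the
    first-order change is the pairing itself. *)
Lemma cint_dbox_scalar :
  pairing r0 r1 r2 r3 c != 0 -> cint nu (dbox m.+2 c setT) G = 0.
Proof.
move=> d0; pose T : borelQp5 -> borelQp5 :=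
  move1 lam (fun _ _ _ _ => 0) \o move2 lam (fun _ _ _ _ => 0)
  \o move3 (lam ^+ 2) (fun _ _ _ _ => 0) \o move4 lam (fun _ _ _ _ => 0)
  \o move5 lam (fun _ _ _ _ => 0).
have lam21 : absp (lam ^+ 2) = 1 by rewrite abspX lam1 expr1n.
apply: (cint_dbox_twist p_prime psi_neq0 psiD psi_Zp psi_pinvZp G_int d0 (T := T)).
  apply: mpres_comp; [apply: mpres_comp; [apply: mpres_comp; [apply: mpres_comp;
    [apply: mpres_move1|apply: mpres_move2]|apply: mpres_move3]|
    apply: mpres_move4]|apply: mpres_move5] => // *; by measurability p_prime.
move=> X y zeta u v.
exists (lam * X), (lam * y), (lam ^+ 2 * zeta), (lam * u), (lam * v); split.
- by rewrite /T /= /move1 /move2 /move3 /move4 /move5 /= !addr0.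
- rewrite -(heis_height_torus p_prime p_gt3 X y u v zeta lamV1 lamV1).
  by congr (heis_height _ _ _ _ _); field; rewrite ?lam_neq0 ?oner_neq0.
- by move=> [X1 y1 u1 v1]; split; exact: near_lam.
- by move=> [X1 y1 u1 v1]; split; exact: (back_unit lam1).
- move=> DX Dy Du Dv.
  exists (pairQ s0 s1 s2 s3 (pi ^+ m.+2 * X) (pi ^+ m.+2 * y) (pi ^+ m.+2 * u) (pi
      ^+ m.+2 * v)).
  split; last 1 first.
  + rewrite (_ : _ - _ = 0) ?absp0//; by rewrite /pairQ pimE /lam; field.
  + move: DX Dy Du Dv => /(dball_red p_prime)[? _] /(dball_red p_prime)[? _].
    move=> /(dball_red p_prime)[? _] /(dball_red p_prime)[? _].
    by rewrite /pairQ; zp.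
  + by apply: red_pairQ.
Qed.

(** The torus element (1/lam, 1) acts on X, y, u, v with weights 2, 1, 0, -1; its derivative is the
    functional of w at x g' - g. *)
Lemma cint_dbox_diag : 2 * r0 * cX + r1 * cy - r3 * cv != 0 ->
  cint nu (dbox m.+2 c setT) G = 0.
Proof.
move=> d0; pose T : borelQp5 -> borelQp5 :=
  move1 (lam ^+ 2) (fun _ _ _ _ => 0) \o move2 lam (fun _ _ _ _ => 0)
  \o move3 lam (fun _ _ _ _ => 0) \o move5 lam^-1 (fun _ _ _ _ => 0).
have lam21 : absp (lam ^+ 2) = 1 by rewrite abspX lam1 expr1n.
apply: (cint_dbox_twist p_prime psi_neq0 psiD psi_Zp psi_pinvZp G_int d0 (T := T)).
  apply: mpres_comp; [apply: mpres_comp; [apply: mpres_comp;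
    [apply: mpres_move1|apply: mpres_move2]|apply: mpres_move3]|
    apply: mpres_move5] => // *; by measurability p_prime.
move=> X y zeta u v.
exists (lam ^+ 2 * X), (lam * y), (lam * zeta), u, (lam^-1 * v); split.
- by rewrite /T /= /move1 /move2 /move3 /move5 /= !addr0.
- rewrite -(heis_height_torus p_prime p_gt3 X y u v zeta lamV1 absp1Q).
  by congr (heis_height _ _ _ _ _); field; rewrite ?lam_neq0 ?oner_neq0.
- move=> [X1 y1 u1 v1]; split; [|exact: near_lam|by rewrite subrr mulr0 absp0|].
  + have -> : pi ^+ m.+2 * (lam ^+ 2 * X - X) = tau * ((1 + lam) * (pi ^+ m.+2 * X)).
      by rewrite /lam; ring.
    by apply: tau_lt; zp.
  + have -> : pi ^+ m.+2 * (lam^-1 * v - v) = tau * (- lam^-1 * (pi ^+ m.+2 * v)).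
      by rewrite (_ : tau = lam - 1); [field|rewrite /lam; ring].
    by apply: tau_lt; zp.
- by move=> [X1 y1 u1 v1]; split => //;
    [exact: (back_unit lam21)|exact: (back_unit lam1)|exact: (back_unit lamV1)].
- move=> /(dball_red p_prime)[X1 eX] /(dball_red p_prime)[y1 ey].
  move=> /(dball_red p_prime)[u1 _] /(dball_red p_prime)[v1 ev].
  exists (s0 * (2 * (pi ^+ m.+2 * X)) + s1 * (pi ^+ m.+2 * y) - s3 * (pi ^+ m.+2 * v)).
  split; first by zp.
    move: (pi ^+ m.+2 * X) (pi ^+ m.+2 * y) (pi ^+ m.+2 * v) X1 y1 v1 eX ey ev =>
        Y U V ? ? ? eX ey ev.
    rewrite (redB p_prime) ?(redD p_prime) ?(redM p_prime) ?(red_nat p_prime) //; zp.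
    by rewrite eX ey ev /=; ring.
  rewrite (_ : _ - _ = s0 * (tau ^+ 2 * X) + s3 * (lam^-1 * (tau ^+ 2 * v))).
    by have X2 := tau2 X1; have v2 := tau2 v1; zp.
  by rewrite /pairQ pimE /lam; field; rewrite -/lam lam_neq0 pi_neq0.
Qed.

Hypothesis g_irr : irreducible_poly (r3%:P + r2 *: 'X + r1 *: 'X^2 + r0 *: 'X^3).
Hypothesis g_size : size (r3%:P + r2 *: 'X + r1 *: 'X^2 + r0 *: 'X^3) = 4%N.

(** The four twists correspond to a basis of the Lie algebra gl_2; only c = 0 is annihilated by all
    of them. *)
Lemma cint_dbox_neq0 : c != (0, 0, 0, 0) -> cint nu (dbox m.+2 c setT) G = 0.
Proof.
move=> c0; have [e1|/cint_dbox_scalar//] := eqVneq (pairing r0 r1 r2 r3 c) 0.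
have [e2|/cint_dbox_diag//] := eqVneq (2 * r0 * cX + r1 * cy - r3 * cv) 0.
have [e3|/cint_dbox_upper//] := eqVneq (3 * r0 * cy + 2 * r1 * cu + r2 * cv) 0.
have [e4|/cint_dbox_lower//] := eqVneq (r1 * cX + 2 * r2 * cy + 3 * r3 * cu) 0.
have three0 : 3 != 0 :> 'F_p by rewrite Fp_natr_neq0.
have [X0 y0 u0 v0] := annihilator_eq0 g_size g_irr three0 e1 e2 e3 e4.
by case/eqP: c0; rewrite X0 y0 u0 v0.
Qed.

End OuterRegion.

(** * Partition of Q_p^5 into the outer region, large zeta, and cells *)

Section Regions.
Context {R : realType} {p : nat} {K : padicField R p}.
Local Notation Qp := (Qp K).
Local Notation borelQp := (borelQp K).
Local Notation borelQp5 := (borelQp * borelQp * borelQp * borelQp * borelQp)%type.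
Hypothesis p_prime : prime p.
Local Notation P := (p%:R : R).
Local Notation pi := (p%:R : Qp).
Implicit Types (X y u v zeta : Qp) (c : form 'F_p).

Let p_gt0 : 0 < P. Proof. by rewrite ltr0n prime_gt0. Qed.
Let p_gt1 : 1 < P. Proof. by rewrite ltr1n prime_gt1. Qed.
Let pi_neq0 : pi != 0. Proof. exact: natp_neq0. Qed.

Lemma dball_inj k a a' (x : Qp) : dball k a x -> dball k a' x -> a = a'.
Proof. by move=> /(dball_red p_prime)[_ <-] /(dball_red p_prime)[_]. Qed.

Lemma dball_deeper k k' a a' (x : Qp) : (k < k')%N ->
  dball k a x -> dball k' a' x -> a' = 0.
Proof.
move=> kk' /(dball_red p_prime)[xk _] /(dball_red p_prime)[_ <-].
have lt1 : absp (pi ^+ k' * x) < 1.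
  rewrite -(subnK kk') addnS -addSn exprD -mulrA exprS -mulrA abspM.
  by rewrite (le_lt_trans _ (absp_p_lt1 p_prime (K := K)))// ler_piMr ?absp_ge0//; zp.
by apply/eqP; rewrite (red_eq0 p_prime) ?ltW.
Qed.

Lemma dbox_inj k c c' A A' (t : borelQp5) : dbox k c A t -> dbox k c' A' t -> c = c'.
Proof.
case: t c c' => [[[[X y] zeta] u] v] [[[? ?] ?] ?] [[[? ?] ?] ?].
move=> [[[[/= h1 h2] _] h3] h4] [[[[/= k1 k2] _] k3] k4].
by rewrite (dball_inj h1 k1) (dball_inj h2 k2) (dball_inj h3 k3) (dball_inj h4 k4).
Qed.

Lemma dbox_deeper k k' c c' A A' (t : borelQp5) : (k < k')%N ->
  dbox k c A t -> dbox k' c' A' t -> c' = (0, 0, 0, 0).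
Proof.
case: t c c' => [[[[X y] zeta] u] v] [[[? ?] ?] ?] [[[? ?] ?] ?] kk'.
move=> [[[[/= h1 h2] _] h3] h4] [[[[/= k1 k2] _] k3] k4].
by rewrite (dball_deeper kk' h1 k1) (dball_deeper kk' h2 k2)
  (dball_deeper kk' h3 k3) (dball_deeper kk' h4 k4).
Qed.

Lemma dbox_cover k X y zeta u v : int4 k X y u v ->
  exists c, forall A : set borelQp, A zeta -> dbox k c A (X, y, zeta, u, v).
Proof.
move=> [X1 y1 u1 v1].
exists (red (pi ^+ k * X), red (pi ^+ k * y), red (pi ^+ k * u), red (pi ^+ k * v)).
by move=> A Az; apply/mem_dbox; split => //=; exact: red_dball.
Qed.

(* Enumerates the boxes of radius p^(m+1) off the origin, m >= 0, whose union is
   the set where one of X, y, u, v exceeds p in absolute value. *)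
Definition shell (i : nat) : set borelQp5 :=
  if (pickle_inv i : option (nat * form 'F_p)) is Some (m, c)
  then if c == (0, 0, 0, 0) then set0 else dbox m.+2 c setT else set0.

Lemma shellP i t : shell i t -> exists m c,
  [/\ i = pickle (m, c), c != (0, 0, 0, 0) & dbox m.+2 c setT t].
Proof.
rewrite /shell; have := pickle_invK (T := (nat * form 'F_p)%type) i.
case: (pickle_inv _) => //= -[m c] <-.
by case: eqP => // c0 D; exists m, c; split => //; exact/eqP.
Qed.

Lemma measurable_shell i : measurable (shell i).
Proof.
rewrite /shell; case: (pickle_inv _) => [[m c]|//].
by case: ifP => // _; exact: measurable_dbox.
Qed.

Lemma trivIset_shell : trivIset setT shell.
Proof.
move=> i j _ _ [t [/shellP[m [c [-> c0 Dt]]] /shellP[m' [c' [-> c'0 Dt']]]]].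
have [mm'|m'm|mm'] := ltngtP m m'.
- by case/eqP: c'0; apply: dbox_deeper Dt Dt'.
- by case/eqP: c0; apply: dbox_deeper Dt' Dt.
- by rewrite -mm' in Dt' *; rewrite (dbox_inj Dt Dt').
Qed.

Lemma int4_exists X y u v : exists k, int4 k X y u v.
Proof.
have one (x : Qp) : exists k, forall l, (k <= l)%N -> absp (pi ^+ l * x) <= 1.
  have [->|x0] := eqVneq x 0; first by exists 0%N => l _; rewrite mulr0 absp0.
  have [k xk] : exists k : nat, absp x <= P ^+ k.
    have [[k|k] ->] := absp_valueP p_prime x0; first by exists k.
    exists 0%N; rewrite NegzE -exprnN expr0 invf_le1 ?exprn_gt0// exprn_ege1//.
    exact: ltW.
  exists k => l kl; rewrite abspM abspX absp_p exprVn ler_pdivrMl ?exprn_gt0//.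
  by rewrite mulr1 (le_trans xk)// ler_weXn2l// ltW.
have [a aX] := one X; have [b bX] := one y.
have [c cX] := one u; have [d dX] := one v.
by exists (a + b + (c + d))%N; split; [apply: aX|apply: bX|apply: cX|apply: dX]; lia.
Qed.

Lemma shell_cover X y zeta u v : int4 1 X y u v \/ exists i, shell i (X, y, zeta, u, v).
Proof.
pose fits k := [&& absp (pi ^+ k * X) <= 1, absp (pi ^+ k * y) <= 1,
  absp (pi ^+ k * u) <= 1 & absp (pi ^+ k * v) <= 1].
have fitsP k : fits k <-> int4 k X y u v.
  by split=> [/and4P[*]//|[? ? ? ?]]; exact/and4P.
have exfits : exists k, fits k by have [k /fitsP] := int4_exists X y u v; exists k.
(* The least k with p^k w integral: k at most 1 is the inner case, and for k = m + 2 minimality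
   makes the residue nonzero. *)
case: (ex_minnP exfits) => -[|[|m]] /fitsP Im min.
- left; case: Im; rewrite !expr0 !mul1r => X1 y1 u1 v1.
  have pi1 := absp_nat_le1 (K := K) p.
  by split; zp.
- by left.
- right; have [c Dc] := dbox_cover zeta Im; exists (pickle (m, c)).
  rewrite /shell pickleK_inv; case: eqP => [c0|_]; last exact: Dc.
  exfalso; have := min m.+1; rewrite ltnn => absurd; apply/notF/absurd.
  have := Dc setT I; rewrite c0 => /mem_dbox[/= D1 D2 _ D3 D4].
  have small (x : Qp) : dball m.+2 0 x -> absp (pi ^+ m.+1 * x) <= 1.
    move=> /(dballP p_prime); rewrite /lift_Fp/= subr0 => /(absp_lt1_le p_prime).
    rewrite exprS -mulrA abspM absp_p -ler_pdivlMl ?invr_gt0// invrK divff//.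
    by rewrite gt_eqF.
  by apply/fitsP; split; exact: small.
Qed.

Definition far_out : set borelQp5 := \bigcup_i shell i.

Definition far_zeta : set borelQp5 :=
  [set t | int4 1 t.1.1.1.1 t.1.1.1.2 t.1.2 t.2 /\ P ^+ 2 < absp (t.1.1.2 : Qp)].

Definition cell (i : form 'F_p * 'F_p) : set borelQp5 := dbox 1 i.1 (dball 2 i.2).

Definition cells : set borelQp5 :=
  \bigcup_i cell i.

Lemma int4_dbox k c A (t : borelQp5) : dbox k c A t ->
  int4 k t.1.1.1.1 t.1.1.1.2 t.1.2 t.2 /\ A t.1.1.2.
Proof.
case: t => [[[[X y] zeta] u] v] /mem_dbox[] /(dball_red p_prime)[? _].
by move=> /(dball_red p_prime)[? _] ? /(dball_red p_prime)[? _] /(dball_red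
    p_prime)[? _].
Qed.

Lemma absp_le_exp k (x : Qp) : (absp (pi ^+ k * x) <= 1) = (absp x <= P ^+ k).
Proof. by rewrite abspM abspX absp_p exprVn ler_pdivrMl ?exprn_gt0// mulr1. Qed.

Lemma far_zetaE : far_zeta = \bigcup_(c : form 'F_p) dbox 1 c (~` cball 0 (P ^+ 2)).
Proof.
apply/seteqP; split=> [[[[[X y] zeta] u] v] [] /= i4 Pz|t [c _ /int4_dbox[? /= Pz]]].
  have [c Dc] := dbox_cover zeta i4; exists c => //; apply: Dc.
  by rewrite /cball/= subr0; apply/negP; rewrite -ltNge.
by split => //; move: Pz; rewrite /cball/= subr0 => /negP; rewrite -ltNge.
Qed.

Lemma measurable_far_zeta : measurable far_zeta.
Proof.
rewrite far_zetaE; apply: fin_bigcup_measurable; first exact: finite_finset.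
move=> c _; apply: measurable_dbox => //; apply: measurableC.
by apply: measurable_cball; rewrite // exprn_gt0.
Qed.

Lemma measurable_far_out : measurable far_out.
Proof. by apply: bigcup_measurable => i _; exact: measurable_shell. Qed.

Lemma measurable_cell i : measurable (cell i).
Proof. by apply: measurable_dbox => //; exact: measurable_dball. Qed.

Lemma measurable_cells : measurable cells.
Proof.
apply: fin_bigcup_measurable; first exact: finite_finset.
by move=> i _; exact: measurable_cell.
Qed.

Lemma trivIset_cells :
  trivIset setT cell.
Proof.
move=> [c Z] [c' Z'] _ _ [t [/= Dt Dt']]; congr (_, _); first exact: dbox_inj Dt Dt'.
by have [_ /= Dz] := int4_dbox Dt; have [_ /= Dz'] := int4_dbox Dt';
    exact: dball_inj Dz Dz'.
Qed.

Lemma regions_cover : setT = far_out `|` (far_zeta `|` cells).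
Proof.
apply/seteqP; split=> // -[[[[X y] zeta] u] v] _.
have [i4|[i si]] := shell_cover X y zeta u v; last by left; exists i.
right; have [Pz|zP] := ltP (P ^+ 2) (absp (zeta : Qp)); first by left.
have [c Dc] := dbox_cover zeta i4; right.
exists (c, red (pi ^+ 2 * zeta)) => //; apply: Dc.
by apply: (red_dball p_prime); rewrite absp_le_exp.
Qed.

Lemma far_zeta_cells : [disjoint far_zeta & cells].
Proof.
apply/disj_setPS => t [[_ /= Pz] [i _ /int4_dbox[_ /= /(dball_red p_prime)[+ _]]]].
by rewrite absp_le_exp leNgt Pz.
Qed.

Lemma far_out_inner : [disjoint far_out & far_zeta `|` cells].
Proof.
apply/disj_setPS => t [[i _ /shellP[m [c [_ /eqP c0 Dt]]]] Dt']; apply: c0.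
have [c' [A Dc']] : exists c' (A : set borelQp), dbox 1 c' A t.
  by case: Dt' => [|[[c' Z] _ D']]; [rewrite far_zetaE => -[c' _ D']|];
    exists c'; eexists; exact: D'.
exact: dbox_deeper Dc' Dt.
Qed.

End Regions.

(** * The inner boxes *)

Section CellIntegrals.
Context {R : realType} {p : nat} {K : padicField R p}.
Local Notation Qp := (Qp K).
Local Notation borelQp := (borelQp K).
Local Notation borelQp5 := (borelQp * borelQp * borelQp * borelQp * borelQp)%type.
Hypothesis p_prime : prime p.
Hypothesis p_gt3 : (3 < p)%N.
Variable mu : {sigma_finite_measure set borelQp -> \bar R}.
Hypothesis mu_haar : normalized_haar mu.
Local Notation nu := (haar5 mu).
Local Notation P := (p%:R : R).
Local Notation pi := (p%:R : Qp).
Implicit Types (X y u v zeta : Qp) (c : form 'F_p).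

Let p_gt0 : 0 < P. Proof. by rewrite ltr0n prime_gt0. Qed.
Let p_gt1 : 1 < P. Proof. by rewrite ltr1n prime_gt1. Qed.
Let pi_neq0 : pi != 0. Proof. exact: natp_neq0. Qed.

Variables s0 s1 s2 s3 : Qp.
Hypotheses (s0_int : absp s0 <= 1) (s1_int : absp s1 <= 1)
  (s2_int : absp s2 <= 1) (s3_int : absp s3 <= 1).
Variable psi : Qp -> R[i].
Hypothesis psi_neq0 : forall x, psi x != 0.
Hypothesis psiD : forall x y, psi (x + y) = psi x * psi y.
Hypothesis psi_Zp : forall x, padic_int x -> psi x = 1.
Hypothesis psi_pinvZp : exists x, padic_int (p%:R * x) /\ psi x <> 1.
Variable s : R[i].
Local Notation G := (integrand_sym s0 s1 s2 s3 psi s).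
Hypothesis G_int : cintegrable nu setT G.
Local Notation r0 := (red s0).
Local Notation r1 := (red s1).
Local Notation r2 := (red s2).
Local Notation r3 := (red s3).
Local Notation g := (r3%:P + r2 *: 'X + r1 *: 'X^2 + r0 *: 'X^3).
Hypothesis g_irr : irreducible_poly g.
Hypothesis g_size : size g = 4%N.

Let G_intS D : measurable D -> cintegrable nu D G.
Proof. by move=> mD; exact: cintegrableS G_int. Qed.

Lemma cint_far_out : cint nu far_out G = 0.
Proof.
apply: cint_bigcup0; [exact: measurable_shell|exact: trivIset_shell| |].
  by apply: G_intS; exact: measurable_far_out.
have c0 : cint nu (set0 : set borelQp5) G = 0 by rewrite /cint !Rintegral_set0.
move=> i; rewrite /shell; case: (pickle_inv _) => [[m [[[cX cy] cu] cv]]|]//.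
case: eqP => // /eqP cne.
exact: (cint_dbox_neq0 p_prime p_gt3 mu_haar s0_int s1_int s2_int s3_int
  psi_neq0 psiD psi_Zp psi_pinvZp G_int m g_irr g_size cne).
Qed.

Lemma cint_far_zeta : cint nu far_zeta G = 0.
Proof.
pose T : borelQp5 -> borelQp5 := move5 1 (fun _ _ _ _ => pi^-1).
have pT : mpres nu T.
  by apply: mpres_move5 => // *; rewrite ?absp1//; exact: measurable_cst.
have le1 (x : Qp) : (absp (pi * x) <= 1) = (absp x <= P).
  by rewrite -[pi]expr1 absp_le_exp// expr1.
apply: (cint_twist pT _ G_int (c := chi psi r3)).
- exact: measurable_far_zeta.
- move=> [[[[X y] zeta] u] v]; rewrite /T/far_zeta/int4/=.
  suff -> : (absp (pi ^+ 1 * (1 * v + pi^-1)) <= 1) = (absp (pi ^+ 1 * v) <= 1) by [].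
  rewrite expr1 mul1r mulrDr mulfV//; apply/idP/idP => h; last by zp.
  by rewrite -[pi * v](addrK 1); zp.
- move=> [[[[X y] zeta] u] v] [[/= X1 y1 u1 v1] Pz].
  have vT : absp (1 * v + pi^-1) <= P.
    by rewrite mul1r abspD_le ?abspV ?absp_p ?invrK -?le1.
  rewrite !expr1 !le1 in X1 y1 u1 v1.
  rewrite /G/T/= !(heis_height_large_zeta p_prime p_gt3) // mulrCA; congr (_ * _).
  rewrite -(chi_red p_prime psiD psi_Zp)// -psiD; congr psi.
  by rewrite /pairQ mul1r; field.
- apply: (chi_neq1 p_prime psi_neq0 psiD psi_Zp psi_pinvZp).
  (* At 0 the polynomial takes the value r3. *)
  have := g_noroot g_size g_irr 0.
  by rewrite !expr0n /= !mulr0 !add0r.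
Qed.

Section Cell.
Variables (cX cy cu cv Z : 'F_p).
Local Notation c := ((cX, cy, cu, cv) : form 'F_p).
Variables X y zeta u v : Qp.
Hypothesis Dt : cell (c, Z) (X, y, zeta, u, v).

Let mems : [/\ dball 1 cX X, dball 1 cy y, dball 2 Z zeta, dball 1 cu u & dball 1 cv v].
Proof. by have := Dt; rewrite /cell => -[[[[]]]]. Qed.

Lemma psi_cell : psi (pairQ s0 s1 s2 s3 X y u v) = chi psi (pairing r0 r1 r2 r3 c).
Proof.
have [DX Dy _ Du Dv] := mems.
rewrite -(red_pairQ (c := c) p_prime s0_int s1_int s2_int s3_int DX Dy Du Dv) /=.
apply: (psi_red p_prime psiD psi_Zp).
  by rewrite (_ : _ - _ = 0) ?absp0//; rewrite /pairQ expr1; field.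
move: DX Dy Du Dv => /(dball_red p_prime)[? _] /(dball_red p_prime)[? _].
by move=> /(dball_red p_prime)[? _] /(dball_red p_prime)[? _]; rewrite /pairQ; zp.
Qed.

Let p4 : absp (pi ^+ 4) = (P ^+ 4)^-1.
Proof. by rewrite abspX absp_p exprVn. Qed.

Let scaled : exists X1 y1 u1 v1 z1 : Qp,
  [/\ [/\ X = X1 / pi, y = y1 / pi, u = u1 / pi, v = v1 / pi & zeta = z1 / pi ^+ 2],
      [/\ absp X1 <= 1, absp y1 <= 1, absp u1 <= 1, absp v1 <= 1 & absp z1 <= 1] &
      [/\ red X1 = cX, red y1 = cy, red u1 = cu, red v1 = cv & red z1 = Z]].
Proof.
have [/(dball_red p_prime)[? ?] /(dball_red p_prime)[? ?] /(dball_red p_prime)[? ?]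
  /(dball_red p_prime)[? ?] /(dball_red p_prime)[? ?]] := mems.
exists (pi ^+ 1 * X), (pi ^+ 1 * y), (pi ^+ 1 * u), (pi ^+ 1 * v), (pi ^+ 2 * zeta).
by split => //; rewrite expr1; split; field.
Qed.

Let wP : [/\ absp X <= P, absp y <= P, absp u <= P, absp v <= P & absp zeta <= P ^+ 2].
Proof.
have [/(dball_red p_prime)[+ _] /(dball_red p_prime)[+ _] /(dball_red p_prime)[+ _]
  /(dball_red p_prime)[+ _] /(dball_red p_prime)[+ _]] := mems.
by rewrite !(absp_le_exp p_prime) expr1.
Qed.

(** [quartic] is homogeneous of degree 4 for weight 1 on w and weight 2 on zeta; multiplying it by 4
    p^4 gives an integer with the stated residue. *)
Let quarticE : exists e : Qp, [/\ absp e <= 1, red e = disc c - (2 * Z) ^+ 2 &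
  absp (quartic X y u v zeta) = P ^+ 4 * absp e].
Proof.
have [X1 [y1 [u1 [v1 [z1 [[-> -> -> -> ->] [? ? ? ? ?] [<- <- <- <- <-]]]]]]] := scaled.
exists (hs1 X1 y1 u1 v1 ^+ 2 - 4 * hs0 X1 y1 u1 v1 * hs2 X1 y1 u1 v1 - (2 * z1) ^+ 2).
rewrite /hs0 /hs1 /hs2; split; first by zp.
  rewrite /disc /h0 /h1 /h2.
  rewrite !(redB p_prime, redM p_prime, redX p_prime, red_nat p_prime); by [|zp].
set e := _ - (2 * z1) ^+ 2.
have -> : quartic (X1 / pi) (y1 / pi) (u1 / pi) (v1 / pi) (z1 / pi ^+ 2) =
    e / (pi ^+ 4 * (2 * 2)).
  have two0 := two_neq0 p_prime p_gt3 (K := K).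
  have four0 : 4 != 0 :> Qp by rewrite (_ : 4 = 2 * 2) ?mulf_neq0//; ring.
  by rewrite /quartic /hs0 /hs1 /hs2 /e; field; rewrite ?four0 ?two0 ?pi_neq0.
by rewrite abspM abspV abspM [absp (2 * 2)]abspM absp2// p4 !mulr1 invrK mulrC.
Qed.

Lemma heis_height_cell4 : (2 * Z) ^+ 2 != disc c -> heis_height X y u v zeta = P ^+ 4.
Proof.
move=> Zd; have [XP yP uP vP zP] := wP; apply: heis_height_eq4 => //.
have [e [e1 re ->]] := quarticE.
by have := red_neq0 p_prime e1; rewrite re subr_eq0 eq_sym Zd => /esym/eqP ->;
    rewrite mulr1.
Qed.

Lemma heis_height_cell3 : (2 * Z) ^+ 2 = disc c -> ~~ cone c ->
    heis_height X y u v zeta = P ^+ 3.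
Proof.
move=> Zd nc; have [XP yP uP vP zP] := wP; apply: heis_height_eq3 => //.
  have [e [e1 re ->]] := quarticE.
  have := red_eq0 p_prime e1; rewrite re Zd subrr eqxx => /esym/(absp_lt1_le p_prime).
  by rewrite -(ler_pM2l (exprn_gt0 4 p_gt0)) exprSr mulfK ?gt_eqF.
have [X1 [y1 [u1 [v1 [z1 [[-> -> -> -> _] [? ? ? ? ?] [eX ey eu ev _]]]]]]] := scaled.
have sc e : absp e <= 1 -> red e != 0 -> P ^+ 2 <= absp (e / pi ^+ 2).
  move=> e1 /(introT negPn); rewrite red_neq0// negbK => /eqP.
  by rewrite abspM abspV abspX absp_p exprVn invrK => ->; rewrite mul1r.
move: nc; rewrite /cone !negb_and => /or3P[h|h|h]; [left|right; left|right; right].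
- rewrite (_ : hs0 _ _ _ _ = hs0 X1 y1 u1 v1 / pi ^+ 2); last by rewrite /hs0; field.
  apply: sc; rewrite /hs0; first by zp.
  by rewrite !(redB p_prime, redM p_prime, redX p_prime) ?eX ?ey ?eu ?ev//; zp.
- rewrite (_ : hs1 _ _ _ _ = hs1 X1 y1 u1 v1 / pi ^+ 2); last by rewrite /hs1; field.
  apply: sc; rewrite /hs1; first by zp.
  by rewrite !(redB p_prime, redM p_prime, redX p_prime) ?eX ?ey ?eu ?ev//; zp.
- rewrite (_ : hs2 _ _ _ _ = hs2 X1 y1 u1 v1 / pi ^+ 2); last by rewrite /hs2; field.
  apply: sc; rewrite /hs2; first by zp.
  by rewrite !(redB p_prime, redM p_prime, redX p_prime) ?eX ?ey ?eu ?ev//; zp.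
Qed.

End Cell.

End CellIntegrals.

(** * Cells over the cone *)

Section ConeCells.
Context {R : realType} {p : nat} {K : padicField R p}.
Local Notation Qp := (Qp K).
Local Notation borelQp := (borelQp K).
Local Notation borelQp5 := (borelQp * borelQp * borelQp * borelQp * borelQp)%type.
Hypothesis p_prime : prime p.
Hypothesis p_gt3 : (3 < p)%N.
Variable mu : {sigma_finite_measure set borelQp -> \bar R}.
Hypothesis mu_haar : normalized_haar mu.
Local Notation nu := (haar5 mu).
Local Notation P := (p%:R : R).
Local Notation pi := (p%:R : Qp).
Implicit Types (X y u v zeta : Qp) (c : form 'F_p).

Let p_gt0 : 0 < P. Proof. by rewrite ltr0n prime_gt0. Qed.
Let p_gt1 : 1 < P. Proof. by rewrite ltr1n prime_gt1. Qed.
Let pi_neq0 : pi != 0. Proof. exact: natp_neq0. Qed.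

Lemma dball_div (e : Qp) : absp e <= 1 -> dball 1 (red e) (e / pi).
Proof.
move=> e1; apply/(dballP p_prime); rewrite expr1 mulrC divfK//; exact: redP.
Qed.

Lemma absp_lift (a : 'F_p) : a != 0 -> absp (lift_Fp a : Qp) = 1.
Proof.
by move=> a0; apply/eqP; rewrite -(red_neq0 p_prime) ?absp_lift_le1// red_lift.
Qed.

Lemma absp_div_pi (e : Qp) : absp (e / pi) = P * absp e.
Proof. by rewrite abspM abspV absp_p invrK mulrC. Qed.

(** The parametrization of cubes lifts from F_p to Q_p, giving an exact point of the cone in the
    box. The whole box is its translate by integral w, so its heights reduce to heights above this
    point. *)
Lemma cone_lift cX cy cu cv : cone ((cX, cy, cu, cv) : form 'F_p) ->
  exists X0 y0 u0 v0 : Qp, [/\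
    [/\ dball 1 cX X0, dball 1 cy y0, dball 1 cu u0 & dball 1 cv v0],
    [/\ hs0 X0 y0 u0 v0 = 0, hs1 X0 y0 u0 v0 = 0 & hs2 X0 y0 u0 v0 = 0],
    (cX, cy, cu, cv) != (0, 0, 0, 0) -> P <= absp X0 \/ P <= absp v0 &
    (cX, cy, cu, cv) = (0, 0, 0, 0) -> [/\ X0 = 0, y0 = 0, u0 = 0 & v0 = 0]].
Proof.
rewrite /cone /h0 /h1 /h2 !subr_eq0 => /and3P[/eqP e0 /eqP e1 /eqP e2].
have [v_eq0|v_neq0] := eqVneq cv 0.
  have u_eq0 : cu = 0 by apply/eqP; rewrite -sqrf_eq0 -e2 v_eq0 mulr0.
  have y_eq0 : cy = 0 by apply/eqP; rewrite -sqrf_eq0 -e0 u_eq0 mulr0.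
  have d0 : dball 1 0 (0 : Qp).
    by rewrite -(red0 (K := K) p_prime) -[X in dball _ _ X](mul0r pi^-1);
        apply: dball_div; rewrite absp0 ler01.
  exists (lift_Fp cX / pi), 0, 0, 0; rewrite y_eq0 u_eq0 v_eq0; split.
  - split => //; rewrite -{1}(red_lift (K := K) p_prime cX).
    by apply: dball_div; exact: absp_lift_le1.
  - by rewrite /hs0 /hs1 /hs2 expr0n /= !(mulr0, mul0r, subr0).
  - rewrite !xpair_eqE !eqxx !andbT => X0; left.
    by rewrite absp_div_pi absp_lift// mulr1.
  - by case=> ->; rewrite /lift_Fp/= mul0r.
(* The lifted point is b (r^3, r^2, r, 1) / p. *)
pose r : Qp := lift_Fp (cu / cv); pose b : Qp := lift_Fp cv.
have r1 : absp r <= 1 := absp_lift_le1 _; have b1 : absp b <= 1 := absp_lift_le1 _.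
have yE : cy = cv * (cu / cv) ^+ 2.
  by apply: (mulIf v_neq0); rewrite e2; field.
have XE : cX = cv * (cu / cv) ^+ 3.
  by apply: (mulIf v_neq0); rewrite e1 yE; field.
have redE n : red (b * r ^+ n) = cv * (cu / cv) ^+ n.
  by rewrite (redM p_prime) ?(redX p_prime) ?red_lift//; zp.
have D n : dball 1 (cv * (cu / cv) ^+ n) (b * r ^+ n / pi).
  by rewrite -redE; apply: dball_div; zp.
exists (b * r ^+ 3 / pi), (b * r ^+ 2 / pi), (b * r ^+ 1 / pi), (b * r ^+ 0 / pi);
    split.
- rewrite {1}XE {1}yE; split; [exact: D|exact: D| |].
  + by have := D 1%N; rewrite {1}expr1 [cv * _]mulrC divfK.
  + by have := D 0%N; rewrite {1}expr0 mulr1.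
- by rewrite /hs0 /hs1 /hs2; split; field.
- by move=> _; right; rewrite expr0 mulr1 absp_div_pi absp_lift// mulr1.
- by case=> _ _ _ v0; rewrite v0 eqxx in v_neq0.
Qed.

Section ConeCell.
Variables cX cy cu cv : 'F_p.
Local Notation c := ((cX, cy, cu, cv) : form 'F_p).
Variables X0 y0 u0 v0 : Qp.
Hypotheses (DX : dball 1 cX X0) (Dy : dball 1 cy y0) (Du : dball 1 cu u0)
  (Dv : dball 1 cv v0).

(** The alternating cocycle between (X0, y0, u0, v0) and w, by which zeta changes when w is
    translated to that point. *)
Definition tilt X y u v : Qp := (3 * (u0 * y - y0 * u) - (v0 * X - X0 * v)) / 2.

(** The part of the cell where the recentred coordinate zeta - tilt is integral; on the rest of the
    cell it has absolute value p. *)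
Definition core : set borelQp5 :=
  [set t | dbox 1 c setT t /\
     absp ((t.1.1.2 : Qp) - tilt t.1.1.1.1 t.1.1.1.2 t.1.2 t.2) <= 1].

Let absp_half (x : Qp) : absp (x / 2) = absp x.
Proof. by rewrite abspM abspV absp2// invr1 mulr1. Qed.

Let close a (x x0 : Qp) : dball 1 a x0 -> dball 1 a x -> absp (x - x0) <= 1.
Proof.
move=> /(dballP p_prime) x0a /(dballP p_prime) xa.
have := abspB_lt xa x0a; rewrite opprB addrA subrK expr1 -mulrBr.
move=> /(absp_lt1_le p_prime).
by rewrite abspM absp_p -ler_pdivlMl ?invr_gt0// invrK divff ?gt_eqF.
Qed.

Let leP a (x0 : Qp) : dball 1 a x0 -> absp x0 <= P.
Proof. by move=> /(dball_red p_prime)[]; rewrite (absp_le_exp p_prime) expr1. Qed.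

Lemma heis_height_tilt X y u v zeta : dbox 1 c setT (X, y, zeta, u, v) ->
  heis_height X y u v zeta = heis_height X0 y0 u0 v0 (zeta - tilt X y u v).
Proof.
move=> [[[[xX xy] _] xu] xv].
rewrite -(heis_height_n p_prime p_gt3 X0 y0 u0 v0 (zeta - tilt X y u v) (close DX xX)
  (close Dy xy) (close Du xu) (close Dv xv)).
by congr heis_height; rewrite /tilt /=; ring.
Qed.

(** An alternating form is unchanged when w is replaced by its integral difference from the centre,
    so a single factor p survives. *)
Lemma tilt_le X y u v zeta : dbox 1 c setT (X, y, zeta, u,
    v) -> absp (tilt X y u v) <= P.
Proof.
move=> [[[[xX xy] _] xu] xv].
rewrite (_ : tilt X y u v =
  (3 * (u0 * (y - y0) - y0 * (u - u0)) - (v0 * (X - X0) - X0 * (v - v0))) / 2);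
  last by rewrite /tilt; congr (_ / _); ring.
have M (e f : Qp) : absp e <= P -> absp f <= 1 -> absp (e * f) <= P.
  by move=> e1 f1; rewrite -[P]mulr1; exact: abspM_le.
rewrite absp_half; apply: abspB_le; last first.
  by apply: abspB_le; apply: M; [exact: leP Dv|exact: close DX xX|exact: leP
      DX|exact: close Dv xv].
rewrite abspM absp3// mul1r.
by apply: abspB_le; apply: M; [exact: leP Du|exact: close Dy xy|exact: leP
    Dy|exact: close Du xu].
Qed.

Lemma cell0P X y u v zeta : cell (c, 0) (X, y, zeta, u, v) <->
  dbox 1 c setT (X, y, zeta, u, v) /\ absp (zeta - tilt X y u v) <= P.
Proof.
have D0 : dball 2 0 zeta <-> absp zeta <= P.
  rewrite (dballP p_prime) /lift_Fp/= subr0; split=> [/(absp_lt1_le p_prime)|zP].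
    rewrite abspM abspX absp_p exprVn ler_pdivrMl ?exprn_gt0//.
    by rewrite expr2 mulfK ?gt_eqF.
  rewrite abspM abspX absp_p exprVn ltr_pdivrMl ?exprn_gt0// mulr1.
  by rewrite (le_lt_trans zP)// ltr_eXnr.
split=> [|[Dt]].
  move=> /= [[[[xX xy] /D0 zP] xu] xv].
  have Dt : dbox 1 c setT (X, y, zeta, u, v) by do !split.
  by split => //; apply: abspB_le => //; exact: tilt_le Dt.
move=> zl; have zP : absp zeta <= P.
  by rewrite -[zeta](subrK (tilt X y u v)); apply: abspD_le => //; exact: tilt_le Dt.
by move: Dt => /= [[[[xX xy] _] xu] xv]; do !split => //; apply/D0.
Qed.

Lemma core_cell : core `<=` cell (c, 0).
Proof.
move=> [[[[X y] zeta] u] v] [Dt /= z1]; apply/cell0P; split => //.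
by rewrite (le_trans z1)// ltW.
Qed.

(** Subtracting the tilt straightens the core into a product box of measure 1. *)
Let T : borelQp5 -> borelQp5 := move3 1 (fun X y u v => - tilt X y u v).

Let pT : mpres nu T.
Proof.
apply: mpres_move3 => //; first exact: absp1.
by move=> *; rewrite /tilt; measurability p_prime.
Qed.

Let coreE : core = T @^-1` dbox 1 c (cball 0 1).
Proof.
apply/seteqP; split=> [[[[[X y] zeta] u] v]|[[[[X y] zeta] u] v]].
  move=> [/= [[[[xX xy] _] xu] xv] z1]; do !split => //=.
  by rewrite /cball/= subr0 mul1r.
move=> [[[[/= xX xy] z1] xu] xv]; do !split => //=.
by move: z1; rewrite /cball/= subr0 mul1r.
Qed.

Let mbox : measurable (dbox 1 c (cball 0 1) : set borelQp5).
Proof. by apply: measurable_dbox => //; exact: measurable_cball. Qed.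

Lemma measurable_core : measurable core.
Proof.
by rewrite coreE -[X in measurable X]setTI; apply: (mpres_measurable pT).
Qed.

Let haar_dball1 a : mu (dball 1 a) = 1%E.
Proof. by rewrite haar_dball// subrr expr0z. Qed.

Lemma haar_dbox1 (A : set borelQp) cc : measurable A -> nu (dbox 1 cc A) = mu A.
Proof.
case: cc => [[[a1 a2] a3] a4] mA /=.
rewrite haar5_box//; do ?exact: measurable_dball.
by rewrite !haar_dball1 !mul1e !mule1.
Qed.

Lemma haar_core : nu core = 1%E.
Proof.
rewrite coreE (mpresP pT)// haar_dbox1//; last exact: measurable_cball.
exact: haar_Zp.
Qed.

Lemma haar_cell i : nu (cell i) = P%:E.
Proof.
by rewrite /cell haar_dbox1; [rewrite haar_dball// expr1z|exact: measurable_dball].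
Qed.

Lemma haar_rim : nu (cell (c, 0) `\` core) = (P - 1)%:E.
Proof.
have fin : (nu (cell (c, 0%R)) < +oo)%E by rewrite haar_cell ltry.
have := measureD (measurable_cell p_prime (c, 0%R)) measurable_core fin.
rewrite (setIidr core_cell) => e; apply: (etrans e).
by apply: (etrans (congr2 _ (haar_cell (c, 0)) (congr1 _ haar_core))).
Qed.

End ConeCell.

End ConeCells.

(** * Summation over the cells *)

Section CellSums.
Context {R : realType} {p : nat} {K : padicField R p}.
Local Notation Qp := (Qp K).
Local Notation borelQp := (borelQp K).
Local Notation borelQp5 := (borelQp * borelQp * borelQp * borelQp * borelQp)%type.
Hypothesis p_prime : prime p.
Hypothesis p_gt3 : (3 < p)%N.
Variable mu : {sigma_finite_measure set borelQp -> \bar R}.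
Hypothesis mu_haar : normalized_haar mu.
Local Notation nu := (haar5 mu).
Local Notation P := (p%:R : R).
Local Notation pi := (p%:R : Qp).
Implicit Types (X y u v zeta : Qp) (c : form 'F_p).

Let p_gt0 : 0 < P. Proof. by rewrite ltr0n prime_gt0. Qed.
Let p_gt1 : 1 < P. Proof. by rewrite ltr1n prime_gt1. Qed.
Let pi_neq0 : pi != 0. Proof. exact: natp_neq0. Qed.

Variables s0 s1 s2 s3 : Qp.
Hypotheses (s0_int : absp s0 <= 1) (s1_int : absp s1 <= 1)
  (s2_int : absp s2 <= 1) (s3_int : absp s3 <= 1).
Variable psi : Qp -> R[i].
Hypothesis psi_neq0 : forall x, psi x != 0.
Hypothesis psiD : forall x y, psi (x + y) = psi x * psi y.
Hypothesis psi_Zp : forall x, padic_int x -> psi x = 1.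
Hypothesis psi_pinvZp : exists x, padic_int (p%:R * x) /\ psi x <> 1.
Variable s : R[i].
Local Notation G := (integrand_sym s0 s1 s2 s3 psi s).
Hypothesis G_int : cintegrable nu setT G.
Local Notation r0 := (red s0).
Local Notation r1 := (red s1).
Local Notation r2 := (red s2).
Local Notation r3 := (red s3).
Local Notation g := (r3%:P + r2 *: 'X + r1 *: 'X^2 + r0 *: 'X^3).
Hypothesis g_irr : irreducible_poly g.
Hypothesis g_size : size g = 4%N.
Local Notation q := (rpowc P (- (3 * s))).
Local Notation pC := (p%:R : R[i]).
Local Notation chi := (chi psi).
Local Notation pairing := (pairing r0 r1 r2 r3).

Let two_neq0 : 2 != 0 :> 'F_p.
Proof. by apply: Fp_natr_neq0 => //; exact: ltn_trans p_gt3. Qed.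

(** Within a cell psi depends only on c, so on a piece of constant height the integrand is
    constant. *)
Let cint_level D c Z k r : measurable D -> D `<=` cell (c, Z) -> nu D = r%:E ->
  (forall X y zeta u v, D (X, y, zeta, u, v) -> heis_height X y u v zeta = P ^+ k) ->
  cint nu D G = chi (pairing c) * (r%:C * q ^+ k).
Proof.
move=> mD Dc nuD DH.
have -> : cint nu D G = cint nu D (fun=> q ^+ k * chi (pairing c)).
  apply: eq_cint => -[[[[X y] zeta] u] v] Dt.
  rewrite /integrand_sym (DH _ _ _ _ _ Dt) rpowcVX//; congr (_ * _).
  case: c Dc {DH} => [[[cX cy] cu] cv] Dc.
  exact: (psi_cell p_prime s0_int s1_int s2_int s3_int psiD psi_Zp (Dc _ Dt)).
rewrite cint_cst// [nu D]nuD /=; ring.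
Qed.

Lemma cint_cell4 c Z : (2 * Z) ^+ 2 != disc c ->
  cint nu (cell (c, Z)) G = chi (pairing c) * (pC * q ^+ 4).
Proof.
case: c => [[[cX cy] cu] cv] Zd; rewrite -[pC](rmorph_nat (real_complex R)).
apply: (@cint_level _ _ Z) => //; [exact: measurable_cell|exact: haar_cell|].
by move=> X y zeta u v Dt; exact: (heis_height_cell4 p_prime p_gt3 Dt).
Qed.

Lemma cint_cell3 c Z : (2 * Z) ^+ 2 = disc c -> ~~ cone c ->
  cint nu (cell (c, Z)) G = chi (pairing c) * (pC * q ^+ 3).
Proof.
case: c => [[[cX cy] cu] cv] Zd nc; rewrite -[pC](rmorph_nat (real_complex R)).
apply: (@cint_level _ _ Z) => //; [exact: measurable_cell|exact: haar_cell|].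
by move=> X y zeta u v Dt; exact: (heis_height_cell3 p_prime p_gt3 Dt).
Qed.

Lemma cint_cone c : cone c -> cint nu (cell (c, 0)) G =
  chi (pairing c) * ((if c == (0, 0, 0, 0) then 1 else q) + (pC - 1) * q ^+ 2).
Proof.
case: c => [[[cX cy] cu] cv] cc.
have [X0 [y0 [u0 [v0 [[DX Dy Du Dv] [e0 e1 e2] big small]]]]] := cone_lift (K := K)
    p_prime cc.
set c : form 'F_p := (cX, cy, cu, cv).
pose A := core cX cy cu cv X0 y0 u0 v0.
have Ac : A `<=` cell (c, 0) := core_cell p_prime p_gt3 DX Dy Du Dv.
have mA : measurable A := measurable_core p_prime mu_haar cX cy cu cv X0 y0 u0 v0.
have mc : measurable (cell (K := K) (c, 0)) by exact: measurable_cell.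
have mB : measurable (cell (c, 0) `\` A) := measurableD mc mA.
rewrite -[X in cint _ X _](setDUK Ac) cintU//; first last.
  by apply: (cintegrableS measurableT _ _ G_int) => //; exact: measurableU.
  by apply/disj_setPS => t [? []].
have le (a : 'F_p) (x : Qp) : dball 1 a x -> absp x <= P.
  by move=> /(dball_red p_prime)[]; rewrite (absp_le_exp p_prime) expr1.
have [XP yP uP vP] : [/\ absp X0 <= P, absp y0 <= P, absp u0 <= P & absp v0 <= P].
  by split; [exact: le DX|exact: le Dy|exact: le Du|exact: le Dv].
rewrite mulrDr; congr (_ + _).
  have nuA : nu A = 1%:E := haar_core p_prime mu_haar cX cy cu cv X0 y0 u0 v0.
  have [c0|cn0] := eqVneq c (0, 0, 0, 0).
    rewrite -[1 in RHS]mulr1 -[X in _ * (X * _)](rmorph1 (real_complex R)) -[X in _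
        * (_ * X)](expr0 q).
    apply: (@cint_level _ _ 0) => // X y zeta u v [/= Dt z1].
    rewrite (heis_height_tilt p_prime p_gt3 DX Dy Du Dv Dt) expr0.
    by have [*] := small c0; exact: heis_height_zero.
  rewrite -[q in RHS]mul1r -[X in _ * (X * _)](rmorph1 (real_complex R)) -[q in
      RHS]expr1.
  apply: (@cint_level _ _ 0) => // X y zeta u v [/= Dt z1].
  rewrite (heis_height_tilt p_prime p_gt3 DX Dy Du Dv Dt) expr1.
  by apply: heis_height_cone1 => //; exact: big.
have -> : pC - 1 = (P - 1)%:C by rewrite rmorphB rmorph1 rmorph_nat.
apply: (@cint_level _ _ 0) => //; first by exact: haar_rim.
move=> X y zeta u v [/(cell0P p_prime p_gt3 DX Dy Du Dv)[Dt zP] nA].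
rewrite (heis_height_tilt p_prime p_gt3 DX Dy Du Dv Dt).
(* Absolute values are powers of p: a recentred coordinate of absolute value below p would be
   integral and the point would lie in the core. *)
apply: heis_height_cone2 => //; apply/eqP; rewrite eq_le zP /= leNgt; apply/negP => zlt.
apply: nA; split => //=; rewrite -(expr0z P); apply: (absp_lt_le p_prime).
by rewrite add0r expr1z.
Qed.

Let cone_disc c : cone c -> disc c = 0.
Proof.
by rewrite /cone /disc => /and3P[/eqP -> /eqP -> _]; ring.
Qed.

Let cone0 : cone ((0, 0, 0, 0) : form 'F_p).
Proof. by rewrite /cone /h0 /h1 /h2 !mulr0 expr0n /= subr0 eqxx. Qed.

(** The generic value plus successive corrections by indicators, each within the locus of the
    preceding one, so that summing over c and Z leaves plain character sums. On the cone the third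
    term also removes the p q^3 introduced by the second. *)
Lemma cint_cell c Z : cint nu (cell (c, Z)) G =
  chi (pairing c) * (pC * q ^+ 4)
  + (chi (pairing c) *+ ((2 * Z) ^+ 2 == disc c)) * (pC * (q ^+ 3 - q ^+ 4))
  + (chi (pairing c) *+ (cone c && (Z == 0))) * ((pC - 1) * q ^+ 2 + q - pC * q ^+ 3)
  + (1 - q) *+ ((c == (0, 0, 0, 0)) && (Z == 0)).
Proof.
have sqr0 : ((2 * Z) ^+ 2 == 0) = (Z == 0) by rewrite sqrf_eq0 mulf_eq0 (negbTE
    two_neq0).
have [Zd|nZd] := eqVneq ((2 * Z) ^+ 2) (disc c); last first.
  have cZ : cone c && (Z == 0) = false.
    by apply/negP => /andP[/cone_disc d0 Z0]; rewrite d0 sqr0 Z0 in nZd.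
  have c0Z : (c == (0, 0, 0, 0)) && (Z == 0) = false.
    by apply/negP => /andP[/eqP c0 Z0]; rewrite c0 cone0 Z0 in cZ.
  by rewrite cint_cell4// cZ c0Z !mulr0n; ring.
have [cc|nc] := boolP (cone c); last first.
  have c0Z : (c == (0, 0, 0, 0)) && (Z == 0) = false.
    by apply/negP => /andP[/eqP c0 Z0]; rewrite c0 cone0 in nc.
  by rewrite cint_cell3// c0Z !mulr0n !mulr1n; ring.
have Z0 : Z = 0 by apply/eqP; rewrite -sqr0 Zd cone_disc.
rewrite Z0 cint_cone// eqxx andbT; case: eqP => [->|_];
    last by rewrite !mulr0n !mulr1n; ring.
rewrite /pairing !mulr0 !addr0 chi0 ?mulr1n; last 2 first.
- exact: chiD.
- by move=> a; exact: chi_neq0.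
by ring.
Qed.

Let sum_sqrt (d : 'F_p) (x : R[i]) :
  \sum_Z x *+ ((2 * Z) ^+ 2 == d) = x *+ #|[pred Z | Z ^+ 2 == d]|.
Proof.
rewrite sumrMnr; congr (_ *+ _).
rewrite -sum1_card [RHS](reindex (fun Z => 2 * Z)) /=; last first.
  by exists (fun Z => Z / 2) => Z _; field.
by rewrite [RHS]big_mkcond /=; apply: eq_bigr => Z _; rewrite inE; case: eqP.
Qed.

Let sum_one (b : bool) (x : R[i]) : \sum_(Z : 'F_p) x *+ (b && (Z == 0)) = x *+ b.
Proof.
rewrite (bigD1 0)//= eqxx andbT big1 ?addr0// => Z /negbTE ->.
by rewrite andbF mulr0n.
Qed.

(** The four sums that occur are 0 over all forms, p^2 with square roots of the discriminant, -p
    over the cone, and 1 - q from the origin. *)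
Lemma cint_cells : cint nu cells G = (1 - q) * (1 - pC * q) * (1 - pC ^+ 2 * q ^+ 2).
Proof.
rewrite cint_fintype_bigcup; first last.
- by apply: (cintegrableS measurableT _ _ G_int) => //; exact: measurable_cells.
- exact: trivIset_cells.
- exact: measurable_cell.
have cardp : #|'F_p|%:R = pC by rewrite card_Fp.
have chiD' := chiD p_prime psiD psi_Zp.
have chi_nt := chi_nontrivial p_prime psiD psi_Zp psi_pinvZp.
have chi_n0 (a : 'F_p) : chi a != 0 by exact: chi_neq0.
transitivity (\sum_c \sum_Z cint nu (cell (c, Z)) G).
  by rewrite pair_bigA; apply: eq_bigr => -[].
transitivity (\sum_c (chi (pairing c) * (pC * (pC * q ^+ 4))
  + (chi (pairing c) *+ #|[pred Z | Z ^+ 2 == disc c]|) * (pC * (q ^+ 3 - q ^+ 4))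
  + (chi (pairing c) *+ cone c) * ((pC - 1) * q ^+ 2 + q - pC * q ^+ 3)
  + (1 - q) *+ (c == (0, 0, 0, 0)))).
  apply: eq_bigr => c _; under eq_bigr do rewrite cint_cell.
  rewrite !big_split /= -!big_distrl /= sum_sqrt.
  congr (_ + _ + _ * _ + _); [|exact: sum_one|exact: sum_one].
  by rewrite sumr_const -[_ *+ #|_|]mulr_natl cardp; ring.
rewrite !big_split /= -!big_distrl /= (sum_sqrt_disc chiD' chi_nt chi_n0 g_size
    g_irr two_neq0).
have -> : \sum_c chi (pairing c) *+ cone c = - pC.
  rewrite -cardp -(sum_cone chiD' chi_nt chi_n0 g_size g_irr) [RHS]big_mkcond.
  by apply: eq_bigr => c _; case: (cone c).
have -> : \sum_c chi (pairing c) = 0.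
  apply: (sum_form_translate chiD' chi_nt (P := xpredT) (e := (1, 0, 0, 0))) => //=.
  rewrite mulr1 !mulr0 !addr0; exact: s0_neq0 g_size.
have -> : \sum_c (1 - q) *+ (c == (0, 0, 0, 0) :> form 'F_p) = 1 - q.
  rewrite (bigD1 ((0, 0, 0, 0) : form 'F_p))//= big1 ?addr0// => c /negbTE ->.
  by rewrite mulr0n.
by rewrite cardp; ring.
Qed.

End CellSums.

(** * Assembly and return to the original coordinates *)

Lemma cintegral_sym (R : realType) (p : nat) (K : padicField R p)
    (mu : {sigma_finite_measure set borelQp K -> \bar R}) (s0 s1 s2 s3 : Qp K)
    (psi : Qp K -> R[i]) (s : R[i]) :
  prime p -> (3 < p)%N -> normalized_haar mu ->
  absp s0 <= 1 -> absp s1 <= 1 -> absp s2 <= 1 -> absp s3 <= 1 ->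
  (forall x, psi x != 0) -> (forall x y, psi (x + y) = psi x * psi y) ->
  (forall x, padic_int x -> psi x = 1) ->
  (exists x, padic_int (p%:R * x) /\ psi x <> 1) ->
  cintegrable (haar5 mu) setT (integrand_sym s0 s1 s2 s3 psi s) ->
  let g := (red s3)%:P + red s2 *: 'X + red s1 *: 'X^2 + red s0 *: 'X^3 in
  irreducible_poly g -> size g = 4%N ->
  cint (haar5 mu) setT (integrand_sym s0 s1 s2 s3 psi s) =
  (1 - rpowc p%:R (- (3 * s))) * (1 - p%:R * rpowc p%:R (- (3 * s))) *
  (1 - p%:R ^+ 2 * rpowc p%:R (- (3 * s)) ^+ 2).
Proof.
move=> p_prime p_gt3 mu_haar i0 i1 i2 i3 psi_neq0 psiD psi_Zp psi_pinvZp G_int g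
    g_irr g_size.
have mO := measurable_far_out (K := K) p_prime.
have mZ := measurable_far_zeta (K := K) p_prime.
have mC := measurable_cells (K := K) p_prime.
have mZC := measurableU _ _ mZ mC.
have sub D : measurable D -> cintegrable (haar5 mu) D (integrand_sym s0 s1 s2 s3 psi s).
  by move=> mD; exact: cintegrableS G_int.
rewrite (regions_cover (K := K) p_prime) cintU//; first last.
- by apply: sub; exact: measurableU.
- exact: far_out_inner.
rewrite cintU//; first last.
- exact: sub.
- exact: far_zeta_cells.
rewrite cint_far_out// cint_far_zeta// !add0r.
exact: cint_cells.
Qed.

Lemma map_reduction_g_sigma (R : realType) (p : nat) (K : padicField R p)
    (a1 a2 a3 a4 : Qp K) : prime p ->
  map_poly (@reduction R p K) (g_sigma a1 a2 a3 a4) =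
  (red a4)%:P + red a3 *: 'X + red a2 *: 'X^2 + red (- a1) *: 'X^3.
Proof.
move=> p_prime; apply/polyP => i; rewrite coef_map_id0; last exact: red0.
rewrite /g_sigma !(coefD, coefB, coefN, coefC, coefZ, coefX, coefXn).
case: i => [|[|[|[|i]]]] /=; rewrite ?(mulr0, mulr1, addr0, add0r, subr0)//.
by rewrite oppr0; exact: red0.
Qed.

Theorem theorem3 (R : realType) (p : nat) (p_prime : prime p)
    (p_mod6 : p = 5 %[mod 6]) (K : padicField R p)
    (mu : {sigma_finite_measure set (borelQp K) -> \bar R})
    (mu_haar : normalized_haar mu)
    (a1 a2 a3 a4 : Qp K)
    (a1_int : padic_int a1) (a2_int : padic_int a2)
    (a3_int : padic_int a3) (a4_int : padic_int a4)
    (g_cubic : size (map_poly (@reduction R p K) (g_sigma a1 a2 a3 a4)) = 4%N)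
    (g_irr : irreducible_poly
               (map_poly (@reduction R p K) (g_sigma a1 a2 a3 a4)))
    (psi : Qp K -> R[i])
    (psi_neq0 : forall x, psi x != 0)
    (psiD : forall x y, psi (x + y) = psi x * psi y)
    (psi_cont : continuous (psi : Qp K -> R[i]^o))
    (psi_Zp : forall x, padic_int x -> psi x = 1)
    (psi_pinvZp : exists x, padic_int (p%:R * x) /\ psi x <> 1)
    (s : R[i])
    (s_conv : abs_convergent (haar5 mu) (integrand a1 a2 a3 a4 psi s)) :
  cintegral (haar5 mu) (integrand a1 a2 a3 a4 psi s) =
  (1 - rpowc p%:R (- (3 * s))) * (1 - rpowc p%:R (- (3 * s) + 1)) *
  (1 - rpowc p%:R (- (6 * s) + 2)).
Proof.
have p_gt3 : (3 < p)%N by lia.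
have p_gt0 : 0 < p%:R :> R by rewrite ltr0n prime_gt0.
(* The passage from (X, zeta) to (x, z): first x = -X, then z = zeta plus half the cocycle, written
   with the new x. The sign turns the first coefficient into -a1, the leading coefficient of g. *)
pose S : (borelQp K * borelQp K * borelQp K * borelQp K * borelQp K)%type -> _ :=
  move3 1 (fun x y u v => (3 * u * y + v * x) / 2) \o move1 (-1) (fun _ _ _ _ => 0).
have pS : mpres (haar5 mu) S.
  apply: mpres_comp; [apply: mpres_move3|apply: mpres_move1] => // *;
    rewrite ?abspN ?absp1//; by measurability p_prime.
have F_int := abs_convergent_cintegrable s_conv.
have SE X y zeta u v :
    S (X, y, zeta, u, v) = (- X, y, zeta + (3 * u * y - v * X) / 2, u, v).
  rewrite /S /move3 /move1 /=; congr (_, _, _, _, _); ring.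
have FS : integrand a1 a2 a3 a4 psi s \o S = integrand_sym (- a1) a2 a3 a4 psi s.
  apply/funext => -[[[[X y] zeta] u] v].
  rewrite -[LHS]/(integrand a1 a2 a3 a4 psi s (S (X, y, zeta, u, v))).
  rewrite SE /integrand f_circE (heisE p_prime p_gt3); congr (_ * psi _).
  by rewrite /pairQ; ring.
rewrite cintegralE -(cint_mpres pS) // preimage_setT FS.
rewrite (map_reduction_g_sigma _ _ _ _ p_prime) in g_cubic g_irr.
rewrite cintegral_sym ?abspN//; last first.
  by rewrite -FS; exact: cintegrable_mpres.
(* All three factors become polynomials in q = p^(-3s). *)
rewrite (_ : - (6 * s) = - (3 * s) + - (3 * s)); last by ring.
rewrite !rpowcD; set q := rpowc _ (- (3 * s)).
have -> : rpowc (p%:R : R) 1 = p%:R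
  by have := rpowc_nat 1 p_gt0; rewrite mulr1n expr1 rmorph_nat.
ring.
Qed.
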